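(* Let $j:(R, \mathfrak m) \rightarrow (A, \mathfrak n)$ be an algebra retract of Noetherian local rings which admits sections (possibly equal) $p$ and $p'$. Suppose that $I=\ker(p)$ and $I'=\ker(p')$ are nonzero and satisfy $II' = 0$. Consider $I$ and $I'$ as $R$-modules via the retract map $j$. Then: (a) $I$ is a Golod $R$-module if and only if $I'$ is a Golod $R$-module. (b) Let $N$ be a nonzero finitely generated $R$-module, and consider $N$ as an $A$-module via any one of the maps $p, p'$. Then $N$ is a Golod $A$-module if and only if $N$ is a Golod $R$-module and $I$ (equivalently $I'$) is a Golod $R$-module. (c) In particular, $A$ is a Golod ring if and only if $I$ (equivalently $I'$) is a Golod $R$-module.
   Context: All rings are Noetherian local rings with $1\neq 0$, all modules are nonzero and finitely generated, and all homomorphisms of local rings are local. Algebra retract: a ring homomorphism $j:R\to A$ is an algebra retract if there is a ring homomorphism $p:A\to R$ with $p\circ j=\mathrm{id}_R$; such a $p$ is called a section of $j$. Golod modules: let $(R,\mathfrak m,k)$ be a local ring with residue field $k=R/\mathfrak m$ and $M$ an $R$-module. The Poincaré series of $M$ is $P^R_M(t)=\sum_{i\ge 0}\dim_k \operatorname{Tor}^R_i(k,M)\,t^i\in\mathbb Z[|t|]$. Let $K^R$ be the Koszul complex of $R$ on a minimal set of generators of $\mathfrak m$, $K^M=K^R\otimes_R M$, and $H_i(R)=H_i(K^R)$, $H_i(M)=H_i(K^M)$. The Koszul polynomials are $\kappa_R(t)=\sum_i\dim_k H_i(R)t^i$ and $\kappa^R_M(t)=\sum_i\dim_k H_i(M)t^i$.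 One always has the coefficientwise inequality $P^R_M(t)\le \frac{\kappa^R_M(t)}{1-t(\kappa_R(t)-1)}$; $M$ is called a Golod $R$-module if equality holds. The ring $R$ is a Golod ring if its residue field $k$ is a Golod $R$-module. *)

(* Defs.v *)
From HB Require Import structures.
From mathcomp Require Import all_boot all_order all_algebra.
From mathcomp Require Import ring_quotient.
From mathcomp Require Import boolp classical_sets.

Set Implicit Arguments.
Unset Strict Implicit.
Unset Printing Implicit Defensive.

Import GRing.Theory.
Local Open Scope classical_set_scope.
Local Open Scope ring_scope.

Section Ideals.
Variable R : comUnitRingType.

Definition is_ideal (I : set R) :=
  [/\ I 0, forall x y, I x -> I y -> I (x + y) & forall a x, I x -> I (a * x)].

Definition ideal_gen (s : seq R) : set R :=
  [set x | exists c : 'I_(size s) -> R, x = \sum_(i < size s) c i * s`_i].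

End Ideals.

HB.mixin Record isNoethLocal R of GRing.ComUnitRing R := {
  nonunitD : forall x y : R,
    x \isn't a GRing.unit -> y \isn't a GRing.unit -> x + y \isn't a GRing.unit;
  ideal_fg : forall I : set R, is_ideal I -> exists s : seq R, I = ideal_gen s
}.

#[short(type="noethLocalRingType")]
HB.structure Definition NoethLocalRing :=
  {R of isNoethLocal R & GRing.ComUnitRing R}.

Definition local_hom (R A : comUnitRingType) (f : R -> A) :=
  forall x, f x \is a GRing.unit -> x \is a GRing.unit.

Definition max_ideal (R : noethLocalRingType) : {pred R} :=
  [pred x | x \isn't a GRing.unit].

Arguments max_ideal : clear implicits.

Section ResidueField.
Variable R : noethLocalRingType.

Lemma max_ideal_idealr_closed : idealr_closed (max_ideal R).
Proof.
split=> [||a x y]; rewrite !inE ?unitr0 ?unitr1 // => xm ym.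
by apply: nonunitD => //; rewrite unitrM negb_and xm orbT.
Qed.

HB.instance Definition _ :=
  isIdealr.Build R (max_ideal R) max_ideal_idealr_closed.

Definition residue_field := {ideal_quot max_ideal R}.

HB.instance Definition _ := GRing.ComNzRing.on residue_field.

Definition residue_map : R -> residue_field := \pi_residue_field%qT.

Lemma residue_map_zmod_morphism : zmod_morphism residue_map.
Proof. exact: pi_is_zmod_morphism. Qed.

Lemma residue_map_monoid_morphism : monoid_morphism residue_map.
Proof. exact: pi_is_monoid_morphism. Qed.

HB.instance Definition _ := GRing.isZmodMorphism.Build R residue_field
  residue_map residue_map_zmod_morphism.
HB.instance Definition _ := GRing.isMonoidMorphism.Build R residue_field
  residue_map residue_map_monoid_morphism.

Lemma residue_map_eq0 x : (residue_map x == 0) = (x \isn't a GRing.unit).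
Proof.
rewrite -(rmorph0 residue_map) /residue_map.
by have := Quotient.idealrBE (max_ideal R) x 0; rewrite subr0 inE => <-.
Qed.

Definition residue_inv (u : residue_field) : residue_field :=
  if u == 0 then 0 else residue_map (repr u)^-1.

Lemma residue_mulV u : u != 0 -> residue_inv u * u = 1.
Proof.
move=> u0; rewrite /residue_inv (negPf u0).
have ru : residue_map (repr u) = u by exact: reprK.
rewrite -[X in _ * X]ru -rmorphM mulVr ?rmorph1 //.
by move: u0; rewrite -ru residue_map_eq0 negbK ru.
Qed.

Lemma residue_inv0 : residue_inv 0 = 0.
Proof. by rewrite /residue_inv eqxx. Qed.

HB.instance Definition _ :=
  GRing.ComNzRing_isField.Build residue_field residue_mulV residue_inv0.

End ResidueField.

Definition restrict_scalars (A R : nzRingType) (f : {rmorphism A -> R})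
  (N : lmodType R) : Type := N.

Section RestrictScalars.
Variables (A R : nzRingType) (f : {rmorphism A -> R}) (N : lmodType R).
Local Notation fN := (restrict_scalars f N).

HB.instance Definition _ := GRing.Zmodule.on fN.

Let scale (a : A) (x : fN) : fN := f a *: (x : N).

Let scaleA a b x : scale a (scale b x) = scale (a * b) x.
Proof. by rewrite /scale scalerA rmorphM. Qed.

Let scale1 : left_id 1 scale.
Proof. by move=> x; rewrite /scale rmorph1 scale1r. Qed.

Let scaleDr : right_distributive scale +%R.
Proof. by move=> a x y; rewrite /scale scalerDr. Qed.

Let scaleDl x : {morph scale^~ x : a b / a + b}.
Proof. by move=> a b; rewrite /scale rmorphD scalerDl. Qed.

HB.instance Definition _ := GRing.Zmodule_isLmodule.Build A fN
  scaleA scale1 scaleDr scaleDl.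

End RestrictScalars.

Section Kernel.
Variables (A R : nzRingType) (f : {rmorphism A -> R}).

Definition in_kernel : {pred A^o} := [pred x : A^o | f x == 0].

Lemma in_kernel_submod_closed : submod_closed in_kernel.
Proof.
split=> [|a x y]; rewrite !inE ?rmorph0 // => /eqP fx /eqP fy.
by rewrite rmorphD rmorphM fx fy mulr0 addr0.
Qed.

HB.instance Definition _ :=
  GRing.isSubmodClosed.Build A A^o in_kernel in_kernel_submod_closed.

Record kernel := Kernel { kernel_val :> A^o; _ : kernel_val \in in_kernel }.

HB.instance Definition _ := [isSub for kernel_val].
HB.instance Definition _ := [Choice of kernel by <:].
HB.instance Definition _ := [SubChoice_isSubZmodule of kernel by <:].
HB.instance Definition _ := [SubZmodule_isSubLmodule of kernel by <:].

End Kernel.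

Definition fg_module (R : nzRingType) (M : lmodType R) :=
  exists n (v : 'I_n -> M), forall x, exists c : 'I_n -> R,
    x = \sum_(i < n) c i *: v i.

Definition nonzero_module (R : nzRingType) (M : lmodType R) :=
  exists x : M, x != 0.

Section Poincare.
Variables (R : noethLocalRingType) (M : lmodType R).

(* Matrices act on row vectors on the right: the differential R^(rk i.+1) ->
   R^(rk i) is u |-> u *m bd i. *)
Record free_resolution := FreeResolution {
  rk : nat -> nat;
  bd : forall i, 'M[R]_(rk i.+1, rk i);
  aug : {linear 'rV[R]_(rk 0) -> M};
  aug_surj : forall x : M, exists u, aug u = x;
  aug_exact : forall u, aug u = 0 <-> exists w, u = w *m bd 0;
  bd_exact : forall i (u : 'rV[R]_(rk i.+1)),
    u *m bd i = 0 <-> exists w, u = w *m bd i.+1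
}.

Definition residue_bd (F : free_resolution) i :
    'M[residue_field R]_(rk F i.+1, rk F i) :=
  map_mx (@residue_map R) (bd F i).

Definition cycles_dim (F : free_resolution) i :=
  match i with
  | 0 => rk F 0
  | i'.+1 => \rank (kermx (residue_bd F i'))
  end.

(* The set of values of dim_k H_i(k (x) F) over the resolutions F of M by
   finitely generated free modules; it is a singleton when M is finitely
   generated. *)
Definition tor_dims i : set nat :=
  [set d | exists F : free_resolution,
     d = (cycles_dim F i - \rank (residue_bd F i))%N].

Definition tor_dim i : nat := xget 0%N (tor_dims i).

End Poincare.

Section Koszul.
Variables (R : noethLocalRingType) (s : seq R) (M : lmodType R).
Local Notation n := (size s).

(* The chain f stands for the sum of f(S) e_S over the subsets S of
   {0, ..., n-1}, where e_S is the exterior product of the e_j, j in S, taken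
   in increasing order. *)
Definition koszul_chain := {ffun {set 'I_n} -> M}.

Definition koszul_deg i : set koszul_chain :=
  [set f | forall S : {set 'I_n}, #|S| != i -> f S = 0].

(* d e_S is the sum over j in S of (-1)^#|{t in S, t < j}| s_j e_(S - j), so
   that the coefficient of d f at T involves the sets j |: T with j not in T. *)
Definition koszul_bd (f : koszul_chain) : koszul_chain :=
  [ffun T : {set 'I_n} =>
    \sum_(j | j \notin T)
      ((-1) ^+ #|[set t : 'I_n in T | (t < j)%N]| * s`_j) *: f (j |: T)].

Definition koszul_cycles i : set koszul_chain :=
  [set f | koszul_deg i f /\ koszul_bd f = 0].

Definition koszul_boundaries i : set koszul_chain :=
  [set f | exists2 g, koszul_deg i.+1 g & f = koszul_bd g].

End Koszul.

(* The classes of the v i form a k-basis of Z / B, the residue field k acting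
   through representatives in R. *)
Definition residue_basis (R : noethLocalRingType) (V : lmodType R)
    (Z B : set V) d (v : 'I_d -> V) :=
  [/\ forall i, Z (v i),
      forall z, Z z -> exists c : 'I_d -> R, B (z - \sum_(i < d) c i *: v i)
    & forall c : 'I_d -> R, B (\sum_(i < d) c i *: v i) ->
        forall i, c i \in max_ideal R].

Definition residue_dim (R : noethLocalRingType) (V : lmodType R)
    (Z B : set V) : nat :=
  xget 0%N [set d | exists v : 'I_d -> V, residue_basis Z B v].

Section Golod.
Variable R : noethLocalRingType.

Definition minimal_generators (s : seq R) :=
  ideal_gen s = [set x | x \in max_ideal R] /\
  forall i, (i < size s)%N ->
    ideal_gen (take i s ++ drop i.+1 s) <> [set x | x \in max_ideal R].

Definition max_ideal_gens : seq R := xget [::] [set s | minimal_generators s].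

Definition koszul_dim (M : lmodType R) i : nat :=
  residue_dim (koszul_cycles (s := max_ideal_gens) (M := M) i)
              (koszul_boundaries (s := max_ideal_gens) (M := M) i).

Definition koszul_poly (M : lmodType R) : {poly int} :=
  \poly_(i < (size max_ideal_gens).+1) (koszul_dim M i)%:Z.

Definition golod_denominator : {poly int} := 1 - 'X * (koszul_poly R^o - 1).

(* P(t) = kappa_M(t) / (1 - t (kappa_R(t) - 1)) in Z[[t]], with the denominator
   (whose constant term is 1) cleared, coefficient by coefficient. *)
Definition golod (M : lmodType R) :=
  forall n, \sum_(i < n.+1) (tor_dim M i)%:Z * golod_denominator`_(n - i)
            = (koszul_poly M)`_n.

Definition golod_ring := golod (restrict_scalars (@residue_map R) (residue_field R)^o).

End Golod.

(* Main.v *)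
Require Import Defs.
From HB Require Import structures.
From mathcomp Require Import all_boot all_order all_algebra.
From mathcomp Require Import boolp classical_sets.
From mathcomp Require Import zify ring.

(** For an R-module M let P_M and kappa_M be its Poincare and Koszul series, put
    D_R = 1 - t (kappa_R - 1), and define S_M by (1 + t) S_M = kappa_M - D_R P_M.
    Thus M is Golod if and only if S_M = 0 (golod_defect). If R^b -> M is a
    minimal cover with kernel Om, the long exact sequence of Koszul homology says
    that S_M = tau - b + t S_Om, where tau counts the image of H(R^b) in H(M)
    (defect_cover). By induction on the degree, S_M has nonnegative coefficients
    and even bounds the dimensions of the subspace H_+(R) H(M) of H(M)
    (kq_le_defect).

    Because I I' = 0, the ring A acts on I through p' and on I' through p. As
    R-modules, I and I' are both isomorphic to A / j R (kernel_swap), which proves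
    the first claim and shows that P_I = P_I'.

    Poincare series over A. Let N be an R-module, seen as an A-module through p.
    The tensor product over R of a minimal resolution of N over R with one of R
    over A is a minimal resolution of N over A, so that P^A_N = P_N G, where
    G = P^A_R (tor_dim_restrict). The first syzygy of R over A is I, which comes
    from R through p'. Hence G = 1 + t P_I G' and, symmetrically,
    G' = 1 + t P_I G, so that G = G' = 1 / (1 - t P_I) (betti_retract_inv).

    Koszul series over A. Let I have r minimal generators; together with those of
    the maximal ideal of R they generate the maximal ideal of A minimally. The
    former are mapped to 0 by p and into the maximal ideal by p', so that the
    Koszul series over A of N and of I are (1 + t)^r times those over R. There
    remains the exact sequence 0 -> I -> A -> R -> 0, in which the image of H(A)
    in H(R), both over A, has to be found. In positive degrees it avoids H_0(R),
    cycles over A having coefficients in the maximal ideal (imgA_dim_le); and a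
    class which it misses is detected by the connecting map, whose values lie in
    the part H_+(R) H(I) of H(I) (conn_kpos). This gives

      D_A = (1 + t)^r (D_R - t kappa_I) + t (1 + t) s

    with 0 <= s <= ((1 + t)^r - t^r) S_I coefficientwise (retract_koszul).

    Combining the two, N is Golod over A if and only if
    S_N D_A + t kappa_N X = 0, where X = (1 + t)^r S_I - s. The series S_N and
    X >= t^r S_I are nonnegative, and D_A and kappa_N have positive constant terms:
    comparing lowest terms (ps_low_pos), this means that S_N = 0 and S_I = 0,
    which is the second claim (golod_restrict). For the last one, N is the residue
    field k, and a nonzero Golod module M forces k to be Golod: by
    (1 + t)^n P_M <= kappa_M P_k, which is betti_koszul_le, the same comparison of
    lowest terms applies (golod_residue_field). *)

Set Implicit Arguments.
Unset Strict Implicit.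
Unset Printing Implicit Defensive.

Import Order.TTheory GRing.Theory Num.Theory.
Local Open Scope classical_set_scope.
Local Open Scope ring_scope.

(** * Identities in abelian groups *)

Inductive zexpr := ZVar of nat | ZZero | ZAdd of zexpr & zexpr | ZOpp of zexpr.

Section AbelianReflection.
Variable V : zmodType.

Fixpoint zeval (env : seq V) e : V :=
  match e with
  | ZVar k => env`_k | ZZero => 0
  | ZAdd a b => zeval env a + zeval env b | ZOpp a => - zeval env a
  end.

Fixpoint zcoef e (k : nat) : int :=
  match e with
  | ZVar j => (j == k)%:R | ZZero => 0
  | ZAdd a b => zcoef a k + zcoef b k | ZOpp a => - zcoef a k
  end.

Lemma zevalE env e : zeval env e = \sum_(k < size env) env`_k *~ zcoef e k.
Proof.
elim: e => [j||a IHa b IHb|a IHa] /=.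
- case: (ltnP j (size env)) => jn; last first.
    rewrite nth_default // big1 // => k _.
    by rewrite gtn_eqF ?mulr0z // (leq_trans (ltn_ord k)).
  rewrite (bigD1 (Ordinal jn)) //= eqxx mulr1z big1 ?addr0 // => k.
  by rewrite -val_eqE /= eq_sym => /negPf ->; rewrite mulr0z.
- by rewrite big1.
- by rewrite IHa IHb -big_split; apply: eq_bigr => k _; rewrite mulrzDr.
- by rewrite IHa -sumrN; apply: eq_bigr => k _; rewrite mulrNz.
Qed.

(** An identity holds in every abelian group as soon as the integral
    coefficients of each atom agree, which is decided by computation. *)
Lemma zmod_correct env a b :
  all (fun k => zcoef a k == zcoef b k) (iota 0 (size env)) ->
  zeval env a = zeval env b.
Proof.
move=> /allP ab; rewrite !zevalE; apply: eq_bigr => k _.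
by rewrite (eqP (ab k _)) // mem_iota /= add0n.
Qed.

End AbelianReflection.

(** Atoms are compared by unification, so that convertible terms share a
    variable. *)
Ltac zfind x env :=
  match env with
  | ?y :: ?l => let _ := match goal with _ => unify x y end in constr:(0%N)
  | ?y :: ?l => let k := zfind x l in constr:(k.+1)
  end.
Ltac zatoms env t :=
  lazymatch t with
  | (?a + ?b)%R => let e := zatoms env a in zatoms e b
  | (- ?a)%R => zatoms env a
  | 0%R => env
  | _ => match env with
         | _ => let _ := zfind t env in env
         | _ => constr:(t :: env)
         end
  end.
Ltac zreify env t :=
  lazymatch t with
  | (?a + ?b)%R => let x := zreify env a in let y := zreify env b in constr:(ZAdd x y)
  | (- ?a)%R => let x := zreify env a in constr:(ZOpp x)
  | 0%R => constr:(ZZero)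
  | _ => let k := zfind t env in constr:(ZVar k)
  end.
Ltac abelian :=
  lazymatch goal with
  | |- @eq ?T ?a ?b =>
    let e0 := constr:(@nil T) in
    let e1 := zatoms e0 a in let e := zatoms e1 b in
    let x := zreify e a in let y := zreify e b in
    exact: (@zmod_correct _ e x y isT)
  end.

(** * Submodules and semilinear maps *)

Section Submodules.
Variables (R : nzRingType) (V : lmodType R).
Implicit Types U : set V.

Definition submod U := U 0 /\ forall a x y, U x -> U y -> U (a *: x + y).

Lemma submod0 U : submod U -> U 0.
Proof. by case. Qed.

Lemma submodZ U a x : submod U -> U x -> U (a *: x).
Proof. by move=> [U0 UL] Ux; rewrite -[_ *: _]addr0; apply: UL. Qed.

Lemma submodD U x y : submod U -> U x -> U y -> U (x + y).
Proof. by move=> [U0 UL] Ux Uy; rewrite -[x]scale1r; apply: UL. Qed.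

Lemma submodN U x : submod U -> U x -> U (- x).
Proof. by move=> sU Ux; rewrite -scaleN1r; apply: submodZ. Qed.

Lemma submodB U x y : submod U -> U x -> U y -> U (x - y).
Proof. by move=> sU Ux Uy; apply: submodD => //; apply: submodN. Qed.

Lemma submod_subr U x y : submod U -> U (x - y) -> U y -> U x.
Proof. by move=> sU Uxy Uy; rewrite -[x](subrK y); apply: submodD. Qed.

Lemma submod_sum U I (r : seq I) (P : pred I) (F : I -> V) :
  submod U -> (forall i, P i -> U (F i)) -> U (\sum_(i <- r | P i) F i).
Proof.
move=> sU UF; apply: (big_ind (fun x => U x)) => //; first exact: submod0.
by move=> x y; apply: submodD.
Qed.

Lemma submod_setT : submod [set: V].
Proof. by []. Qed.

Lemma submod_set0 : submod [set (0 : V)].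
Proof. by split=> // a x y /= -> ->; rewrite scaler0 addr0. Qed.

Lemma submodI U U' : submod U -> submod U' -> submod (U `&` U').
Proof.
move=> [U0 UL] [U'0 U'L]; split=> // a x y [Ux U'x] [Uy U'y].
by split; [apply: UL | apply: U'L].
Qed.

Definition fgsub U := exists n (v : 'I_n -> V),
  (forall i, U (v i)) /\ forall z, U z -> exists c : 'I_n -> R, z = \sum_i c i *: v i.

Definition fcat T m n (u : 'I_m -> T) (w : 'I_n -> T) (k : 'I_(m + n)) : T :=
  match split k with inl i => u i | inr j => w j end.

Lemma fcatl T m n (u : 'I_m -> T) (w : 'I_n -> T) i : fcat u w (lshift n i) = u i.
Proof. by rewrite /fcat (unsplitK (inl _)). Qed.

Lemma fcatr T m n (u : 'I_m -> T) (w : 'I_n -> T) i : fcat u w (rshift m i) = w i.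
Proof. by rewrite /fcat (unsplitK (inr _)). Qed.

Lemma fcat_all T m n (u : 'I_m -> T) (w : 'I_n -> T) (P : T -> Prop) :
  (forall i, P (u i)) -> (forall i, P (w i)) -> forall k, P (fcat u w k).
Proof. by move=> Pu Pw k; rewrite /fcat; case: split. Qed.

Lemma sum_fcat m n (c : 'I_m -> R) (d : 'I_n -> R) (u : 'I_m -> V) (w : 'I_n -> V) :
  \sum_k fcat c d k *: fcat u w k = \sum_i c i *: u i + \sum_j d j *: w j.
Proof.
rewrite big_split_ord /=; congr (_ + _); apply: eq_bigr => i _.
  by rewrite !fcatl.
by rewrite !fcatr.
Qed.

End Submodules.

Section Semilinear.
Variables (R S : nzRingType) (phi : {rmorphism R -> S}).
Variables (V : lmodType R) (W : lmodType S).

(** Semilinear maps give one statement for linear maps, for base change along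
    the retract j, and for modules restricted along its sections. *)
Definition semilin (f : V -> W) :=
  forall a x y, f (a *: x + y) = phi a *: f x + f y.

Variable f : V -> W.
Hypothesis fl : semilin f.

Lemma semilin0 : f 0 = 0.
Proof.
have := fl 0 0 0; rewrite scaler0 add0r rmorph0 scale0r add0r => _.
have := fl 1 0 0; rewrite scaler0 add0r rmorph1 scale1r => /eqP.
by rewrite -subr_eq subrr eq_sym => /eqP.
Qed.

Lemma semilinD x y : f (x + y) = f x + f y.
Proof. by have := fl 1 x y; rewrite rmorph1 !scale1r. Qed.

Lemma semilinZ a x : f (a *: x) = phi a *: f x.
Proof. by have := fl a x 0; rewrite semilin0 !addr0. Qed.

Lemma semilinN x : f (- x) = - f x.
Proof. by rewrite -scaleN1r semilinZ rmorphN1 scaleN1r. Qed.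

Lemma semilinB x y : f (x - y) = f x - f y.
Proof. by rewrite semilinD semilinN. Qed.

Lemma semilin_sum I (r : seq I) (P : pred I) (F : I -> V) :
  f (\sum_(i <- r | P i) F i) = \sum_(i <- r | P i) f (F i).
Proof.
elim: r => [|i r IH]; first by rewrite !big_nil semilin0.
by rewrite !big_cons; case: (P i); rewrite // semilinD IH.
Qed.

Lemma semilin_preim (U : set W) : submod U -> submod (fun v => U (f v)).
Proof.
move=> sU; split; first by rewrite semilin0; apply: submod0.
by move=> a x y Ux Uy; rewrite fl; apply: submodD => //; apply: submodZ.
Qed.

Lemma semilin_image (Z : set V) (phi_surj : forall b, exists a, phi a = b) :
  submod Z -> submod [set w | exists2 v, Z v & w = f v].
Proof.
move=> sZ; split; first by exists 0; [apply: submod0 | rewrite semilin0].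
move=> b _ _ [v Zv ->] [w Zw ->]; have [a <-] := phi_surj b.
by exists (a *: v + w); [apply: (sZ.2) | rewrite fl].
Qed.

End Semilinear.

Notation lin f := (semilin idfun f).

Lemma linear_lin (R : nzRingType) (V W : lmodType R) (f : {linear V -> W}) : lin f.
Proof. by move=> a x y; rewrite linearP. Qed.

Lemma lin_image (R : nzRingType) (V W : lmodType R) (f : V -> W) (Z : set V) :
  lin f -> submod Z -> submod [set w | exists2 v, Z v & w = f v].
Proof. by move=> fl; apply: (semilin_image fl) => b; exists b. Qed.

Lemma lin_comp (R S : nzRingType) (phi : {rmorphism R -> S}) (V W : lmodType R) (X : lmodType S)
  (f : V -> W) (g : W -> X) : lin f -> semilin phi g -> semilin phi (g \o f).
Proof. by move=> fl gl a x y; rewrite /= fl gl. Qed.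

(** * Noetherian modules *)

Section Noetherian.
Variable R : noethLocalRingType.
Implicit Types V : lmodType R.

Lemma ideal_gen_nth (s : seq R) i : (i < size s)%N -> ideal_gen s s`_i.
Proof.
move=> lti; exists (fun k => (k == Ordinal lti)%:R).
rewrite (bigD1 (Ordinal lti)) //= eqxx mul1r big1 ?addr0 // => k /negPf ->.
by rewrite mul0r.
Qed.

(** Induction on n: the coefficients at v_0 of the elements of U form an ideal,
    finitely many elements of U realise its generators, and these reduce the
    others to the span of v_1, ..., v_(n-1). *)
Lemma noetherian_span V n (v : 'I_n -> V) (U : set V) : submod U ->
  (forall u, U u -> exists c : 'I_n -> R, u = \sum_i c i *: v i) -> fgsub U.
Proof.
elim: n v U => [|n IH] v U sU Uv.
  exists 0%N, v; split; first by case.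
  by move=> z /Uv[c ->]; exists c.
pose v' (i : 'I_n) := v (lift ord0 i).
pose J : set R := [set a | exists c : 'I_n -> R, U (a *: v ord0 + \sum_i c i *: v' i)].
have idJ : is_ideal J.
  split.
  - exists (fun=> 0); rewrite scale0r add0r big1; first exact: submod0.
    by move=> i _; rewrite scale0r.
  - move=> x y [c Uc] [d Ud]; exists (fun i => c i + d i).
    have := submodD sU Uc Ud; rewrite addrACA -scalerDl -big_split /=.
    by under eq_bigr do rewrite -scalerDl.
  - move=> a x [c Uc]; exists (fun i => a * c i).
    have := submodZ a sU Uc; rewrite scalerDr scalerA scaler_sumr.
    by under eq_bigr do rewrite scalerA.
have [s Js] := ideal_fg _ idJ.
have /fin_all_exists[c Uc] : forall i : 'I_(size s), exists c : 'I_n -> R,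
    U (s`_i *: v ord0 + \sum_i c i *: v' i).
  by move=> i; have : J s`_i by rewrite Js; apply: ideal_gen_nth.
pose U' := U `&` [set u | exists c : 'I_n -> R, u = \sum_i c i *: v' i].
have sU' : submod U'.
  apply: submodI => //; split.
    by exists (fun=> 0); rewrite big1 // => i _; rewrite scale0r.
  move=> a _ _ [d ->] [e ->]; exists (fun i => a * d i + e i).
  rewrite scaler_sumr -big_split /=; apply: eq_bigr => i _.
  by rewrite scalerA scalerDl.
have [m [w [Uw wP]]] := IH v' U' sU' (fun u Uu => Uu.2).
pose u (i : 'I_(size s)) := s`_i *: v ord0 + \sum_k c i k *: v' k.
exists (size s + m)%N, (fcat u w); split.
  by apply: fcat_all => i; [apply: Uc | case: (Uw i)].
move=> z Uz; have [d zd] := Uv _ Uz.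
rewrite big_ord_recl -/v' in zd.
have Jd : J (d ord0) by exists (fun i => d (lift ord0 i)); rewrite -zd.
move: Jd; rewrite Js => -[b bP].
have U'zu : U' (z - \sum_i b i *: u i).
  split.
    by apply: submodB => //; apply: submod_sum => // i _; apply: submodZ => //; apply: Uc.
  exists (fun k => d (lift ord0 k) - \sum_i b i * c i k).
  rewrite zd /u; under [X in _ - X = _]eq_bigr do rewrite scalerDr scaler_sumr.
  rewrite big_split /= opprD addrACA bP scaler_suml -sumrB big1 ?add0r; last first.
    by move=> i _; rewrite scalerA subrr.
  rewrite exchange_big -sumrB /=; apply: eq_bigr => k _.
  rewrite scalerBl scaler_suml; congr (_ - _).
  by apply: eq_bigr => i _; rewrite scalerA.
have [e ze] := wP _ U'zu.
by exists (fcat b e); rewrite sum_fcat -ze addrC subrK.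
Qed.

Lemma noetherian V (U : set V) : fg_module V -> submod U -> fgsub U.
Proof. by move=> [n [v vP]] sU; apply: (noetherian_span (v := v)) => // u _; apply: vP. Qed.

End Noetherian.

(** * Dimensions of subquotients killed by the maximal ideal *)

Section Dimension.
Variable R : noethLocalRingType.
Implicit Types V : lmodType R.

Lemma maxE (x : R) : (x \in max_ideal R) = (x \isn't a GRing.unit).
Proof. by []. Qed.

Lemma max0 : (0 : R) \in max_ideal R.
Proof. by rewrite maxE unitr0. Qed.

Lemma maxD (x y : R) : x \in max_ideal R -> y \in max_ideal R -> x + y \in max_ideal R.
Proof. exact: nonunitD. Qed.

Lemma maxMl (a x : R) : x \in max_ideal R -> a * x \in max_ideal R.
Proof. by rewrite !maxE unitrM negb_and => ->; rewrite orbT. Qed.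

Lemma maxMr (a x : R) : x \in max_ideal R -> x * a \in max_ideal R.
Proof. by rewrite mulrC; apply: maxMl. Qed.

Lemma maxN (x : R) : x \in max_ideal R -> - x \in max_ideal R.
Proof. by rewrite !maxE unitrN. Qed.

Lemma max_sum I (r : seq I) (P : pred I) (F : I -> R) :
  (forall i, P i -> F i \in max_ideal R) -> \sum_(i <- r | P i) F i \in max_ideal R.
Proof.
move=> mF; apply: (big_ind (fun x => x \in max_ideal R)) => //; first exact: max0.
exact: maxD.
Qed.

(** After reduction to the residue field, mutually inverse matrices are square. *)
Lemma inverse_mod_max_size a b (C : 'M[R]_(a, b)) (D : 'M[R]_(b, a)) :
    (forall i j, (C *m D - 1%:M) i j \in max_ideal R) ->
    (forall i j, (D *m C - 1%:M) i j \in max_ideal R) -> a = b.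
Proof.
have aux m n (A : 'M[R]_(m, n)) (B : 'M[R]_(n, m)) :
    (forall i j, (A *m B - 1%:M) i j \in max_ideal R) -> (m <= n)%N.
  move=> AB; apply: (@mulmx1_min (residue_field R) _ _
    (map_mx (@residue_map R) A) (map_mx (@residue_map R) B)).
  rewrite -map_mxM; apply/matrixP => i j.
  have := AB i j; rewrite maxE -residue_map_eq0 !mxE rmorphB /= subr_eq0.
  by move/eqP ->; rewrite rmorph_nat.
by move=> CD DC; apply/eqP; rewrite eqn_leq (aux _ _ _ _ CD) (aux _ _ _ _ DC).
Qed.

Variable V : lmodType R.
Implicit Types Z B C : set V.

(** The subquotients Z / B that are vector spaces over the residue field; all
    homology below is of this form. *)
Definition kspace Z B := [/\ submod Z, submod B, B `<=` Z
  & forall a z, a \in max_ideal R -> Z z -> B (a *: z)].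

(** Two bases are expressed in terms of each other by matrices that are inverse
    modulo the maximal ideal. *)
Lemma residue_basis_uniq Z B d e (v : 'I_d -> V) (w : 'I_e -> V) :
  submod B -> residue_basis Z B v -> residue_basis Z B w -> d = e.
Proof.
move=> sB [Zv vs vi] [Zw ws wi].
have /fin_all_exists[C Cw] i := ws _ (Zv i).
have /fin_all_exists[D Dv] i := vs _ (Zw i).
have aux a b (x : 'I_a -> V) (y : 'I_b -> V) (E : 'I_a -> 'I_b -> R) (F : 'I_b -> 'I_a -> R) :
    (forall i, B (x i - \sum_j E i j *: y j)) ->
    (forall i, B (y i - \sum_j F i j *: x j)) ->
    (forall c : 'I_a -> R, B (\sum_i c i *: x i) -> forall i, c i \in max_ideal R) ->
    forall i j, (\matrix_(i, j) E i j *m \matrix_(i, j) F i j - 1%:M) i j \in max_ideal R.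
  move=> Exy Fyx xi i j; rewrite !mxE.
  under eq_bigr do rewrite !mxE.
  apply: (xi (fun j => \sum_k E i k * F k j - (i == j)%:R)).
  under eq_bigr do rewrite scalerBl.
  rewrite sumrB [X in _ - X](bigD1 i) //= eqxx scale1r.
  rewrite [X in _ - (_ + X)]big1 => [|k]; last first.
    by rewrite eq_sym => /negPf->; rewrite scale0r.
  rewrite addr0 -opprB; apply: submodN => //.
  apply: (@submod_subr _ _ _ _ (x i - \sum_j E i j *: y j)) => //.
  rewrite opprB [X in B X]addrC addrA subrK.
  have -> : \sum_k (\sum_l E i l * F l k) *: x k = \sum_l \sum_k (E i l * F l k) *: x k.
    by rewrite exchange_big /=; apply: eq_bigr => k _; rewrite scaler_suml.
  rewrite -sumrB; apply: submod_sum => // k _.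
  have -> : E i k *: y k - \sum_l (E i k * F k l) *: x l = E i k *: (y k - \sum_j F k j *: x j).
    by rewrite scalerBr scaler_sumr; congr (_ - _); apply: eq_bigr => l _; rewrite scalerA.
  exact: submodZ.
apply: inverse_mod_max_size (aux _ _ v w C D Cw Dv vi) (aux _ _ w v D C Dv Cw wi).
Qed.

Lemma residue_dimE Z B d (v : 'I_d -> V) :
  submod B -> residue_basis Z B v -> residue_dim Z B = d.
Proof.
move=> sB vb; rewrite /residue_dim; case: xgetP => [e _ [w wb]|]; last first.
  by move=> /(_ d)[]; exists v.
exact: residue_basis_uniq sB wb vb.
Qed.

(** A relation with a unit coefficient makes one generator redundant. *)
Lemma residue_basis_exists Z B : submod B ->
  fgsub Z -> exists d (v : 'I_d -> V), residue_basis Z B v.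
Proof.
move=> sB [n [v [Zv vs]]].
have {vs}vs z : Z z -> exists c : 'I_n -> R, B (z - \sum_i c i *: v i).
  by move=> /vs[c ->]; exists c; rewrite subrr; apply: submod0.
elim: n v Zv vs => [|n IH] v Zv vs; first by exists 0%N, v; split=> // c _ [].
case: (pselect (forall c : 'I_n.+1 -> R, B (\sum_i c i *: v i) ->
  forall i, c i \in max_ideal R)) => [vi|].
  by exists n.+1, v.
move=> /existsNP[c /not_implyP[Bc /existsNP[i0 /negP]]].
rewrite maxE negbK => ci.
apply: (IH (fun k => v (lift i0 k))) => // z /vs[d Bd].
exists (fun k => d (lift i0 k) - d i0 * (c i0)^-1 * c (lift i0 k)).
have := submodD sB Bd (submodZ (d i0 * (c i0)^-1) sB Bc).
congr (B _); rewrite scaler_sumr -addrA; congr (_ + _).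
rewrite (bigD1_ord i0) //= [X in _ + X](bigD1_ord i0) //=.
rewrite opprD addrACA scalerA mulrVK // addNr add0r -sumrN -big_split /=.
rewrite -sumrN; apply: eq_bigr => k _.
by rewrite scalerBl opprB scalerA addrC.
Qed.

End Dimension.

Section DimensionCalculus.
Variable R : noethLocalRingType.
Variable V : lmodType R.
Hypothesis fgV : fg_module V.
Implicit Types Z B C : set V.

Lemma residue_dimP Z B : kspace Z B ->
  exists v : 'I_(residue_dim Z B) -> V, residue_basis Z B v.
Proof.
move=> [sZ sB _ _]; have [d [v vb]] := residue_basis_exists sB (noetherian fgV sZ).
by rewrite (residue_dimE sB vb); exists v.
Qed.

Lemma kspace_split Z B C : kspace Z B -> submod C -> B `<=` C -> C `<=` Z ->
  kspace Z C /\ kspace C B.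
Proof.
move=> [sZ sB BZ mZ] sC BC CZ; split; split=> // a z am; first by move/(mZ _ _ am)/BC.
by move/CZ; apply: mZ.
Qed.

Lemma residue_dim_add Z B C : kspace Z B -> submod C -> B `<=` C -> C `<=` Z ->
  residue_dim Z B = (residue_dim Z C + residue_dim C B)%N.
Proof.
move=> kZB sC BC CZ; have [kZC kCB] := kspace_split kZB sC BC CZ.
have [v [Zv vs vi]] := residue_dimP kZC.
have [w [Cw ws wi]] := residue_dimP kCB.
have [sZ sB BZ mZ] := kZB.
apply: (residue_dimE (v := fcat v w)) => //; split.
- by apply: fcat_all => // i; apply/CZ/Cw.
- move=> z /vs[c /ws[d Bd]]; exists (fcat c d).
  by rewrite sum_fcat opprD addrA.
move=> c; have -> : c = fcat (fun i => c (lshift _ i)) (fun i => c (rshift _ i)).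
  by apply/funext => k; rewrite /fcat; case: splitP => i ki; congr c; apply/val_inj.
set c1 := fun i => _ (lshift _ i); set c2 := fun i => _ (rshift _ i).
rewrite sum_fcat => Bc.
have c1m : forall i, c1 i \in max_ideal R.
  apply: vi; rewrite -[X in C X](addrK (\sum_j c2 j *: w j)).
  by apply: submodB => //; [apply: BC | apply: submod_sum => // i _; apply: submodZ].
suff c2m : forall i, c2 i \in max_ideal R.
  exact: (fcat_all (P := fun x => x \in max_ideal R)).
apply: (wi c2); rewrite -[X in B X](addKr (\sum_i c1 i *: v i)).
apply: submodD => //; apply: submodN => //; apply: submod_sum => // i _.
exact: mZ.
Qed.

Lemma residue_dim_sub Z Z' B : kspace Z' B -> submod Z -> B `<=` Z -> Z `<=` Z' ->
  (residue_dim Z B <= residue_dim Z' B)%N.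
Proof. by move=> kZ sZ BZ ZZ'; rewrite (residue_dim_add kZ sZ) // leq_addl. Qed.

Lemma residue_dimxx Z : submod Z -> residue_dim Z Z = 0%N.
Proof.
move=> sZ; apply: (residue_dimE (v := fun i : 'I_0 => 0)) => //; split; try by case.
by move=> z Zz; exists (fun=> 0); rewrite big_ord0 subr0.
by move=> c _ [].
Qed.

End DimensionCalculus.

Section DimensionTransport.
Variables (R S : noethLocalRingType) (phi : {rmorphism R -> S}).
Hypothesis phi_surj : forall b, exists a, phi a = b.
Hypothesis phi_local : local_hom phi.
Variables (V : lmodType R) (W : lmodType S) (f : V -> W).
Hypotheses (fgV : fg_module V) (fl : semilin phi f).

Lemma local_max a : (phi a \in max_ideal S) = (a \in max_ideal R).
Proof.
rewrite !maxE; congr (~~ _); apply/idP/idP; first exact: phi_local.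
exact: rmorph_unit.
Qed.

(** The ring is allowed to change along a local surjection: this compares
    dimensions over A with dimensions over R. *)
Lemma residue_dim_iso (Z B : set V) (Z' B' : set W) : kspace Z B -> submod B' ->
  (forall z, Z z -> Z' (f z)) -> (forall z, Z z -> B' (f z) <-> B z) ->
  (forall z', Z' z' -> exists2 z, Z z & B' (z' - f z)) ->
  residue_dim Z' B' = residue_dim Z B.
Proof.
move=> kZ sB' fZ fB fS; have [v [Zv vs vi]] := residue_dimP fgV kZ.
have [sZ sB BZ mZ] := kZ.
have fsum (c : 'I_(residue_dim Z B) -> R) : f (\sum_i c i *: v i) = \sum_i phi (c i) *: f (v i).
  by rewrite (semilin_sum fl); under eq_bigr do rewrite (semilinZ fl).
apply: (residue_dimE (v := fun i => f (v i))) => //; split=> [i|z' /fS[z Zz Bz]|c].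
- exact/fZ/Zv.
- have [c Bc] := vs z Zz; exists (fun i => phi (c i)).
  rewrite -[z'](subrK (f z)) -addrA; apply: submodD => //.
  rewrite -fsum -(semilinB fl); apply/fB => //.
  by apply: submodB => //; apply: submod_sum => // i _; apply: submodZ.
- have /fin_all_exists[c' c'E] i := phi_surj (c i).
  have cE : c = fun i => phi (c' i) by apply/funext.
  rewrite {}cE -fsum => /fB Bc i; rewrite local_max; apply: vi; apply: Bc.
  by apply: submod_sum => // k _; apply: submodZ.
Qed.

End DimensionTransport.

Section DimensionLinear.
Variables (R : noethLocalRingType) (V W : lmodType R) (f : V -> W).
Hypotheses (fgV : fg_module V) (fgW : fg_module W) (fl : lin f).

Lemma residue_dim_liniso (Z B : set V) (Z' B' : set W) : kspace Z B -> submod B' ->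
  (forall z, Z z -> Z' (f z)) -> (forall z, Z z -> B' (f z) <-> B z) ->
  (forall z', Z' z' -> exists2 z, Z z & B' (z' - f z)) ->
  residue_dim Z' B' = residue_dim Z B.
Proof.
by apply: (residue_dim_iso (phi := idfun)) => // b; exists b.
Qed.

Lemma residue_dim_le (Z B : set V) (Z' B' : set W) : kspace Z B -> kspace Z' B' ->
  (forall z, Z z -> Z' (f z)) -> (forall z, Z z -> B' (f z) -> B z) ->
  (residue_dim Z B <= residue_dim Z' B')%N.
Proof.
move=> kZ kZ' fZ fB; have [sZ sB BZ mZ] := kZ; have [sZ' sB' BZ' mZ'] := kZ'.
pose B0 := Z `&` (fun v => B' (f v)).
have kZ0 : kspace Z B0.
  split=> //; first by apply: submodI => //; apply: semilin_preim fl _ _.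
    by move=> v [].
  move=> a z am Zz; split; first exact: submodZ.
  by rewrite (semilinZ fl); apply: mZ' => //; apply: fZ.
have [_ sB0 _ _] := kZ0.
have B0B : B0 `<=` B by move=> v [Zv]; apply: fB.
have sD : submod [set w | exists2 z, Z z & B' (w - f z)].
  split; first by exists 0; [apply: submod0 | rewrite (semilin0 fl) subrr; apply: submod0].
  move=> a x y [z Zz Bz] [z' Zz' Bz']; exists (a *: z + z'); first exact: sZ.2.
  rewrite fl opprD addrACA -scalerBr; exact: sB'.2.
have BD : B' `<=` [set w | exists2 z, Z z & B' (w - f z)].
  by move=> w Bw; exists 0; [apply: submod0 | rewrite (semilin0 fl) subr0].
have DZ : [set w | exists2 z, Z z & B' (w - f z)] `<=` Z'.
  by move=> w [z /fZ Zz /BZ' Bz]; apply: submod_subr Bz Zz.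
rewrite (leq_trans _ (residue_dim_sub fgW kZ' sD BD DZ)) //.
rewrite (@residue_dim_liniso Z B0) //.
- by rewrite (residue_dim_add fgV kZ0 sB B0B BZ) leq_addr.
- by move=> z Zz; exists z => //; rewrite subrr; apply: submod0.
- by move=> z Zz; split=> [//|[]].
Qed.

End DimensionLinear.

(** * Koszul complexes as iterated mapping cones *)

Section KoszulChains.
Variable R : noethLocalRingType.

(** Chains on n generators of degree 1: the first half of a pair collects the
    coefficients of the monomials without the first generator, the second half
    those of the monomials containing it. *)
Fixpoint kch (n : nat) (M : lmodType R) : lmodType R :=
  if n is n'.+1 then (kch n' M * kch n' M)%type else M.

Lemma kpairP n (M : lmodType R) (v w : kch n.+1 M) : v.1 = w.1 -> v.2 = w.2 -> v = w.
Proof. by case: v w => [a b] [c d] /= -> ->. Qed.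

Lemma kch1D n (M : lmodType R) (v w : kch n.+1 M) : (v + w).1 = v.1 + w.1. Proof. by []. Qed.
Lemma kch2D n (M : lmodType R) (v w : kch n.+1 M) : (v + w).2 = v.2 + w.2. Proof. by []. Qed.
Lemma kch1Z n (M : lmodType R) a (v : kch n.+1 M) : (a *: v).1 = a *: v.1. Proof. by []. Qed.
Lemma kch2Z n (M : lmodType R) a (v : kch n.+1 M) : (a *: v).2 = a *: v.2. Proof. by []. Qed.
Definition kchE := (kch1D, kch2D, kch1Z, kch2Z).

Lemma fg_prod (M N : lmodType R) : fg_module M -> fg_module N -> fg_module (M * N)%type.
Proof.
move=> [m [v vP]] [n [w wP]].
exists (m + n)%N, (fcat (fun i => (v i, 0)) (fun j => (0, w j))) => -[x y].
have [c xc] := vP x; have [d yd] := wP y; exists (fcat c d).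
rewrite sum_fcat; apply: injective_projections => /=.
  rewrite (raddf_sum fst) (raddf_sum fst) /= xc -[LHS]addr0; congr (_ + _).
  by rewrite big1 // => j _; rewrite scaler0.
rewrite (raddf_sum snd) (raddf_sum snd) /= yd -[LHS]add0r; congr (_ + _).
by rewrite big1 // => j _; rewrite scaler0.
Qed.

Lemma fg_kch n (M : lmodType R) : fg_module M -> fg_module (kch n M).
Proof. by move=> fgM; elim: n => //= n IH; apply: fg_prod. Qed.

Variable M : lmodType R.
Implicit Types (n : nat) (s : seq R) (i : int).

(** The differential of the cone of multiplication by the first element of s;
    a list shorter than n is completed by zeros. *)
Fixpoint kd n s : kch n M -> kch n M :=
  if n is n'.+1 then
    fun v => (kd (behead s) v.1 + head 0 s *: v.2, - kd (behead s) v.2)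
  else fun=> 0.

(** Degrees are integers so that the two halves of a chain of degree i simply
    have degrees i and i - 1. *)
Fixpoint kdeg n i : kch n M -> Prop :=
  if n is n'.+1 then fun v => kdeg i v.1 /\ kdeg (i - 1) v.2
  else fun v => i != 0 -> v = 0.

Fixpoint kco n (P : M -> Prop) : kch n M -> Prop :=
  if n is n'.+1 then fun v => kco P v.1 /\ kco P v.2 else P.

(** Exterior multiplication on the left by the element of degree 1 with
    coordinates b. *)
Fixpoint khom n (b : seq R) : kch n M -> kch n M :=
  if n is n'.+1 then
    fun v => (khom (behead b) v.1, head 0 b *: v.1 - khom (behead b) v.2)
  else fun=> 0.

(** The sign (-1)^i in degree i. *)
Fixpoint kbar n : kch n M -> kch n M :=
  if n is n'.+1 then fun v => (kbar v.1, - kbar v.2) else id.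

(** Exterior multiplication on the right by a chain with coefficients in R. *)
Fixpoint krm n : kch n M -> kch n R^o -> kch n M :=
  if n is n'.+1 then
    fun c z => (krm c.1 z.1, krm c.2 z.1 + krm (kbar c.1) z.2)
  else fun c z => (z : R) *: c.

Lemma kd_lin n s : lin (@kd n s).
Proof.
elim: n s => [|n IH] s a x y /=; first by rewrite scaler0 addr0.
rewrite !IH; apply: kpairP; rewrite !kchE /=.
  by rewrite !scalerDr !scalerA mulrC -!scalerA addrACA.
by rewrite opprD scalerN.
Qed.

Lemma kd0 n s : kd s (0 : kch n M) = 0.
Proof. exact: semilin0 (kd_lin s). Qed.

Lemma kdD n s (v w : kch n M) : kd s (v + w) = kd s v + kd s w.
Proof. exact: semilinD (kd_lin s) _ _. Qed.

Lemma kdZ n s a (v : kch n M) : kd s (a *: v) = a *: kd s v.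
Proof. exact: semilinZ (kd_lin s) _ _. Qed.

Lemma kdN n s (v : kch n M) : kd s (- v) = - kd s v.
Proof. exact: semilinN (kd_lin s) _. Qed.

Lemma kdB n s (v w : kch n M) : kd s (v - w) = kd s v - kd s w.
Proof. exact: semilinB (kd_lin s) _ _. Qed.

Lemma kdd n s (v : kch n M) : kd s (kd s v) = 0.
Proof.
elim: n s v => [|n IH] s v //=; apply: kpairP => /=.
  by rewrite kdD kdZ IH add0r scalerN subrr.
by rewrite kdN IH !oppr0.
Qed.

Lemma kdeg_submod n i : submod (@kdeg n i).
Proof.
elim: n i => [|n IH] i /=.
  by split=> // a x y xi yi i0; rewrite xi // yi // scaler0 addr0.
split; first by split; apply: submod0 (IH _).
move=> a x y [x1 x2] [y1 y2]; rewrite !kchE.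
by split; apply: (IH _).2.
Qed.

Lemma kd_deg n s i (v : kch n M) : kdeg i v -> kdeg (i - 1) (kd s v).
Proof.
elim: n s i v => [|n IH] s i v //= [v1 v2]; split.
  apply: submodD (kdeg_submod _ _) _ _; first exact: IH.
  exact: submodZ (kdeg_submod _ _) _.
by apply: submodN (kdeg_submod _ _) _; apply: IH.
Qed.

Lemma kdeg_lt0 n i (v : kch n M) : i < 0 -> kdeg i v -> v = 0.
Proof.
elim: n i v => [|n IH] i v i0 /=; first by apply; rewrite Order.POrderTheory.lt_eqF.
move=> [v1 v2]; apply: kpairP => /=; first exact: IH v1.
by apply: IH v2; rewrite subr_lt0 (lt_trans i0).
Qed.

Lemma kdeg_gt n i (v : kch n M) : n%:Z < i -> kdeg i v -> v = 0.
Proof.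
elim: n i v => [|n IH] i v i0 /=; first by apply; rewrite gt_eqF.
move=> [v1 v2]; apply: kpairP => /=.
  by apply: IH v1; apply: le_lt_trans i0; rewrite lez_nat.
by apply: IH v2; rewrite ltrBrDr -PoszD addn1.
Qed.

Lemma kd_deg0 n s (v : kch n M) : kdeg 0 v -> kd s v = 0.
Proof. by move=> /(kd_deg s); apply: kdeg_lt0. Qed.

Lemma khom_lin n b : lin (@khom n b).
Proof.
elim: n b => [|n IH] b a x y /=; first by rewrite scaler0 addr0.
rewrite !IH; apply: kpairP; rewrite !kchE //=.
by rewrite scalerDr scalerBr opprD !scalerA mulrC -scalerA addrACA.
Qed.

Lemma khom_deg n b i (v : kch n M) : kdeg i v -> kdeg (i + 1) (khom b v).
Proof.
elim: n b i v => [|n IH] b i v //= [v1 v2]; split; first exact: IH.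
rewrite addrK; apply: submodB (kdeg_submod _ _) _ _.
  exact: submodZ (kdeg_submod _ _) _.
by have := IH (behead b) _ _ v2; rewrite subrK.
Qed.

Fixpoint lincomb (b s : seq R) n : R :=
  if n is n'.+1 then head 0 b * head 0 s + lincomb (behead b) (behead s) n' else 0.

(** Contraction and exterior multiplication anticommute up to a scalar, so that
    the ideal generated by s acts null-homotopically and kills homology. *)
Lemma khomP n b s (v : kch n M) :
  kd s (khom b v) + khom b (kd s v) = lincomb b s n *: v.
Proof.
elim: n b s v => [|n IH] b s v /=; first by rewrite scale0r add0r.
apply: kpairP; rewrite !kchE /=.
  rewrite (semilinD (khom_lin _)) (semilinZ (khom_lin _)) scalerBr /=.
  rewrite scalerDl -IH [head 0 b * _]mulrC -scalerA; abelian.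
rewrite kdB kdZ (semilinN (khom_lin _)) scalerDl -IH scalerDr scalerA; abelian.
Qed.

Lemma kbar_lin n : lin (@kbar n).
Proof.
elim: n => [|n IH] a x y //=; rewrite !IH; apply: kpairP; rewrite !kchE //=.
by rewrite opprD scalerN.
Qed.

Lemma kbar_deg n i (v : kch n M) : kdeg i v -> kdeg i (kbar v).
Proof.
elim: n i v => [|n IH] i v //= [v1 v2]; split; first exact: IH.
by apply: submodN (kdeg_submod _ _) _; apply: IH.
Qed.

Lemma kd_bar n s (v : kch n M) : kd s (kbar v) = - kbar (kd s v).
Proof.
elim: n s v => [|n IH] s v /=; first by rewrite oppr0.
apply: kpairP => /=.
  by rewrite IH (semilinD (@kbar_lin n)) (semilinZ (@kbar_lin n)) /= scalerN; abelian.
by rewrite kdN IH (semilinN (@kbar_lin n)); abelian.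
Qed.

Lemma kbar_hom n b (v : kch n M) : kbar (khom b v) = - khom b (kbar v).
Proof.
elim: n b v => [|n IH] b v /=; first by rewrite oppr0.
apply: kpairP => /=; first exact: IH.
rewrite (semilinB (@kbar_lin n)) (semilinZ (@kbar_lin n)) /= IH.
by rewrite (semilinN (@khom_lin n _)); abelian.
Qed.

Lemma krm_linl n (z : kch n R^o) : lin (fun c : kch n M => krm c z).
Proof.
elim: n z => [|n IH] z a x y /=; first by rewrite scalerDr !scalerA mulrC.
apply: kpairP; rewrite !kchE /=; first exact: IH.
by rewrite (IH z.1) kbar_lin (IH z.2) scalerDr /=; abelian.
Qed.

Lemma krm_linr n (c : kch n M) : lin (krm c).
Proof.
elim: n c => [|n IH] c a x y /=; first by rewrite scalerDl scalerA.
apply: kpairP; rewrite !kchE /=; first exact: IH.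
by rewrite (IH c.2) (IH (kbar c.1)) scalerDr /=; abelian.
Qed.

Lemma khom_krm n b (c : kch n M) (z : kch n R^o) : khom b (krm c z) = krm (khom b c) z.
Proof.
elim: n b c z => [|n IH] b c z /=; first by rewrite scaler0.
apply: kpairP => /=; first exact: IH.
rewrite (semilinD (@khom_lin n _)) !IH (semilinB (krm_linl _)) (semilinZ (krm_linl _)) /=.
by rewrite kbar_hom (semilinN (krm_linl _)); abelian.
Qed.

Definition kcyc n s i : set (kch n M) := [set v | kdeg i v /\ kd s v = 0].
Definition kbnd n s i : set (kch n M) := [set v | exists2 w, kdeg (i + 1) w & v = kd s w].

Lemma kcyc_submod n s i : submod (@kcyc n s i).
Proof.
split; first by split; [apply: submod0 (kdeg_submod _ _) | exact: kd0].
move=> a x y [xi dx] [yi dy]; split; first exact: (kdeg_submod _ _).2.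
by rewrite kd_lin dx dy scaler0 addr0.
Qed.

Lemma kbnd_submod n s i : submod (@kbnd n s i).
Proof. exact: (lin_image (@kd_lin n s) (kdeg_submod n (i + 1))). Qed.

Lemma kbnd_cyc n s i : @kbnd n s i `<=` @kcyc n s i.
Proof.
by move=> _ [w dw ->]; split; [rewrite -[i](addrK 1); apply: kd_deg | apply: kdd].
Qed.

Definition spans_max n s := forall x, x \in max_ideal R -> exists b, x = lincomb b s n.

Lemma kcyc_kspace n s i : spans_max n s -> kspace (@kcyc n s i) (kbnd s i).
Proof.
move=> ms; split; [exact: kcyc_submod | exact: kbnd_submod | exact: kbnd_cyc |].
move=> a z /ms[b ->] [dz cz]; exists (khom b z); first exact: khom_deg.
by rewrite -khomP cz (semilin0 (khom_lin b)) addr0.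
Qed.

(** dim H_i(s; M). *)
Definition kh n s i := residue_dim (@kcyc n s i) (kbnd s i).

End KoszulChains.

Arguments kdeg_submod {R M} n i.
Arguments kd_lin {R M n} s.
Arguments khom_lin {R M n} b.
Arguments krm_linl {R M n} z.
Arguments krm_linr {R M n} c.
Arguments kbar_lin {R M} n.
Arguments kcyc_submod {R M} n s i.
Arguments kbnd_submod {R M} n s i.
Arguments kcyc {R M} n s i.
Arguments kbnd {R M} n s i.
Arguments kh {R} M n s i.

Section KoszulProducts.
Variables (R : noethLocalRingType) (M : lmodType R).

Lemma krm_deg n i j (c : kch n M) (z : kch n R^o) :
  kdeg i c -> kdeg j z -> kdeg (i + j) (krm c z).
Proof.
elim: n i j c z => [|n IH] i j c z /=.
  move=> ci zj ij; have [i0|/ci ->] := eqVneq i 0; last by rewrite scaler0.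
  by rewrite zj ?scale0r //; rewrite i0 add0r in ij.
move=> [c1 c2] [z1 z2]; split; first exact: IH.
apply: submodD (kdeg_submod _ _) _ _; first by rewrite addrAC; apply: IH.
by rewrite -addrA; apply: IH => //; apply: kbar_deg.
Qed.

(** The Leibniz rule. *)
Lemma kd_krm n s (c : kch n M) (z : kch n R^o) :
  kd s (krm c z) = krm (kd s c) z + krm (kbar c) (kd s z).
Proof.
elim: n s c z => [|n IH] s c z /=; first by rewrite scaler0 scale0r addr0.
apply: kpairP; rewrite !kchE /=.
  rewrite (semilinD (krm_linl _)) (semilinZ (krm_linl _)) (semilinD (krm_linr _)).
  rewrite (semilinZ (krm_linr _)) IH scalerDr /=; abelian.
rewrite kdD !IH kd_bar !(semilinN (krm_linl _)) !(semilinN (krm_linr _)).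
rewrite (semilinD (kbar_lin n)) (semilinZ (kbar_lin n)).
rewrite !(semilinD (krm_linl _)) !(semilinD (krm_linr _)) !(semilinZ (krm_linl _)) /=.
rewrite !(semilinZ (krm_linr _)) /=; abelian.
Qed.

Lemma kd_krm_cycle n s (c : kch n M) (z : kch n R^o) :
  kd s z = 0 -> kd s (krm c z) = krm (kd s c) z.
Proof. by move=> dz; rewrite kd_krm dz (semilin0 (krm_linr _)) addr0. Qed.

Fixpoint kunit n : kch n R^o := if n is n'.+1 then (kunit n', 0) else 1.

Lemma kunit_deg n : kdeg 0 (kunit n).
Proof. by elim: n => //= n IH; split=> //; apply: submod0 (kdeg_submod _ _). Qed.

Lemma kd_unit n s : kd s (kunit n) = 0.
Proof. by apply: kd_deg0; apply: kunit_deg. Qed.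

Lemma kbar_unit n : kbar (kunit n) = kunit n.
Proof. by elim: n => //= n ->; rewrite (semilin0 (kbar_lin n)) oppr0. Qed.

Lemma krm_unitl n (z : kch n R^o) : krm (kunit n) z = z.
Proof.
elim: n z => [|n IH] z /=; first exact: mulr1.
apply: kpairP => //=.
by rewrite kbar_unit IH (semilin0 (krm_linl _)) add0r.
Qed.

End KoszulProducts.

Section KoszulMaps.
Variables (R S : noethLocalRingType) (phi : {rmorphism R -> S}).
Variables (V : lmodType R) (W : lmodType S) (f : V -> W).

Fixpoint kmap n : kch n V -> kch n W :=
  if n is n'.+1 then fun v => (kmap v.1, kmap v.2) else f.

Lemma kmap_inj n : injective f -> injective (@kmap n).
Proof.
move=> fi; elim: n => //= n IH v w [/IH e1 /IH e2]; exact: kpairP.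
Qed.

Lemma kmap_co n (P : V -> Prop) (Q : W -> Prop) (v : kch n V) :
  (forall x, P x -> Q (f x)) -> kco P v -> kco Q (kmap v).
Proof. by move=> PQ; elim: n v => [|n IH] v /=; [apply: PQ | move=> [/IH ? /IH ?]]. Qed.

Lemma kmap_lift n i (w : kch n W) : f 0 = 0 -> kco (fun y => exists x, f x = y) w ->
  kdeg i w -> exists2 v, kdeg i v & kmap v = w.
Proof.
move=> f0; elim: n i w => [|n IH] i w /=.
  move=> [x fx] wi; have [i0|/wi w0] := eqVneq i 0; first by exists x.
  by exists 0; rewrite ?f0.
move=> [/IH c1 /IH c2] [/c1[v1 d1 e1] /c2[v2 d2 e2]].
by exists (v1, v2) => //=; rewrite e1 e2; case: (w).
Qed.

Hypothesis fl : semilin phi f.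

Lemma kmap_lin n : semilin phi (@kmap n).
Proof. by elim: n => //= n IH a x y; rewrite !kchE !IH; apply: kpairP. Qed.

Lemma kmap_deg n i (v : kch n V) : kdeg i v -> kdeg i (kmap v).
Proof.
elim: n i v => [|n IH] i v /=; first by move=> vi /vi ->; rewrite (semilin0 fl).
by move=> [v1 v2]; split; apply: IH.
Qed.

Lemma kmap_kd n s (v : kch n V) : kmap (kd s v) = kd (map phi s) (kmap v).
Proof.
elim: n s v => [|n IH] s v /=; first exact: semilin0 fl.
rewrite (semilinD (@kmap_lin n)) (semilinN (@kmap_lin n)) (semilinZ (@kmap_lin n)).
rewrite !IH behead_map; congr (_ + _ *: _, _).
by case: s => //=; rewrite rmorph0.
Qed.

End KoszulMaps.

Lemma kmap_kd_lin (R : noethLocalRingType) (V W : lmodType R) (f : V -> W) n s (v : kch n V) :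
  lin f -> kmap f (kd s v) = kd s (kmap f v).
Proof. by move=> fl; rewrite (kmap_kd fl) map_id. Qed.

Lemma kmap_bar (R : noethLocalRingType) (V W : lmodType R) (f : V -> W) n (v : kch n V) :
  lin f -> kmap f (kbar v) = kbar (kmap f v).
Proof.
move=> fl; elim: n v => //= n IH v; congr pair; first exact: IH.
by rewrite (semilinN (kmap_lin fl (n := n))) IH.
Qed.

Lemma kmap_krm (R : noethLocalRingType) (V W : lmodType R) (f : V -> W) n
  (c : kch n V) (z : kch n R^o) : lin f -> kmap f (krm c z) = krm (kmap f c) z.
Proof.
move=> fl; elim: n c z => [|n IH] c z /=; first exact: semilinZ fl _ _.
by rewrite (semilinD (kmap_lin fl (n := n))) !IH kmap_bar.
Qed.

Lemma kmap_comp (R S T : noethLocalRingType) (U : lmodType R) (V : lmodType S) (W : lmodType T)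
  (f : U -> V) (g : V -> W) n (v : kch n U) : kmap g (kmap f v) = kmap (g \o f) v.
Proof. by elim: n v => //= n IH v; rewrite !IH. Qed.

Lemma kmap_ext (R S : noethLocalRingType) (V : lmodType R) (W : lmodType S)
  (f g : V -> W) n (v : kch n V) : f =1 g -> kmap f v = kmap g v.
Proof. by move=> fg; elim: n v => //= n IH v; rewrite !IH. Qed.

Lemma kmap_id (R : noethLocalRingType) (V : lmodType R) n (v : kch n V) : kmap id v = v.
Proof. by elim: n v => //= n IH v; rewrite !IH; case: v. Qed.

Lemma kco_true (R : noethLocalRingType) (V : lmodType R) n (P : V -> Prop) (v : kch n V) :
  (forall x, P x) -> kco P v.
Proof. by move=> PT; elim: n v => //= n IH v; split. Qed.

(** * The long exact sequence of Koszul homology *)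

Section LongExactSequence.
Variables (R : noethLocalRingType) (X Y W : lmodType R).
Variables (f : X -> Y) (g : Y -> W) (n : nat) (s : seq R).
Hypotheses (fgX : fg_module X) (fgY : fg_module Y) (fgW : fg_module W).
Hypotheses (fl : lin f) (gl : lin g) (finj : injective f).
Hypotheses (gsurj : forall w, exists y, g y = w).
Hypotheses (gf0 : forall x, g (f x) = 0) (exact_fg : forall y, g y = 0 -> exists x, f x = y).
Hypothesis ms : spans_max n s.

(** Cycles representing the image of H_i(Y) in H_i(W). *)
Definition kimg i : set (kch n W) := [set w | exists2 y, kcyc n s i y & w = kmap g y].
Definition kimg_dim i := residue_dim (kimg i) (kbnd n s i).

Lemma kimg_submod i : submod (kimg i).
Proof. exact: (lin_image (kmap_lin gl (n := n)) (kcyc_submod n s i)). Qed.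

Lemma kmap_surj_deg i (w : kch n W) : kdeg i w -> exists2 y : kch n Y, kdeg i y & kmap g y = w.
Proof. by apply: kmap_lift; [exact: semilin0 gl | apply: kco_true]. Qed.

Lemma kmap_ker_deg i (y : kch n Y) : kmap g y = 0 -> kdeg i y ->
  exists2 x : kch n X, kdeg i x & kmap f x = y.
Proof.
move=> gy; apply: kmap_lift; first exact: semilin0 fl.
elim: (n) y gy => [|k IH] y /=; first exact: exact_fg.
by move=> /(f_equal (fun p => (p.1, p.2))) [/IH ? /IH].
Qed.

Lemma kmap_gf (x : kch n X) : kmap g (kmap f x) = 0.
Proof.
by elim: (n) x => [|k IH] x /=; [exact: gf0 | apply: kpairP; exact: IH].
Qed.

Lemma kbnd_kimg i : kbnd n s i `<=` kimg i.
Proof.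
move=> _ [w dw ->]; have [y dy <-] := kmap_surj_deg dw.
exists (kd s y); last by rewrite kmap_kd_lin.
by apply: kbnd_cyc; exists y.
Qed.

Lemma kimg_cyc i : kimg i `<=` kcyc n s i.
Proof.
move=> _ [y [dy cy] ->]; split; first exact: (kmap_deg gl).
by rewrite -kmap_kd_lin // cy (semilin0 (kmap_lin gl (n := n))).
Qed.

(** Each homology module is split in two: H_i(X) by the kernel of f, H_i(Y) by
    the image of f, and H_(i+1)(W) by the image of g. Exactness
    identifies the two pieces of H_i(X) with one of H_i(Y) and one of H_(i+1)(W). *)
Lemma koszul_les i :
  (kh X n s i + kimg_dim (i + 1) + kimg_dim i = kh W n s (i + 1) + kh Y n s i)%N.
Proof.
have [[fgX' fgY'] fgW'] := (fg_kch n fgX, fg_kch n fgY, fg_kch n fgW).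
have [fk gk] := (kmap_lin fl (n := n), kmap_lin gl (n := n)).
have finjk : injective (kmap f (n := n)) by apply: kmap_inj.
pose CX : set (kch n X) := kcyc n s i `&` (fun x => kbnd n s i (kmap f x)).
pose CY : set (kch n Y) := kcyc n s i `&` (fun y => kbnd n s i (kmap g y)).
have sCX : submod CX.
  by apply: (submodI (kcyc_submod n s i)); apply: (semilin_preim fk (kbnd_submod n s i)).
have sCY : submod CY.
  by apply: (submodI (kcyc_submod n s i)); apply: (semilin_preim gk (kbnd_submod n s i)).
have BCX : kbnd n s i `<=` CX.
  move=> x Bx; split; first exact: kbnd_cyc.
  by case: Bx => [w dw ->]; exists (kmap f w); [apply: (kmap_deg fl) | rewrite kmap_kd_lin].
have BCY : kbnd n s i `<=` CY.
  move=> x Bx; split; first exact: kbnd_cyc.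
  by case: Bx => [w dw ->]; exists (kmap g w); [apply: (kmap_deg gl) | rewrite kmap_kd_lin].
have CZX : CX `<=` kcyc n s i by move=> x [].
have CZY : CY `<=` kcyc n s i by move=> x [].
have [[kX kY] kW] := (kcyc_kspace X i ms, kcyc_kspace Y i ms, kcyc_kspace W (i + 1) ms).
have [kX1 kX2] := kspace_split kX sCX BCX CZX.
have [kY1 kY2] := kspace_split kY sCY BCY CZY.
rewrite /kh (residue_dim_add fgX' kX sCX BCX CZX) (residue_dim_add fgY' kY sCY BCY CZY).
rewrite (residue_dim_add fgW' kW (kimg_submod _) (@kbnd_kimg _) (@kimg_cyc _)).
(* the image of H_i(Y) in H_i(W) *)
have <- : kimg_dim i = residue_dim (kcyc n s i) CY.
  apply: (residue_dim_liniso fgY' gk kY1 (kbnd_submod n s i)) => [z Zz|z Zz|w].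
  - by exists z.
  - by split=> [|[]].
  - by move=> [y Zy ->]; exists y => //; rewrite subrr; apply: submod0 (kbnd_submod _ _ _).
(* the image of H_i(X) in H_i(Y) *)
have -> : residue_dim CY (kbnd n s i) = residue_dim (kcyc n s i) CX.
  apply: (residue_dim_liniso fgX' fk kX1 (kbnd_submod n s i)) => [z [dz cz]|z Zz|y].
  - split; last by rewrite kmap_gf; apply: submod0 (kbnd_submod _ _ _).
    split; first exact: (kmap_deg fl).
    by rewrite -kmap_kd_lin // cz (semilin0 fk).
  - by split=> [|[]].
  - move=> [[dy cy] [w dw gy]]; have [y' dy' gy'] := kmap_surj_deg dw.
    have [||x dx fx] := @kmap_ker_deg i (y - kd s y').
    + by rewrite (semilinB gk) gy kmap_kd_lin // gy' subrr.
    + by apply: submodB (kdeg_submod _ _) dy _; rewrite -[i](addrK 1); apply: kd_deg.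
    exists x; last by rewrite fx opprB addrC subrK; exists y'.
    split=> //; apply: finjk; rewrite kmap_kd_lin // fx kdB cy kdd subrr.
    by rewrite (semilin0 fk).
(* the kernel of H_i(X) -> H_i(Y) is the image of the connecting map *)
pose E : set (kch n Y) := kdeg (i + 1) `&` (fun y => kmap g (kd s y) = 0).
pose E' : set (kch n Y) := E `&` (fun y => kimg (i + 1) (kmap g y)).
have sE : submod E.
  apply: (submodI (kdeg_submod n (i + 1))); split; first by rewrite kd0 (semilin0 gk).
  by move=> a x y gx gy; rewrite kd_lin gk gx gy scaler0 addr0.
have sE' : submod E'.
  by apply: (submodI sE); apply: (semilin_preim gk (kimg_submod (i + 1))).
have EZ y : E y -> kcyc n s (i + 1) (kmap g y).
  by move=> [dy gy]; split; [apply: (kmap_deg gl) | rewrite -kmap_kd_lin].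
have kE : kspace E E'.
  split=> //; first by move=> y [].
  move=> a y am Ey; split; first exact: submodZ.
  rewrite (semilinZ gk); apply: kbnd_kimg; case: kW => _ _ _; apply=> //; exact: EZ.
have -> : residue_dim (kcyc n s (i + 1)) (kimg (i + 1)) = residue_dim E E'.
  apply: (residue_dim_liniso fgY' gk kE (kimg_submod _)) => [//|z Zz|w [dw cw]].
  - by split=> [|[]].
  - have [y dy gy] := kmap_surj_deg dw; exists y.
      by split=> //; rewrite kmap_kd_lin // gy.
    by rewrite gy subrr; apply: submod0 (kimg_submod _).
pose I1 : set (kch n Y) := [set y | exists2 x, CX x & y = kmap f x].
pose I2 : set (kch n Y) := [set y | exists2 x, kbnd n s i x & y = kmap f x].
have sI2 : submod I2 by apply: (lin_image fk (kbnd_submod n s i)).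
have <- : residue_dim I1 I2 = residue_dim E E'.
  apply: (residue_dim_liniso fgY' (kd_lin s) kE sI2) => [y [dy gy]|y [dy gy]|y].
  - have dy' : kdeg i (kd s y) by rewrite -[i](addrK 1); apply: kd_deg.
    have [x dx fx] := kmap_ker_deg gy dy'; exists x => //; split.
      by split=> //; apply: finjk; rewrite kmap_kd_lin // fx kdd (semilin0 fk).
    by rewrite fx; exists y.
  - split=> [[_ [x dx ->] yE]|[_ [y' [dy' cy'] gy']]].
      split=> //; exists (y - kmap f x); last by rewrite (semilinB gk) kmap_gf subr0.
      split; last by rewrite kdB yE kmap_kd_lin // subrr.
      by apply: submodB (kdeg_submod _ _) dy _; apply: (kmap_deg fl).
    have [||x dx fx] := @kmap_ker_deg (i + 1) (y - y').
    + by rewrite (semilinB gk) gy' subrr.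
    + exact: submodB (kdeg_submod _ _) dy dy'.
    exists (kd s x); first by exists x.
    by rewrite kmap_kd_lin // fx kdB cy' subr0.
  - move=> [x [[dx cx] [w dw fx]] ->]; exists w.
      by split=> //; rewrite -fx kmap_gf.
    by rewrite fx subrr; apply: submod0 sI2.
have -> : residue_dim I1 I2 = residue_dim CX (kbnd n s i).
  apply: (residue_dim_liniso fgX' fk kX2 sI2) => [x Cx|x Cx|y [x Cx ->]].
  - by exists x.
  - by split=> [[x' Bx' /finjk ->]|Bx] //; exists x.
  - by exists x => //; rewrite subrr; apply: submod0 sI2.
by rewrite /kimg_dim; lia.
Qed.

End LongExactSequence.

(** * Adjoining elements that act trivially *)

(** The coefficient of degree i of (1 + t)^r f(t). *)
Fixpoint bsum (r : nat) (f : int -> nat) (i : int) : nat :=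
  if r is r'.+1 then (bsum r' f i + bsum r' f (i - 1))%N else f i.

Lemma bsum_inj r (f g : int -> nat) :
  (forall i : int, i < 0 -> f i = g i) -> (forall i, bsum r f i = bsum r g i) ->
  forall i, f i = g i.
Proof.
elim: r => [//|r IH] fg0 /= fg; apply: IH => // i.
have lt0 j : j < 0 -> bsum r f j = bsum r g j.
  elim: (r) j => [|k IHk] j j0 /=; first exact: fg0.
  by rewrite !IHk // subr_lt0 (lt_trans j0).
case: (ltP i 0) => [/lt0//|]; case: i => // k _.
elim: k => [|k IHk]; have := fg (Posz _); [move=> /(_ 0%N)|move=> /(_ k.+1)].
  by rewrite (lt0 (0 - 1)) // => /addIn.
by rewrite (_ : k.+1%:Z - 1 = k) ?IHk => [/addIn|]; lia.
Qed.

Lemma bsum_ext r (f g : int -> nat) i : f =1 g -> bsum r f i = bsum r g i.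
Proof. by move=> fg; elim: r i => [|r IH] i //=; rewrite !IH. Qed.

Lemma residue_dim_prod (R : noethLocalRingType) (V W : lmodType R) (Z1 B1 : set V) (Z2 B2 : set W) :
  fg_module V -> fg_module W -> kspace Z1 B1 -> kspace Z2 B2 ->
  kspace (V := (V * W)%type) (Z1 `*` Z2) (B1 `*` B2) /\
  residue_dim (V := (V * W)%type) (Z1 `*` Z2) (B1 `*` B2) =
    (residue_dim Z1 B1 + residue_dim Z2 B2)%N.
Proof.
move=> fgV fgW k1 k2; have fgVW := fg_prod fgV fgW.
have [[sZ1 sB1 BZ1 mZ1] [sZ2 sB2 BZ2 mZ2]] := (k1, k2).
have sX U1 U2 : submod U1 -> submod U2 -> submod (V := (V * W)%type) (U1 `*` U2).
  move=> s1 s2; split; first by split; apply: submod0.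
  by move=> a x y [x1 x2] [y1 y2]; split; [apply: s1.2 | apply: s2.2].
have kX : kspace (V := (V * W)%type) (Z1 `*` Z2) (B1 `*` B2).
  split; [exact: sX | exact: sX | |] => [x [/BZ1 ? /BZ2 ?] //|a x am [x1 x2]].
  by split; [apply: mZ1 | apply: mZ2].
split=> //.
have sC : submod (V := (V * W)%type) (B1 `*` Z2) by exact: sX.
have BC : B1 `*` B2 `<=` B1 `*` Z2 by move=> x [? /BZ2].
have CZ : B1 `*` Z2 `<=` Z1 `*` Z2 by move=> x [/BZ1].
rewrite (residue_dim_add fgVW kX sC BC CZ).
have [kZC kCB] := kspace_split kX sC BC CZ.
congr (_ + _)%N.
  apply/esym; apply: (residue_dim_liniso (f := fst) fgVW _ kZC sB1) => //.
  - by move=> z [].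
  - by move=> z [_ z2]; split=> [|[]].
  - by move=> z Zz; exists (z, 0); [split=> //; apply: submod0 | rewrite subrr; apply: submod0].
apply/esym; apply: (residue_dim_liniso (f := snd) fgVW _ kCB sB2) => //.
- by move=> z [].
- by move=> z [z1 z2]; split=> [|[]].
- by move=> z Zz; exists (0, z); [split=> //; apply: submod0 | rewrite subrr; apply: submod0].
Qed.

Section Layers.
Variables (R : noethLocalRingType) (M : lmodType R) (n : nat).
Implicit Types P Q : int -> set (kch n M).

(** A chain on r + n generators is a family of chains on the last n of them,
    indexed by the subsets L of the first r; kall asks that the member
    indexed by L satisfies P in degree i - |L|. *)
Fixpoint kall r P i : set (kch (r + n) M) :=
  if r is r'.+1 return set (kch (r + n) M) then fun v => @kall r' P i v.1 /\ @kall r' P (i - 1) v.2 else P i.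
Arguments kall : clear implicits.

Lemma kall_dim r P Q : fg_module M -> (forall i, kspace (P i) (Q i)) -> forall i,
  kspace (kall r P i) (kall r Q i) /\
  residue_dim (kall r P i) (kall r Q i) = bsum r (fun i => residue_dim (P i) (Q i)) i.
Proof.
move=> fgM kPQ; elim: r => [|r IH] i //.
have [k1 d1] := IH i; have [k2 d2] := IH (i - 1).
have fgr := fg_kch (r + n) fgM.
have [k d] := residue_dim_prod fgr fgr k1 k2.
by split=> //=; rewrite -d1 -d2 -d.
Qed.

Lemma kall_sub r P Q i : (forall i, P i `<=` Q i) -> kall r P i `<=` kall r Q i.
Proof. by move=> PQ; elim: r i => [|r IH] i v /=; [apply: PQ | move=> [/IH ? /IH ?]]. Qed.

Lemma kall_submod r P i : (forall i, submod (P i)) -> submod (kall r P i).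
Proof.
move=> sP; elim: r i => [|r IH] i /=; first exact: sP.
split; first by split; apply: submod0 (IH _).
by move=> a x y [x1 x2] [y1 y2]; split; apply: (IH _).2.
Qed.

(** Zeros contribute nothing to the differential, which acts on the members of
    a family separately. *)
Lemma kcyc_layers r s i : kcyc (M := M) (r + n) (nseq r 0 ++ s) i = kall r (fun j => kcyc n s j) i.
Proof.
elim: r i => [|r IH] i //; rewrite /= -!IH; apply/seteqP; split=> v /=.
  move=> [[v1 v2] /(f_equal (fun p => (p.1, p.2)))[]].
  by rewrite scale0r addr0 => e1 /eqP; rewrite oppr_eq0 => /eqP.
move=> [[d1 c1] [d2 c2]]; split=> //; apply: kpairP => /=.
  by rewrite c1 scale0r addr0.
by rewrite c2 oppr0.
Qed.

Lemma kbnd_layers r s i : kbnd (M := M) (r + n) (nseq r 0 ++ s) i = kall r (fun j => kbnd n s j) i.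
Proof.
elim: r i => [|r IH] i //; rewrite /= -!IH; apply/seteqP; split=> v /=.
  move=> [w [w1 w2] ->] /=; split; first by exists w.1; rewrite // scale0r addr0.
  by exists (- w.2); rewrite ?kdN // addrAC; apply: submodN (kdeg_submod _ _) _.
move=> [[w1 d1 e1] [w2 d2 e2]]; exists (w1, - w2) => /=.
  by split=> //; rewrite addrAC; apply: submodN (kdeg_submod _ _) _.
by apply: kpairP => /=; rewrite ?scale0r ?addr0 // kdN opprK.
Qed.

Lemma lincomb_nseq r (b s a : seq R) :
  size a = r -> lincomb (nseq r 0 ++ b) (a ++ s) (r + n) = lincomb b s n.
Proof.
elim: r a => [|r IH] [|a0 a] //= [sa].
by rewrite mul0r add0r IH.
Qed.

Lemma spans_max_cat r (a s : seq R) : size a = r -> spans_max n s -> spans_max (r + n) (a ++ s).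
Proof. by move=> sa ms x /ms[b ->]; exists (nseq r 0 ++ b); rewrite lincomb_nseq. Qed.

Lemma kh_layers r s i : fg_module M -> spans_max n s ->
  kh M (r + n) (nseq r 0 ++ s) i = bsum r (kh M n s) i.
Proof.
move=> fgM ms; rewrite /kh kcyc_layers kbnd_layers.
by have [] := kall_dim r fgM (fun j => kcyc_kspace M j ms) i.
Qed.

(** An element of the ideal generated by s may be replaced by zero: the cone of
    a null-homotopic map is isomorphic to the cone of 0, through the homotopy
    khom of khomP. *)
Fixpoint kth r (bs : seq (seq R)) : kch (r + n) M -> kch (r + n) M :=
  if r is r'.+1 return kch (r + n) M -> kch (r + n) M then
    fun v => (kth (behead bs) (v.1 + khom (nseq r' 0 ++ head [::] bs) v.2), kth (behead bs) v.2)
  else id.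

Lemma kth_lin r bs : lin (@kth r bs).
Proof.
elim: r bs => [|r IH] bs a x y //=; rewrite (khom_lin _) /=.
apply: kpairP; rewrite !kchE /= -?IH //; congr kth.
by rewrite scalerDr; abelian.
Qed.

Lemma kth_deg r bs i v : kdeg i v -> kdeg i (@kth r bs v).
Proof.
elim: r bs i v => [|r IH] bs i v //= [v1 v2]; split; apply: IH => //.
apply: submodD (kdeg_submod _ _) _ _ => //.
by rewrite -[i](subrK 1); apply: khom_deg.
Qed.

Lemma kth_inj r bs : injective (@kth r bs).
Proof.
elim: r bs => [|r IH] bs v w //= [/IH e1 /IH e2]; apply: kpairP => //.
by move: e1; rewrite e2 => /addIr.
Qed.

Lemma kth_surj r bs i w : kdeg i w -> exists2 v, kdeg i v & @kth r bs v = w.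
Proof.
elim: r bs i w => [|r IH] bs i w /=; first by exists w.
move=> [/IH-/(_ (behead bs))[v1 d1 e1] /IH-/(_ (behead bs))[v2 d2 e2]].
exists (v1 - khom (nseq r 0 ++ head [::] bs) v2, v2) => /=.
  split=> //; apply: submodB (kdeg_submod _ _) d1 _.
  by rewrite -[i](subrK 1); apply: khom_deg.
by rewrite subrK e1 e2; case: (w).
Qed.

Lemma kth_kd r bs s v : size bs = r ->
  kd (nseq r 0 ++ s) (@kth r bs v) = kth bs (kd ([seq lincomb b s n | b <- bs] ++ s) v).
Proof.
elim: r bs v => [|r IH] [|b bs] v //= [rbs]; rewrite !IH // scale0r addr0.
apply: kpairP => /=; last by rewrite -(semilinN (@kth_lin r bs)).
congr kth; rewrite kdD -addrA; congr (_ + _).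
rewrite (semilinN (khom_lin _)); apply/esym/eqP; rewrite subr_eq.
by rewrite khomP lincomb_nseq // size_map.
Qed.

Lemma kh_kth bs s i : fg_module M -> spans_max n s ->
  kh M (size bs + n) ([seq lincomb b s n | b <- bs] ++ s) i = bsum (size bs) (kh M n s) i.
Proof.
move=> fgM ms; rewrite -kh_layers //; apply/esym.
have ms' : spans_max (size bs + n) ([seq lincomb b s n | b <- bs] ++ s).
  by apply: spans_max_cat; rewrite ?size_map.
have kl := @kth_lin (size bs) bs; have ki := @kth_inj (size bs) bs.
apply: (residue_dim_liniso (f := @kth (size bs) bs) (fg_kch _ fgM) kl (kcyc_kspace M i ms')).
- exact: kbnd_submod.
- by move=> z [dz cz]; split; [apply: kth_deg | rewrite kth_kd // cz (semilin0 kl)].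
- move=> z _; split=> [[w dw]|[w dw ->]]; last first.
    by exists (kth bs w); [apply: kth_deg | rewrite kth_kd].
  have [w' dw' <-] := kth_surj bs dw; rewrite kth_kd // => /ki ->.
  by exists w'.
- move=> w [dw cw]; have [v dv vw] := kth_surj bs dw; exists v.
    by split=> //; apply: ki; rewrite -kth_kd // vw cw (semilin0 kl).
  by rewrite vw subrr; apply: submod0 (kbnd_submod _ _ _).
Qed.

(** Products on the right with chains on the last n generators. *)
Fixpoint klr r (z : kch n R^o) : kch (r + n) M -> kch (r + n) M :=
  if r is r'.+1 return kch (r + n) M -> kch (r + n) M then fun v => (klr z v.1, klr z v.2) else fun v => krm v z.

(** The member of a family indexed by the set of all of the first r generators. *)
Fixpoint ktop r : kch (r + n) M -> kch n M :=
  if r is r'.+1 return kch (r + n) M -> kch n M then fun v => ktop v.2 else id.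

Lemma klr_lin r z : lin (klr (r := r) z).
Proof.
elim: r => [|r IH] a x y /=; first exact: krm_linl.
by rewrite !IH.
Qed.

Lemma khom_klr r b z v : khom (nseq r 0 ++ b) (klr (r := r) z v) = klr z (khom (nseq r 0 ++ b) v).
Proof.
elim: r v => [|r IH] v /=; first exact: khom_krm.
by rewrite !IH (semilinB (@klr_lin r z)) (semilinZ (@klr_lin r z)).
Qed.

Lemma kth_klr r bs z v : @kth r bs (klr z v) = klr z (kth bs v).
Proof.
elim: r bs v => [|r IH] bs v //=.
by rewrite khom_klr -(semilinD (@klr_lin _ z)) !IH.
Qed.

Lemma ktop_kth r bs v : ktop (@kth r bs v) = ktop v.
Proof. by elim: r bs v => [|r IH] bs v //=. Qed.

End Layers.
Arguments kth {R M n r} bs v.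
Arguments kall {R M n} r P i _.

(** * Independence of the generators *)

Section Reordering.
Variables (R : noethLocalRingType) (M : lmodType R).

Definition kiso n (s s' : seq R) := exists F G : kch n M -> kch n M,
  [/\ lin F, cancel G F, injective F, (forall i v, kdeg i v -> kdeg i (F v) /\ kdeg i (G v))
    & forall v, F (kd s v) = kd s' (F v)].

Lemma kiso_refl n s : kiso n s s.
Proof. by exists id, id; split=> // a x y. Qed.

Lemma kiso_trans n s1 s2 s3 : kiso n s1 s2 -> kiso n s2 s3 -> kiso n s1 s3.
Proof.
move=> [F [G [Fl GF Fi Fd Fk]]] [F' [G' [Fl' GF' Fi' Fd' Fk']]].
exists (F' \o F), (G \o G'); split.
- exact: lin_comp.
- by move=> v /=; rewrite GF GF'.
- exact: inj_comp.
- move=> i v dv; split.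
    by have [/Fd'[]] := Fd _ _ dv.
  by have [_ /Fd[]] := Fd' _ _ dv.
- by move=> v /=; rewrite Fk Fk'.
Qed.

Lemma kiso_cons n a s s' : kiso n s s' -> kiso n.+1 (a :: s) (a :: s').
Proof.
move=> [F [G [Fl GF Fi Fd Fk]]].
exists (fun v => (F v.1, F v.2)), (fun v => (G v.1, G v.2)); split.
- by move=> c x y; rewrite !kchE !Fl.
- by move=> v; rewrite /= !GF; case: v.
- by move=> v w [/Fi ? /Fi ?]; apply: kpairP.
- by move=> i v [/Fd[? ?] /Fd[? ?]].
- by move=> v /=; rewrite (semilinD Fl) (semilinZ Fl) (semilinN Fl) !Fk.
Qed.

Lemma kiso_swap n a b s : kiso n.+2 [:: a, b & s] [:: b, a & s].
Proof.
pose F (v : kch n.+2 M) : kch n.+2 M := ((v.1.1, v.2.1), (v.1.2, - v.2.2)).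
have FF : involutive F by move=> [[p q] [r t]]; rewrite /F /= opprK.
exists F, F; split=> //; last 2 first.
- move=> i [[p q] [r t]] /= [[dp dq] [dr dt]].
  by split; split=> //; split=> //; apply: submodN (kdeg_submod _ _) _.
- move=> [[p q] [r t]]; apply: kpairP; apply: kpairP => /=; rewrite ?scalerN ?kdN; abelian.
- by move=> c x y; apply: kpairP; apply: kpairP => //=; rewrite opprD scalerN.
- exact: inv_inj.
Qed.

Lemma kiso_sym n s s' : kiso n s s' -> kiso n s' s.
Proof.
move=> [F [G [Fl GF Fi Fd Fk]]].
have FG : cancel F G by move=> v; apply: Fi; rewrite GF.
exists G, F; split=> //.
- by move=> a x y; apply: Fi; rewrite Fl !GF.
- exact: can_inj GF.
- by move=> i v /Fd[].
- by move=> v; apply: Fi; rewrite Fk !GF.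
Qed.

Lemma kiso_move n a s1 s2 : kiso (size s1 + n).+1 (s1 ++ a :: s2) (a :: s1 ++ s2).
Proof.
elim: s1 => [|b s1 IH] /=; first exact: kiso_refl.
by apply: kiso_trans (kiso_cons b IH) _; apply: kiso_swap.
Qed.

Lemma kiso_catC s1 s2 : kiso (size s1 + size s2) (s1 ++ s2) (s2 ++ s1).
Proof.
elim: s1 => [|a s1 IH] /=; first by rewrite cats0; apply: kiso_refl.
apply: kiso_trans (kiso_cons a IH) _; apply: kiso_sym.
by rewrite addnC; apply: kiso_move.
Qed.

Lemma kh_kiso n s s' i : fg_module M -> spans_max n s -> kiso n s s' ->
  kh M n s' i = kh M n s i.
Proof.
move=> fgM ms [F [G [Fl GF Fi Fd Fk]]].
apply: (residue_dim_liniso (fg_kch n fgM) Fl (kcyc_kspace M i ms)).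
- exact: kbnd_submod.
- by move=> z [/Fd[dz _] cz]; split=> //; rewrite -Fk cz (semilin0 Fl).
- move=> z _; split=> [[w /Fd[_ dw] zw]|[w /Fd[dw _] ->]]; last by exists (F w).
  by exists (G w) => //; apply: Fi; rewrite Fk GF.
- move=> w [/Fd[_ dw] cw]; exists (G w).
    by split=> //; apply: Fi; rewrite Fk GF cw (semilin0 Fl).
  by rewrite GF subrr; apply: submod0 (kbnd_submod _ _ _).
Qed.

Lemma kh_lt0 n s i : fg_module M -> i < 0 -> kh M n s i = 0%N.
Proof.
move=> fgM i0; rewrite /kh (_ : kcyc n s i = kbnd n s i).
  by apply: residue_dimxx; apply: kbnd_submod.
apply/seteqP; split; last exact: kbnd_cyc.
by move=> v [/(kdeg_lt0 i0) -> _]; apply: submod0 (kbnd_submod _ _ _).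
Qed.

(** Both families are compared with s ++ s', in which either one makes the
    other redundant; a factor (1 + t)^r is then cancelled. *)
Lemma kh_gens s s' i : fg_module M -> size s = size s' ->
  (forall x, x \in s -> x \in max_ideal R) -> (forall x, x \in s' -> x \in max_ideal R) ->
  spans_max (size s) s -> spans_max (size s') s' ->
  kh M (size s) s i = kh M (size s') s' i.
Proof.
move=> fgM ss' sm sm' ms ms'.
have coefs (t u : seq R) : (forall x, x \in t -> x \in max_ideal R) ->
    spans_max (size u) u -> exists2 bs, size bs = size t & t = [seq lincomb b u (size u) | b <- bs].
  elim: t => [|x t IH] tm mu; first by exists [::].
  have [|bs sbs tE] := IH _ mu; first by move=> y yt; apply: tm; rewrite inE yt orbT.
  have [|b xb] := mu x; first by apply: tm; rewrite inE eqxx.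
  by exists (b :: bs); rewrite /= ?sbs // -xb -tE.
have [bs sbs sE] := coefs s s' sm ms'.
have [bs' sbs' sE'] := coefs s' s sm' ms.
move: i; apply: (@bsum_inj (size s)) => [i i0|i]; first by rewrite !kh_lt0.
have e1 := kh_kth bs i fgM ms'; rewrite -sE sbs in e1.
have e2 := kh_kth bs' i fgM ms; rewrite -sE' sbs' in e2.
transitivity (kh M (size s' + size s) (s' ++ s) i); first by rewrite e2 ss'.
rewrite -e1 addnC; apply: kh_kiso (kiso_catC s s') => //.
exact: spans_max_cat.
Qed.

End Reordering.

(** * Koszul chains indexed by subsets *)

Section SubsetIndexing.
Variables (R : noethLocalRingType) (M : lmodType R).

(** A subset of {0, ..., n} is split into the membership of 0 and a subset of
    the remaining n elements, like the chains of kch. *)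
Definition tailset n (S : {set 'I_n.+1}) : {set 'I_n} := [set i | lift ord0 i \in S].

Lemma card_tailset n (S : {set 'I_n.+1}) : #|S| = ((ord0 \in S) + #|tailset S|)%N.
Proof.
rewrite -!sum1_card !(big_mkcond (fun i => i \in _)) big_ord_recl /=; congr (_ + _)%N.
by apply: eq_bigr => i _; rewrite inE.
Qed.

Lemma tailset_imset n (T : {set 'I_n}) : tailset (lift ord0 @: T) = T.
Proof. by apply/setP => i; rewrite inE mem_imset //; apply: lift_inj. Qed.

Lemma ord0_imset n (T : {set 'I_n}) : (ord0 \in lift ord0 @: T) = false.
Proof. by apply/negbTE/imsetP => -[i _ /eqP]; rewrite (negPf (neq_lift _ _)). Qed.

Lemma tailsetU1 n (T : {set 'I_n}) : tailset (ord0 |: lift ord0 @: T) = T.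
Proof.
apply/setP => i; rewrite !inE mem_imset; last exact: lift_inj.
by rewrite eq_sym (negPf (neq_lift _ _)).
Qed.

Lemma tailsetK n (S : {set 'I_n.+1}) :
  S = if ord0 \in S then ord0 |: lift ord0 @: tailset S else lift ord0 @: tailset S.
Proof.
apply/setP => i; case: (unliftP ord0 i) => [j ->|->]; case: ifP => S0.
- by rewrite !inE mem_imset ?inE //=; apply: lift_inj.
- by rewrite mem_imset ?inE //; apply: lift_inj.
- by rewrite !inE eqxx ?S0.
- by rewrite ord0_imset.
Qed.

Fixpoint kffun n : kch n M -> {ffun {set 'I_n} -> M} :=
  if n is n'.+1 then
    fun v => [ffun S : {set 'I_n'.+1} =>
      if ord0 \in S then kffun v.2 (tailset S) else kffun v.1 (tailset S)]
  else fun v => [ffun=> v].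

Lemma kffun_lin n : lin (@kffun n).
Proof.
elim: n => [|n IH] a x y; apply/ffunP => S; rewrite /= !ffunE //.
by case: ifP => _; [rewrite (IH a x.2 y.2) | rewrite (IH a x.1 y.1)]; rewrite !ffunE.
Qed.

Lemma kffun1 n (v : kch n.+1 M) (T : {set 'I_n}) : kffun v (lift ord0 @: T) = kffun v.1 T.
Proof. by rewrite /= ffunE ord0_imset tailset_imset. Qed.

Lemma kffun2 n (v : kch n.+1 M) (T : {set 'I_n}) :
  kffun v (ord0 |: lift ord0 @: T) = kffun v.2 T.
Proof. by rewrite /= ffunE !inE eqxx tailsetU1. Qed.

Lemma kffun_inj n : injective (@kffun n).
Proof.
elim: n => [|n IH] v w vw.
  by have := congr1 (fun f : {ffun _ -> _} => f finset.set0) vw; rewrite /= !ffunE.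
by apply: kpairP; apply: IH; apply/ffunP => T; rewrite -?kffun1 -?kffun2 vw.
Qed.

Lemma kffun_surj n (f : {ffun {set 'I_n} -> M}) : exists v, kffun v = f.
Proof.
elim: n f => [|n IH] f.
  exists (f finset.set0); apply/ffunP => S; rewrite ffunE; congr (f _).
  by apply/setP => -[].
have [v1 e1] := IH [ffun T : {set 'I_n} => f (lift ord0 @: T)].
have [v2 e2] := IH [ffun T : {set 'I_n} => f (ord0 |: lift ord0 @: T)].
exists (v1, v2); apply/ffunP => S; rewrite /= ffunE /= e1 e2 !ffunE.
by rewrite [in RHS](tailsetK S); case: ifP.
Qed.

Lemma kffun_co n (P : M -> Prop) (v : kch n M) : (forall S, P (kffun v S)) -> kco P v.
Proof.
elim: n v => [|n IH] v Pv /=; first by have := Pv finset.set0; rewrite ffunE.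
by split; apply: IH => T; rewrite -?kffun1 -?kffun2.
Qed.

Lemma kffun_deg n (i : int) (v : kch n M) :
  kdeg i v <-> forall S : {set 'I_n}, #|S|%:Z != i -> kffun v S = 0.
Proof.
elim: n i v => [|n IH] i v.
  have card0 (S : {set 'I_0}) : #|S| = 0%N by apply: eq_card0 => -[].
  split=> /= [vi S|vi i0]; first by rewrite ffunE card0 eq_sym.
  by have := vi finset.set0; rewrite ffunE card0 eq_sym; apply.
split=> [[/IH v1 /IH v2] S|vi].
  rewrite card_tailset /= ffunE; case: ifP => _ Si; [apply: v2 | apply: v1] => //.
  by apply: contraNneq Si => e; rewrite PoszD e addrC subrK.
split; apply/IH => T Ti; rewrite -?kffun1 -?kffun2; apply: vi.
  by rewrite card_tailset ord0_imset tailset_imset.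
rewrite card_tailset !inE eqxx tailsetU1.
by apply: contraNneq Ti => <-; rewrite PoszD addrC addKr.
Qed.

Lemma card_lt_tailset n (T : {set 'I_n.+1}) (j : 'I_n) :
  #|[set t in T | (t < lift ord0 j)%N]%SET| =
  ((ord0 \in T) + #|[set t in tailset T | (t < j)%N]%SET|)%N.
Proof.
rewrite card_tailset !inE andbT; congr (_ + _)%N.
by apply: eq_card => i; rewrite !inE.
Qed.

Lemma kffun_kd n (s : seq R) (v : kch n M) (T : {set 'I_n}) :
  kffun (kd s v) T = \sum_(j | j \notin T)
    ((-1) ^+ #|[set t : 'I_n in T | (t < j)%N]%SET| * s`_j) *: kffun v (j |: T).
Proof.
elim: n s v T => [|n IH] s v T; first by rewrite big1 => [|[] //]; rewrite /= ffunE.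
have step (w : kch n M) (e : {set 'I_n.+1} -> {set 'I_n}) :
    (forall j, e (lift ord0 j |: T) = j |: tailset T) ->
    (forall j, kffun v (lift ord0 j |: T) = kffun w (e (lift ord0 j |: T))) ->
  \sum_(j < n | lift ord0 j \notin T)
    ((-1) ^+ #|[set t in T | (t < lift ord0 j)%N]%SET| * s`_(lift ord0 j)) *:
      kffun v (lift ord0 j |: T) = (-1) ^+ (ord0 \in T) *: kffun (kd (behead s) w) (tailset T).
  move=> eT vw; rewrite IH scaler_sumr; apply: eq_big => [j|j _]; first by rewrite inE.
  rewrite vw eT scalerA; congr (_ *: _).
  by rewrite card_lt_tailset exprD nth_behead mulrA.
have tU j : tailset (lift ord0 j |: T) = j |: tailset T.
  by apply/setP => k; rewrite !inE (inj_eq (@lift_inj _ _)).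
rewrite big_mkcond big_ord_recl -big_mkcond /= ffunE.
have lift0 (j : 'I_n) : ord0 == lift ord0 j = false by apply/negbTE; rewrite neq_lift.
case: ifP => T0.
  rewrite (step v.2 (@tailset n)) ?T0 ?add0r ?scaleN1r //.
    by rewrite (semilinN (@kffun_lin n)) ffunE.
  by move=> j; rewrite /= ffunE !inE T0 orbT.
rewrite (step v.1 (@tailset n)) ?T0 ?scale1r //; last first.
  by move=> j; rewrite /= ffunE !inE T0 lift0.
rewrite (semilinD (@kffun_lin n)) (semilinZ (@kffun_lin n)) !ffunE addrC /=; congr (_ + _).
rewrite (_ : [set t in T | _]%SET = finset.set0) ?cards0 ?expr0 ?mul1r ?nth0; last first.
  by apply/setP => t; rewrite !inE ltn0 andbF.
rewrite !inE eqxx /=; congr (_ *: kffun _ _).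
by apply/setP => k; rewrite !inE eq_sym lift0.
Qed.

End SubsetIndexing.

Section KoszulDim.
Variable R : noethLocalRingType.

(** Minimality of the generating family s of the maximal ideal, in the form in
    which it is used: no relation among its members has a unit coefficient. *)
Definition min_gens (s : seq R) := [/\ forall x, x \in s -> x \in max_ideal R,
  spans_max (size s) s
  & forall c : 'I_(size s) -> R, \sum_i c i * s`_i = 0 -> forall i, c i \in max_ideal R].

Lemma lincombE n (b s : seq R) : lincomb b s n = \sum_(i < n) b`_i * s`_i.
Proof.
elim: n b s => [|n IH] b s; first by rewrite big_ord0.
by rewrite big_ord_recl /= !nth0 IH; congr (_ + _); apply: eq_bigr => i _; rewrite !nth_behead.
Qed.

Lemma spans_maxP (s : seq R) : (forall x, x \in max_ideal R -> ideal_gen s x) ->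
  spans_max (size s) s.
Proof.
move=> ms x /ms[c ->]; exists (mkseq (fun k => if insub k is Some i then c i else 0) (size s)).
rewrite lincombE; apply: eq_bigr => i _.
by rewrite nth_mkseq // insubT // => lti; congr (c _ * _); apply: val_inj.
Qed.

Lemma ideal_gen_ideal (s : seq R) : is_ideal (ideal_gen s).
Proof.
split=> [|x y [c ->] [d ->]|a x [c ->]].
- by exists (fun=> 0); rewrite big1 // => i _; rewrite mul0r.
- by exists (fun i => c i + d i); rewrite -big_split; apply: eq_bigr => i _; rewrite mulrDl.
- by exists (fun i => a * c i); rewrite mulr_sumr; apply: eq_bigr => i _; rewrite mulrA.
Qed.

Lemma is_ideal_sum (J : set R) I (r : seq I) (P : pred I) (F : I -> R) :
  is_ideal J -> (forall i, P i -> J (F i)) -> J (\sum_(i <- r | P i) F i).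
Proof. by move=> [J0 JD _] JF; apply: (big_ind (fun x => J x)). Qed.

Lemma ideal_gen_mem (s : seq R) x : x \in s -> ideal_gen s x.
Proof. by move=> xs; rewrite -(nth_index 0 xs); apply: ideal_gen_nth; rewrite index_mem. Qed.

(** A unit coefficient in a relation would make a generator redundant. *)
Lemma minimal_generators_min (s : seq R) : minimal_generators s -> min_gens s.
Proof.
move=> [ms smin]; split=> [x /ideal_gen_mem|| c cs i]; first by rewrite ms.
  by apply: spans_maxP => x xm; rewrite ms.
apply: contraT; rewrite maxE negbK => ci; case: (smin i (ltn_ord i)).
set t := take i s ++ drop i.+1 s.
have ts x : x \in t -> x \in s.
  by rewrite mem_cat => /orP[/mem_take|/mem_drop].
have [t0 tD tM] := ideal_gen_ideal t.
have st (k : 'I_(size s)) : k != i -> s`_k \in t.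
  rewrite -val_eqE /= neq_ltn mem_cat => /orP[ki|ik]; apply/orP; [left | right].
    by rewrite -(nth_take 0 ki); apply: mem_nth; rewrite size_take ltn_ord.
  rewrite -(subnKC ik) -nth_drop; apply: mem_nth; rewrite size_drop.
  by rewrite ltn_sub2r // (leq_ltn_trans ik).
rewrite -ms; apply/seteqP; split=> [x [d ->]|x [d ->]].
  apply: is_ideal_sum => [|k _]; first exact: ideal_gen_ideal.
  by have [_ _] := ideal_gen_ideal s; apply; apply/ideal_gen_mem/ts/mem_nth.
apply: is_ideal_sum => [|k _]; first exact: ideal_gen_ideal.
apply: (tM); have [->|ki] := eqVneq k i; last by apply/ideal_gen_mem/st.
have -> : s`_i = \sum_(k | k != i) (- (c k / c i)) * s`_k.
  move: cs; rewrite (bigD1 i) //= => /eqP; rewrite addr_eq0 => /eqP cs.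
  rewrite -[LHS](mulKr ci) cs mulrN mulr_sumr -sumrN; apply: eq_bigr => l _.
  by rewrite mulNr mulrA [_ / _]mulrC.
apply: is_ideal_sum => [|l li]; first exact: ideal_gen_ideal.
by apply: (tM); apply/ideal_gen_mem/st.
Qed.

Lemma max_ideal_gensP : min_gens (max_ideal_gens R).
Proof.
apply: minimal_generators_min; rewrite /max_ideal_gens; case: xgetP => [s _ //|].
have idm : is_ideal [set x | x \in max_ideal R].
  by split=> [|x y|a x]; [exact: max0 | exact: maxD | exact: maxMl].
have [s0 /esym ms0] := ideal_fg _ idm.
have ex : exists n, `[< exists2 s : seq R, size s = n & ideal_gen s = [set x | x \in max_ideal R] >].
  by exists (size s0); apply/asboolP; exists s0.
case: (ex_minnP ex) => n /asboolP[s sn ms] nmin /(_ s)[]; split=> // i si mt.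
have : (n <= size (take i s ++ drop i.+1 s))%N.
  by apply: nmin; apply/asboolP; exists (take i s ++ drop i.+1 s).
by rewrite size_cat size_take size_drop si -sn; lia.
Qed.

Lemma min_gens_size (s t : seq R) : min_gens s -> min_gens t -> size s = size t.
Proof.
move=> [sm ms si] [tm mt ti].
have express (u w : seq R) : (forall x, x \in u -> x \in max_ideal R) -> spans_max (size w) w ->
    exists C : 'I_(size u) -> 'I_(size w) -> R, forall i : 'I_(size u), u`_i = \sum_j C i j * w`_j.
  move=> um mw; suff /fin_all_exists[C uC] : forall i : 'I_(size u),
    exists C : 'I_(size w) -> R, u`_i = \sum_j C j * w`_j by exists C.
  move=> i; have [|b ub] := mw u`_i; first by apply/um/mem_nth.
  by exists (fun j => b`_j); rewrite ub lincombE.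
have [C sC] := express s t sm mt; have [D tD] := express t s tm ms.
have aux (u w : seq R) (C' : 'I_(size u) -> 'I_(size w) -> R) (D' : 'I_(size w) -> 'I_(size u) -> R) :
    (forall c : 'I_(size u) -> R, \sum_i c i * u`_i = 0 -> forall i, c i \in max_ideal R) ->
    (forall i : 'I_(size u), u`_i = \sum_j C' i j * w`_j) ->
    (forall i : 'I_(size w), w`_i = \sum_j D' i j * u`_j) ->
    forall i j, (\matrix_(i, j) C' i j *m \matrix_(i, j) D' i j - 1%:M) i j \in max_ideal R.
  move=> ui uC wD i j; rewrite !mxE.
  under eq_bigr do rewrite !mxE.
  apply: (ui (fun j => \sum_k C' i k * D' k j - (i == j)%:R)).
  under eq_bigr do rewrite mulrBl.
  rewrite sumrB [X in _ - X](bigD1 i) //= eqxx mul1r [X in _ - (_ + X)]big1 => [|k]; last first.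
    by rewrite eq_sym => /negPf ->; rewrite mul0r.
  rewrite addr0 [X in _ - X]uC.
  have -> : \sum_k (\sum_l C' i l * D' l k) * u`_k = \sum_l \sum_k C' i l * D' l k * u`_k.
    by rewrite exchange_big /=; apply: eq_bigr => k _; rewrite mulr_suml.
  rewrite -sumrB big1 // => l _; apply/eqP; rewrite subr_eq0; apply/eqP.
  by rewrite wD mulr_sumr; apply: eq_bigr => k _; rewrite mulrA.
exact: inverse_mod_max_size (aux _ _ C D si sC tD) (aux _ _ D C ti tD sC).
Qed.

(** Minimal generating families have the same size and the same Koszul homology
    (kh_gens); kffun identifies the two models of chains. *)
Lemma koszul_dimE (M : lmodType R) (s : seq R) (i : nat) : fg_module M -> min_gens s ->
  koszul_dim M i = kh M (size s) s i.
Proof.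
move=> fgM gs; have ge := max_ideal_gensP; have [em me _] := ge; have [sm ms _] := gs.
rewrite -(kh_gens i fgM (min_gens_size ge gs) em sm me ms).
set e := max_ideal_gens R in me *; rewrite /koszul_dim -/e.
have bdE (v : kch (size e) M) : koszul_bd (s := e) (kffun v) = kffun (kd e v).
  by apply/ffunP => T; rewrite kffun_kd ffunE.
have degE k (v : kch (size e) M) : koszul_deg (s := e) k (kffun v) <-> kdeg k v.
  by split=> [dv|/kffun_deg dv S Sk]; [apply/kffun_deg => S Sk | ]; apply: dv.
have kl := @kffun_lin R M (size e).
apply: (residue_dim_liniso (f := @kffun R M (size e)) (fg_kch _ fgM) kl (kcyc_kspace M i me)).
- split; first by exists 0; [|by rewrite -(semilin0 kl) bdE kd0];
    rewrite -(semilin0 kl); apply/degE; apply: submod0 (kdeg_submod _ _).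
  move=> a _ _ [g dg ->] [h dh ->].
  have [v gv] := kffun_surj g; have [w hw] := kffun_surj h; subst g h.
  exists (kffun (a *: v + w)); last by rewrite !bdE -kl kd_lin.
  by apply/degE; apply: (kdeg_submod _ _).2; apply/degE.
- by move=> v [dv cv]; split; [apply/degE | rewrite bdE cv (semilin0 kl)].
- move=> v _; split=> [[g dg]|[w dw ->]].
    have [w gw] := kffun_surj g; subst g; rewrite bdE => /kffun_inj ->.
    by exists w => //; rewrite -PoszD addn1; apply/degE.
  by exists (kffun w); [apply/degE; rewrite -addn1 PoszD | rewrite bdE].
- move=> g [dg cg]; have [v gv] := kffun_surj g; subst g; exists v.
    by split; [apply/degE | apply: (@kffun_inj R M (size e)); rewrite -bdE cg (semilin0 kl)].
  rewrite subrr; exists 0; last by rewrite -(semilin0 kl) bdE kd0.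
  by rewrite -(semilin0 kl); apply/degE; apply: submod0 (kdeg_submod _ _).
Qed.

(** The vanishing of one coefficient of the boundary of v is a relation between
    the minimal generators s, with coefficients among those of v. *)
Lemma cycle_coef_max (s : seq R) (i : int) (v : kch (size s) R^o) : min_gens s ->
  0 < i -> kcyc (size s) s i v -> kco (fun x : R^o => (x : R) \in max_ideal R) v.
Proof.
move=> [_ _ si] i0 [/kffun_deg dv cv]; apply: kffun_co => S.
have [Si|/dv ->] := eqVneq #|S|%:Z i; last exact: max0.
have /card_gt0P[j jS] : (0 < #|S|)%N by rewrite -ltz_nat Si.
(* up to sign, s_j times the coefficient at S occurs in the boundary at S - j *)
pose T := S :\ j.
have := kffun_kd s v T; rewrite cv (semilin0 (@kffun_lin _ _ _)) ffunE.
pose c k := if k \in T then 0 else (-1) ^+ #|[set t in T | (t < k)%N]%SET| * (kffun v (k |: T) : R).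
rewrite (_ : \sum_(_ | _) _ = \sum_k c k * s`_k) => [/esym/si/(_ j)|]; last first.
  rewrite big_mkcond /=; apply: eq_bigr => k _; rewrite /c.
  by case: (k \in T); rewrite /= ?mul0r // mulrAC.
rewrite /c !inE eqxx /= finset.setD1K // => /(maxMl ((-1) ^+ #|[set t in T | (t < j)%N]%SET|)).
by rewrite mulrA -expr2 sqrr_sign mul1r.
Qed.

End KoszulDim.

(** * Free resolutions of subquotients *)

Lemma dependent_choice (T : nat -> Type) (P : forall i, T i -> Prop)
    (Q : forall i, T i -> T i.+1 -> Prop) (x0 : T 0%N) :
  P 0%N x0 -> (forall i x, P i x -> exists2 y, Q i x y & P i.+1 y) ->
  exists2 f : forall i, T i, f 0%N = x0 & forall i, Q i (f i) (f i.+1).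
Proof.
move=> P0 PQ.
pose next i (x : {x : T i | P i x}) : {y : T i.+1 | Q i (sval x) y /\ P i.+1 y} :=
  cid (let: ex_intro2 y q p := PQ i (sval x) (svalP x) in ex_intro _ y (conj q p)).
pose g := fix g i : {x : T i | P i x} :=
  match i with
  | 0 => exist _ x0 P0
  | i'.+1 => exist _ (sval (next i' (g i'))) (svalP (next i' (g i'))).2
  end.
by exists (fun i => sval (g i)) => // i; apply: (svalP (next i (g i))).1.
Qed.

Section FreeComplexes.
Variable R : noethLocalRingType.

Record freecx := FreeCx {
  frk : nat -> nat;
  fbd : forall i, 'M[R]_(frk i.+1, frk i)
}.

Definition resbd (F : freecx) i : 'M[residue_field R]_(frk F i.+1, frk F i) :=
  map_mx (@residue_map R) (fbd F i).

Definition fcycles (F : freecx) i : 'M[residue_field R]_(frk F i) :=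
  match i with 0 => 1%:M | i'.+1 => kermx (resbd F i') end.

(** The dimension of H_i(k (x) F). *)
Definition hdim (F : freecx) i := (\rank (fcycles F i) - \rank (resbd F i))%N.

Definition minimalcx (F : freecx) := forall i k l, fbd F i k l \in max_ideal R.

Lemma hdim_le (F : freecx) i : (hdim F i <= frk F i)%N.
Proof. by rewrite (leq_trans (leq_subr _ _)) // rank_leq_row. Qed.

Lemma hdim_min (F : freecx) i : minimalcx F -> hdim F i = frk F i.
Proof.
move=> Fm; have res0 k : resbd F k = 0.
  by apply/matrixP => a b; rewrite !mxE; apply/eqP; rewrite residue_map_eq0; apply: Fm.
rewrite /hdim res0 mxrank0 subn0; case: i => [|i] /=; first exact: mxrank1.
by rewrite mxrank_ker res0 mxrank0 subn0.
Qed.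

Section Resolutions.
Variable V : lmodType R.
Implicit Types Z B : set V.

(** A free resolution of the subquotient Z / B, whose augmentation is given by a
    linear map to V with values in Z. *)
Definition fresolves Z B (F : freecx) (aug : 'rV[R]_(frk F 0) -> V) : Prop :=
  [/\ lin aug, forall u, Z (aug u), forall z, Z z -> exists u, B (z - aug u),
      forall u, B (aug u) <-> exists w, u = w *m fbd F 0
    & forall i (u : 'rV_(frk F i.+1)), u *m fbd F i = 0 <-> exists w, u = w *m fbd F i.+1].

Arguments fresolves : clear implicits.

Lemma rows_lift m n p (C : 'M[R]_(m, n)) (D : 'M[R]_(p, n)) :
  (forall i, exists w, row i C = w *m D) -> exists E, C = E *m D.
Proof.
move=> /fin_all_exists[w wP]; exists (\matrix_i w i).
by apply/row_matrixP => i; rewrite row_mul rowK.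
Qed.

Lemma mul_rows_eq m n (C D : 'M[R]_(m, n)) : (forall u : 'rV_m, u *m C = u *m D) -> C = D.
Proof. by move=> CD; apply/row_matrixP => i; rewrite !rowE. Qed.

Lemma fresolves_bdbd Z B F aug i : fresolves Z B F aug -> fbd F i.+1 *m fbd F i = 0.
Proof.
move=> [_ _ _ _ ex]; apply: mul_rows_eq => u; rewrite mulmx0 mulmxA.
by apply/ex; exists u.
Qed.

Lemma fresolves_lift Z B F aug i m (C : 'M[R]_(m, frk F i.+1)) : fresolves Z B F aug ->
  C *m fbd F i = 0 -> exists E, C = E *m fbd F i.+1.
Proof.
move=> [_ _ _ _ ex] C0; apply: rows_lift => k.
by apply/ex; rewrite -row_mul C0 row0.
Qed.

(** Comparison of resolutions: the identity of Z / B lifts to a chain map. *)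
Lemma chain_map_exists Z B F aug F' aug' : submod B ->
  fresolves Z B F aug -> fresolves Z B F' aug' ->
  exists phi : forall i, 'M[R]_(frk F i, frk F' i),
    (forall u, B (aug u - aug' (u *m phi 0%N))) /\
    forall i, fbd F i *m phi i = phi i.+1 *m fbd F' i.
Proof.
move=> sB rF rF'; have [al Za _ Ba _] := rF; have [al' Za' sa' Ba' _] := rF'.
have /fin_all_exists[w wP] i : exists w, B (aug (delta_mx 0 i) - aug' w) by apply: sa'.
pose phi0 := \matrix_i w i.
have phi0P u : B (aug u - aug' (u *m phi0)).
  rewrite [in aug u](row_sum_delta u) mulmx_sum_row (semilin_sum al) (semilin_sum al') -sumrB.
  apply: submod_sum => // i _; rewrite (semilinZ al) (semilinZ al') -scalerBr rowK.
  exact: submodZ.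
have [||phi p0 pP] := @dependent_choice (fun i => 'M[R]_(frk F i, frk F' i))
  (fun i x => exists y, fbd F i *m x = y *m fbd F' i)
  (fun i x y => fbd F i *m x = y *m fbd F' i) phi0.
- apply: rows_lift => k; apply/Ba'; rewrite row_mul rowE.
  set u := _ *m fbd F 0; have Bu : B (aug u) by apply/Ba; exists (delta_mx 0 k).
  by have := submodB sB Bu (phi0P u); rewrite opprB addrC subrK.
- move=> i x [y xy]; exists y => //; apply: (fresolves_lift rF').
  by rewrite -mulmxA -xy mulmxA (fresolves_bdbd _ rF) mul0mx.
by exists phi; split=> // u; rewrite p0.
Qed.

(** Uniqueness up to homotopy of the lifts of chain_map_exists: applied to the
    difference of an endomorphism lifting the identity with the identity. *)
Lemma homotopy_exists Z B F aug (th : forall i, 'M[R]_(frk F i)) : fresolves Z B F aug ->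
  (forall u, B (aug (u *m th 0%N))) -> (forall i, fbd F i *m th i = th i.+1 *m fbd F i) ->
  exists h : forall i, 'M[R]_(frk F i, frk F i.+1), th 0%N = h 0%N *m fbd F 0 /\
    forall i, th i.+1 = h i.+1 *m fbd F i.+1 + fbd F i *m h i.
Proof.
move=> rF th0 thP; have [al Za _ Ba _] := rF.
have [h0 h0P] : exists h0, th 0%N = h0 *m fbd F 0.
  by apply: rows_lift => k; apply/Ba; rewrite rowE.
have [||h hE hP] := @dependent_choice (fun i => 'M[R]_(frk F i, frk F i.+1))
  (fun i x => fbd F i *m th i = fbd F i *m x *m fbd F i)
  (fun i x y => th i.+1 = y *m fbd F i.+1 + fbd F i *m x) h0.
- by rewrite h0P mulmxA.
- move=> i x xP; have [|y yP] := @fresolves_lift Z B F aug i _ (th i.+1 - fbd F i *m x) rF.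
    by rewrite mulmxBl -thP xP subrr.
  have yP' : th i.+1 = y *m fbd F i.+1 + fbd F i *m x by rewrite -yP subrK.
  exists y => //.
  by rewrite yP' mulmxDr !mulmxA (fresolves_bdbd _ rF) mul0mx addr0.
by exists h; rewrite hE.
Qed.

(** A map f of complexes with a left inverse g up to homotopy is injective on
    homology; C and D are the cycles and the boundaries. *)
Lemma homology_rank_le (K : fieldType) n n' m m' (C : 'M[K]_n) (D : 'M[K]_(m, n))
    (C' : 'M[K]_n') (D' : 'M[K]_(m', n')) (f : 'M[K]_(n, n')) (g : 'M[K]_(n', n)) :
  (D <= C)%MS -> (D' <= C')%MS -> (C *m f <= C')%MS -> (D' *m g <= D)%MS ->
  (C *m (f *m g - 1%:M) <= D)%MS -> (\rank C - \rank D <= \rank C' - \rank D')%N.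
Proof.
move=> DC DC' Cf Dg Cfg.
have e : (\rank D' + \rank (C' :\: D')%MS = \rank C')%N.
  by rewrite -[RHS](mxrank_cap_compl C' D') (capmx_idPr DC').
have CCD : (C <= D + (C' :\: D')%MS *m g)%MS.
  have -> : C = C *m f *m g - C *m (f *m g - 1%:M) by rewrite mulmxBr mulmx1 mulmxA opprB addrC subrK.
  apply: addmx_sub; last by rewrite eqmx_opp (submx_trans Cfg) // addsmxSl.
  apply: submx_trans (submxMr g Cf) _.
  have CDC : (C' <= D' + (C' :\: D')%MS)%MS.
    have /andP[_ le] := introT eqmxP (addsmx_diff_cap_eq C' D').
    by apply: submx_trans le _; rewrite addsmxC addsmxS // capmxSr.
  by apply: submx_trans (submxMr g CDC) _; rewrite addsmxMr addsmxS.
have := leq_trans (mxrankS CCD) (mxrank_adds_leqif _ _).1.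
have := mxrankM_maxl (C' :\: D')%MS g.
by move: e; lia.
Qed.

Lemma hdim_le_of_resolutions Z B F aug F' aug' i : submod B ->
  fresolves Z B F aug -> fresolves Z B F' aug' -> (hdim F i <= hdim F' i)%N.
Proof.
move=> sB rF rF'; have [al Za _ Ba _] := rF; have [al' Za' sa' Ba' _] := rF'.
have [phi [phi0 phiP]] := chain_map_exists sB rF rF'.
have [psi [psi0 psiP]] := chain_map_exists sB rF' rF.
have [||h [h0 hP]] := @homotopy_exists Z B F aug (fun i => phi i *m psi i - 1%:M) rF.
- move=> u; rewrite mulmxBr mulmx1 (semilinB al) mulmxA -opprB.
  apply: submodN => //; rewrite -[X in B X](subrKA (aug' (u *m phi 0%N))).
  by apply: submodD.
- by move=> k; rewrite mulmxBr mulmx1 mulmxBl mul1mx mulmxA phiP -mulmxA psiP mulmxA.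
have res0 (G : freecx) a k : fresolves Z B G a -> resbd G k.+1 *m resbd G k = 0.
  by move=> rG; rewrite -map_mxM (fresolves_bdbd _ rG) map_mx0.
have bdc (G : freecx) a k : fresolves Z B G a -> (resbd G k <= fcycles G k)%MS.
  by case: k => [|k] rG /=; [exact: submx1 | rewrite sub_kermx (res0 _ _ _ rG)].
pose rphi k := map_mx (@residue_map R) (phi k); pose rpsi k := map_mx (@residue_map R) (psi k).
pose rh k := map_mx (@residue_map R) (h k).
have rphiP k : resbd F k *m rphi k = rphi k.+1 *m resbd F' k by rewrite -!map_mxM phiP.
have rpsiP k : resbd F' k *m rpsi k = rpsi k.+1 *m resbd F k by rewrite -!map_mxM psiP.
apply: (@homology_rank_le _ _ _ _ _ _ _ _ _ (rphi i) (rpsi i)).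
- exact: bdc rF.
- exact: bdc rF'.
- case: i => [|i] /=; first exact: submx1.
  by rewrite sub_kermx -mulmxA -rphiP mulmxA mulmx_ker mul0mx.
- by rewrite rpsiP submxMl.
- rewrite -map_mxM -(map_mx1 (@residue_map R)) -map_mxB.
  case: i => [|i] /=; first by rewrite mul1mx h0 map_mxM submxMl.
  by rewrite hP map_mxD !map_mxM mulmxDr !mulmxA mulmx_ker mul0mx addr0 submxMl.
Qed.

(** dim Tor_i(k, Z / B), defined on subquotients because the homology of
    complexes of free modules is met in this form. *)
Definition tord Z B i : nat :=
  xget 0%N [set d | exists F aug, fresolves Z B F aug /\ d = hdim F i].

Lemma tordE Z B F aug i : submod B -> fresolves Z B F aug -> tord Z B i = hdim F i.
Proof.
move=> sB rF; rewrite /tord; case: xgetP => [d _ [F' [aug' [rF' ->]]]|/(_ (hdim F i))[]].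
  by apply/eqP; rewrite eqn_leq !(hdim_le_of_resolutions _ sB rF rF') !(hdim_le_of_resolutions _ sB rF' rF).
by exists F, aug.
Qed.

End Resolutions.
Arguments fresolves {V} Z B F aug.

Lemma tor_dimE (M : lmodType R) i : tor_dim M i = tord [set: M] [set 0] i.
Proof.
rewrite /tor_dim /tord; congr xget; apply/seteqP; split=> [d [F ->]|d [F [aug [rF ->]]]].
  exists (FreeCx (bd F)), (aug F); split.
    split=> //; first exact: linear_lin.
    - by move=> z _; have [u <-] := aug_surj F z; exists u; rewrite /= subrr.
    - exact: aug_exact.
    - exact: bd_exact.
  by rewrite /cycles_dim /hdim; case: i => [|i]; rewrite //= mxrank1.
have [al _ sa Ba ex] := rF.
have alin : linear aug by move=> a x y; apply: al.
pose lm := GRing.isLinear.Build R 'rV[R]_(frk F 0) M *:%R aug alin.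
pose la : {linear 'rV[R]_(frk F 0) -> M} := HB.pack aug lm.
have la_surj x : exists u, la u = x.
  by have [u /= /eqP] := sa x I; rewrite subr_eq0 => /eqP ->; exists u.
exists (FreeResolution la_surj Ba ex).
by rewrite /cycles_dim /hdim; case: i => [|i]; rewrite //= mxrank1.
Qed.

End FreeComplexes.
Arguments fresolves {R V} Z B F aug.

(** * Minimal resolutions, syzygies and the horseshoe lemma *)

Section MinimalResolutions.
Variable R : noethLocalRingType.

Lemma fg_rV n : fg_module 'rV[R]_n.
Proof. by exists n, (fun i => delta_mx 0 i) => x; exists (x 0); apply: row_sum_delta. Qed.

Lemma mulmx_lin m n (D : 'M[R]_(m, n)) : lin (fun u : 'rV_m => u *m D).
Proof. by move=> a x y; rewrite mulmxDl scalemxAl. Qed.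

Definition kerset m n (D : 'M[R]_(m, n)) : set 'rV[R]_m := [set u | u *m D = 0].

Lemma kerset_submod m n (D : 'M[R]_(m, n)) : submod (kerset D).
Proof. exact: (semilin_preim (@mulmx_lin _ _ D) (@submod_set0 _ _)). Qed.

Definition inmax m : set 'rV[R]_m := [set u | forall k, u 0 k \in max_ideal R].

Lemma inmax_submod m : submod (@inmax m).
Proof.
split=> [k|a x y xm ym k]; rewrite !mxE ?max0 //.
by apply: maxD => //; apply: maxMl.
Qed.

(** One step of a minimal resolution: the rows of D are a residue basis of U,
    so that relations between them have no unit coefficients. *)
Lemma syzygy_matrix n (U : set 'rV[R]_n) : submod U ->
  exists m (D : 'M[R]_(m, n)),
    (forall u, U u <-> exists w, u = w *m D) /\ kerset D `<=` @inmax m.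
Proof.
move=> sU; have [m [v [Uv vs vi]]] :=
  residue_basis_exists (@submod_set0 _ 'rV[R]_n) (noetherian (fg_rV n) sU).
exists m, (\matrix_i v i).
have DE (w : 'rV_m) : w *m \matrix_i v i = \sum_i w 0 i *: v i.
  by rewrite mulmx_sum_row; under eq_bigr do rewrite rowK.
split=> [u|w]; last by rewrite /kerset /= DE => /vi wm i; apply: wm.
split=> [Uu|[w ->]]; last by rewrite DE; apply: submod_sum => // i _; apply: submodZ.
have [c /= /eqP] := vs _ Uu; rewrite subr_eq0 => /eqP uc.
by exists (\row_i c i); rewrite DE uc; apply: eq_bigr => i _; rewrite mxE.
Qed.

Record syzygy := Syzygy { syz_rk : nat; syz_set : set 'rV[R]_syz_rk; syz_sub : submod syz_set }.

Definition next_rk (s : syzygy) : nat := projT1 (cid (syzygy_matrix (syz_sub s))).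
Definition next_bd (s : syzygy) : 'M[R]_(next_rk s, syz_rk s) :=
  projT1 (cid (projT2 (cid (syzygy_matrix (syz_sub s))))).
Definition next_syz (s : syzygy) : syzygy := Syzygy (kerset_submod (next_bd s)).

Lemma next_bdP s : (forall u, syz_set u <-> exists w, u = w *m next_bd s) /\
  kerset (next_bd s) `<=` @inmax _.
Proof. exact: projT2 (cid (projT2 (cid (syzygy_matrix (syz_sub s))))). Qed.

Definition syzcx (s : syzygy) : freecx R :=
  @FreeCx R (fun i => syz_rk (iter i next_syz s)) (fun i => next_bd (iter i next_syz s)).

Lemma minimal_resolution (V : lmodType R) (Z B : set V) :
  fg_module V -> submod Z -> submod B -> B `<=` Z ->
  exists F aug, fresolves Z B F aug /\ minimalcx F.
Proof.
move=> fgV sZ sB BZ; have [n [v [Zv vs vi]]] := residue_basis_exists sB (noetherian fgV sZ).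
pose aug (u : 'rV[R]_n) := \sum_i u 0 i *: v i.
have al : lin aug.
  move=> a x y; rewrite /aug scaler_sumr -big_split; apply: eq_bigr => i _.
  by rewrite !mxE scalerDl scalerA.
have sU : submod (fun u => B (aug u)) by exact: (semilin_preim al sB).
pose s := Syzygy sU; exists (syzcx s), aug.
have bdm i : @syz_set (iter i next_syz s) `<=` @inmax _.
  by case: i => [u /vi um k|i]; [apply: um | exact: (next_bdP _).2].
split; last first.
  move=> i k l; have [+ _] := next_bdP (iter i next_syz s).
  move=> /(_ (row k (next_bd (iter i next_syz s))))[_ rowU].
  have /bdm/(_ l) : syz_set (row k (next_bd (iter i next_syz s))).
    by apply: rowU; exists (delta_mx 0 k); rewrite rowE.
  by rewrite mxE.
split=> //.
- by move=> u; apply: submod_sum => // i _; apply: submodZ.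
- move=> z /vs[c Bc]; exists (\row_i c i).
  by rewrite /aug; under eq_bigr do rewrite mxE.
- exact: (next_bdP s).1.
- by move=> i u; apply: (next_bdP (iter i.+1 next_syz s)).1.
Qed.

Lemma tord_minimal (V : lmodType R) (Z B : set V) F aug i : submod B ->
  fresolves Z B F aug -> minimalcx F -> tord Z B i = frk F i.
Proof. by move=> sB rF mF; rewrite (tordE i sB rF) hdim_min. Qed.

Lemma tord_le (V : lmodType R) (Z B : set V) F aug i : submod B ->
  fresolves Z B F aug -> (tord Z B i <= frk F i)%N.
Proof. by move=> sB rF; rewrite (tordE i sB rF) hdim_le. Qed.

Lemma fresolves_transport (V W : lmodType R) (f : V -> W) (Z B : set V) (Z' B' : set W) F aug :
  lin f -> submod Z -> submod B' ->
  (forall z, Z z -> Z' (f z)) -> (forall z, Z z -> B' (f z) <-> B z) ->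
  (forall z', Z' z' -> exists2 z, Z z & B' (z' - f z)) ->
  fresolves Z B F aug -> fresolves Z' B' F (f \o aug).
Proof.
move=> fl sZ sB' fZ fB fS [al Za sa Ba ex]; split=> //.
- exact: lin_comp.
- by move=> u; apply/fZ/Za.
- move=> z' /fS[z Zz Bz]; have [u Bu] := sa z Zz; exists u => /=.
  rewrite -[z'](subrK (f z)) -addrA; apply: submodD => //.
  by rewrite -(semilinB fl); apply/fB => //; apply: submodB.
- by move=> u; rewrite /= fB.
Qed.

Lemma tord_iso (V W : lmodType R) (f : V -> W) (Z B : set V) (Z' B' : set W) i :
  fg_module V -> lin f -> submod Z -> submod B -> B `<=` Z -> submod B' ->
  (forall z, Z z -> Z' (f z)) -> (forall z, Z z -> B' (f z) <-> B z) ->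
  (forall z', Z' z' -> exists2 z, Z z & B' (z' - f z)) ->
  tord Z' B' i = tord Z B i.
Proof.
move=> fgV fl sZ sB BZ sB' fZ fB fS; have [F [aug [rF _]]] := minimal_resolution fgV sZ sB BZ.
by rewrite (tordE i sB rF) (tordE i sB' (fresolves_transport fl sZ sB' fZ fB fS rF)).
Qed.

(** ** Syzygies *)

Lemma rows_lin m n (f : 'rV[R]_m -> 'rV[R]_n) : lin f ->
  forall u, u *m \matrix_i f (delta_mx 0 i) = f u.
Proof.
move=> fl u; rewrite [in RHS](row_sum_delta u) (semilin_sum fl) mulmx_sum_row.
by apply: eq_bigr => i _; rewrite (semilinZ fl) rowK.
Qed.

Definition cons_rk b (F : freecx R) i := if i is i'.+1 then frk F i' else b.

Definition cons_cx b (F : freecx R) (D : 'M[R]_(frk F 0, b)) : freecx R :=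
  @FreeCx R (cons_rk b F)
    (fun i => match i return 'M[R]_(cons_rk b F i.+1, cons_rk b F i) with
              | 0 => D | i'.+1 => fbd F i' end).

(** A minimal resolution of U, continued by the inclusion of U in the free
    module, is a minimal resolution of the quotient because the entries of this
    inclusion lie in the maximal ideal. *)
Lemma syzygy_resolution b (U : set 'rV[R]_b) : submod U -> U `<=` @inmax b ->
  exists F aug, [/\ fresolves U [set 0] F aug, minimalcx F
   & exists D : 'M[R]_(frk F 0, b), minimalcx (cons_cx D) /\
     fresolves [set: 'rV[R]_b] U (cons_cx D) id].
Proof.
move=> sU Um; have s0 := @submod_set0 _ 'rV[R]_b.
have U0 : [set 0] `<=` U by move=> _ ->; apply: submod0.
have [F [aug [rF mF]]] := minimal_resolution (fg_rV b) sU s0 U0.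
exists F, aug; split=> //; have [al Za sa Ba ex] := rF.
pose D := \matrix_i aug (delta_mx 0 i); exists D.
have DE : forall u, u *m D = aug u by apply: rows_lin.
split.
  case=> [|i] k l /=; last exact: mF.
  by rewrite mxE; apply/Um/Za.
split=> //=.
- by move=> z _; exists z; rewrite subrr; apply: submod0.
- move=> u; split=> [Uu|[w ->]]; last by rewrite DE; apply: Za.
  have [w /eqP] := sa u Uu; rewrite subr_eq0 => /eqP uw.
  by exists w; rewrite DE.
- by case=> [|i] u /=; [rewrite DE; apply: Ba | apply: ex].
Qed.

Lemma tord_syzygy0 b (U : set 'rV[R]_b) : submod U -> U `<=` @inmax b ->
  tord [set: 'rV[R]_b] U 0 = b.
Proof.
move=> sU Um; have [F [aug [_ _ [D [mD rD]]]]] := syzygy_resolution sU Um.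
by rewrite (tord_minimal 0 sU rD mD).
Qed.

Lemma tord_syzygyS b (U : set 'rV[R]_b) i : submod U -> U `<=` @inmax b ->
  tord [set: 'rV[R]_b] U i.+1 = tord U [set 0] i.
Proof.
move=> sU Um; have [F [aug [rF mF [D [mD rD]]]]] := syzygy_resolution sU Um.
by rewrite (tord_minimal _ sU rD mD) (tord_minimal i (@submod_set0 _ _) rF mF).
Qed.

(** ** The horseshoe lemma *)

Section Horseshoe.
Variables (F F' : freecx R) (th : forall i, 'M[R]_(frk F' i.+1, frk F i)).

Definition horsecx : freecx R :=
  @FreeCx R (fun i => frk F' i + frk F i)%N
    (fun i => block_mx (fbd F' i) (th i) 0 (fbd F i)).

Lemma mul_horse i (u : 'rV_(frk F' i.+1 + frk F i.+1)) :
  u *m fbd horsecx i =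
  row_mx (lsubmx u *m fbd F' i) (lsubmx u *m th i + rsubmx u *m fbd F i).
Proof. by rewrite -[in LHS](hsubmxK u) mul_row_block mulmx0 addr0. Qed.

End Horseshoe.

(** aug' maps the boundaries of F' into Z only; the block th of the differential
    corrects this modulo B, and is found degree by degree from the exactness of
    F. *)
Lemma horseshoe (V : lmodType R) (B Z Y : set V) F aug F' aug' :
  submod B -> submod Z -> submod Y -> B `<=` Z -> Z `<=` Y ->
  fresolves Z B F aug -> fresolves Y Z F' aug' ->
  exists th aug'', fresolves Y B (@horsecx F F' th) aug''.
Proof.
move=> sB sZ sY BZ ZY rF rF'.
have [al Za sa Ba ex] := rF; have [al' Za' sa' Ba' ex'] := rF'.
have [th0 th0P] : exists th0 : 'M[R]_(frk F' 1, frk F 0),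
    forall w, B (aug' (w *m fbd F' 0) + aug (w *m th0)).
  have /fin_all_exists[c cP] (k : 'I_(frk F' 1)) :
      exists u, B (- aug' (row k (fbd F' 0)) - aug u).
    have Zr : Z (aug' (row k (fbd F' 0))) by apply/(Ba' _).2; exists (delta_mx 0 k); rewrite rowE.
    by apply: sa; apply: submodN.
  exists (\matrix_k c k) => w; rewrite !mulmx_sum_row (semilin_sum al) (semilin_sum al').
  rewrite -big_split; apply: submod_sum => // k _.
  rewrite (semilinZ al) (semilinZ al') /= -scalerDr rowK; apply: submodZ => //.
  by rewrite -[_ + _]opprK; apply: submodN; rewrite // opprD.
have [||th thE thP] := @dependent_choice (fun i => 'M[R]_(frk F' i.+1, frk F i))
  (fun i x => exists y, fbd F' i.+1 *m x = y *m fbd F i)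
  (fun i x y => fbd F' i.+1 *m x + y *m fbd F i = 0) th0.
- apply: rows_lift => k; apply/Ba; rewrite rowE mulmxA.
  have := th0P (delta_mx 0 k *m fbd F' 1).
  by rewrite -[X in aug' X]mulmxA (fresolves_bdbd _ rF') mulmx0 (semilin0 al') add0r.
- move=> i x [y xy]; exists (- y); first by rewrite mulNmx xy subrr.
  apply: (fresolves_lift rF); rewrite mulmxN mulNmx -mulmxA -xy mulmxA.
  by rewrite (fresolves_bdbd _ rF') mul0mx oppr0.
rewrite -thE in th0P.
exists th, (fun u => aug' (lsubmx u) + aug (rsubmx u)); split=> /=.
- by move=> a x y; rewrite !linearP /= al al' scalerDr; abelian.
- by move=> u; apply: submodD => //; apply/ZY/Za.
- move=> z /sa'[u' /sa[u Bu]]; exists (row_mx u' u).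
  by rewrite row_mxKl row_mxKr opprD addrA.
- move=> u; split=> [Bu|[w ->]]; last first.
    rewrite (@mul_horse F F' th) row_mxKl row_mxKr (semilinD al) addrA.
    by apply: submodD => //; apply/Ba; exists (rsubmx w).
  have /Ba'[w' w'E] : Z (aug' (lsubmx u)).
    by rewrite -[aug' _](addrK (aug (rsubmx u))); apply: submodB; [|apply: BZ|].
  have /Ba[w wE] : B (aug (rsubmx u - w' *m th 0%N)).
    rewrite (semilinB al); apply: (@submod_subr _ _ _ _ (- (aug' (w' *m fbd F' 0) + aug (w' *m th 0%N)))) => //.
      rewrite -w'E; have -> : aug (rsubmx u) - aug (w' *m th 0%N) -
         - (aug' (lsubmx u) + aug (w' *m th 0%N)) = aug' (lsubmx u) + aug (rsubmx u) by abelian.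
      by [].
    by apply: submodN.
  exists (row_mx w' w); rewrite (@mul_horse F F' th) row_mxKl row_mxKr -w'E -wE.
  by rewrite addrC subrK hsubmxK.
- move=> i u; split=> [|[w ->]]; last first.
    rewrite (@mul_horse F F' th) (@mul_horse F F' th) row_mxKl row_mxKr.
    rewrite -mulmxA (fresolves_bdbd _ rF') mulmx0 mulmxDl -!mulmxA (fresolves_bdbd _ rF).
    by rewrite mulmx0 addr0 -mulmxDr thP mulmx0 row_mx0.
  rewrite (@mul_horse F F' th) -row_mx0 => /eq_row_mx[/ex'[w' w'E] e2].
  have /ex[w wE] : (rsubmx u - w' *m th i.+1) *m fbd F i = 0.
    rewrite mulmxBl -mulmxA; move: (thP i) => /eqP; rewrite addrC addr_eq0 => /eqP ->.
    by rewrite mulmxN opprK mulmxA -w'E addrC.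
  exists (row_mx w' w); rewrite (@mul_horse F F' th) row_mxKl row_mxKr -w'E -wE.
  by rewrite addrC subrK hsubmxK.
Qed.

(** The horseshoe resolution need not be minimal, whence an inequality. *)
Lemma tord_subadditive (V : lmodType R) (B Z Y : set V) i : fg_module V ->
  submod B -> submod Z -> submod Y -> B `<=` Z -> Z `<=` Y ->
  (tord Y B i <= tord Z B i + tord Y Z i)%N.
Proof.
move=> fgV sB sZ sY BZ ZY.
have [F [aug [rF mF]]] := minimal_resolution fgV sZ sB BZ.
have [F' [aug' [rF' mF']]] := minimal_resolution fgV sY sZ ZY.
have [th [aug'' rH]] := horseshoe sB sZ sY BZ ZY rF rF'.
rewrite (tord_minimal i sB rF mF) (tord_minimal i sZ rF' mF') addnC.
exact: tord_le sB rH.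
Qed.

(** Z / B is a vector space over k of dimension d: it is filtered by the spans of
    the first basis vectors, with quotients k, and Tor is subadditive. *)
Lemma tord_residue_basis (V : lmodType R) (Z B : set V) d (v : 'I_d -> V) i :
  fg_module V -> kspace Z B -> residue_basis Z B v ->
  (tord Z B i <= d * tord [set: R^o] (fun x : R^o => (x : R) \in max_ideal R) i)%N.
Proof.
move=> fgV [sZ sB BZ mZ] [Zv vs vi].
have sm : submod (fun x : R^o => (x : R) \in max_ideal R).
  by split=> [|a x y]; [exact: max0 | move=> xm ym; apply: maxD => //; apply: maxMl].
have fgR : fg_module R^o.
  by exists 1%N, (fun=> 1) => x; exists (fun=> x); rewrite big_ord1 /= [RHS]mulr1.
pose part k : set V := [set z | exists2 c : 'I_d -> R,
   (forall j : 'I_d, (k <= j)%N -> c j = 0) & B (z - \sum_j c j *: v j)].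
have spart k : submod (part k).
  split; first by exists (fun=> 0) => //; rewrite big1 ?subr0; [apply: submod0|move=> j; rewrite scale0r].
  move=> a x y [c c0 Bc] [e e0 Be]; exists (fun j => a * c j + e j).
    by move=> j kj; rewrite c0 // e0 // mulr0 addr0.
  under eq_bigr do rewrite scalerDl -scalerA.
  by rewrite big_split -scaler_sumr /= opprD addrACA -scalerBr; apply: sB.2.
have Bpart k : B `<=` part k.
  by move=> z Bz; exists (fun=> 0) => //; rewrite big1 ?subr0 // => j _; rewrite scale0r.
have mono k : part k `<=` part k.+1.
  by move=> z [c c0 Bc]; exists c => // j kj; apply: c0; apply: ltnW.
have bound k : (k <= d)%N ->
    (tord (part k) B i <= k * tord [set: R^o] (fun x : R^o => (x : R) \in max_ideal R) i)%N.
  elim: k => [_|k IH kd].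
    have BB : part 0 `<=` B.
      by move=> z [c c0]; rewrite big1 ?subr0 // => j _; rewrite c0 // scale0r.
    have -> : part 0 = B by apply/seteqP; split=> //; exact: Bpart.
    pose Z0 : freecx R := @FreeCx R (fun=> 0%N) (fun=> 0).
    rewrite (@tord_le _ B B Z0 (fun=> 0)) //; split=> //=.
    - by move=> a x y; rewrite scaler0 addr0.
    - by move=> u; apply: submod0.
    - by move=> z Bz; exists 0; rewrite subr0.
    - by move=> u; split=> _; [exists 0; apply/matrixP => a [] | apply: submod0].
    - by move=> j u; split=> _; [exists 0|]; apply/matrixP => a [].
  apply: leq_trans (tord_subadditive i fgV sB (spart k) (spart _) (@Bpart k) (@mono k)) _.
  rewrite mulSn [X in (_ <= X)%N]addnC; apply: leq_add; first by apply: IH; apply: ltnW.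
  pose k' := Ordinal kd.
  rewrite (@tord_iso _ _ (fun x : R^o => (x : R) *: v k') [set: R^o]
    (fun x : R^o => (x : R) \in max_ideal R)) //.
  - by move=> a x y; rewrite scalerDl scalerA.
  - move=> x _; exists (fun j => (j == k')%:R * (x : R)).
      by move=> j; rewrite leqNgt; case: eqVneq => [->|_ _]; rewrite ?ltnSn // mul0r.
    rewrite (bigD1 k') //= eqxx mul1r big1 ?addr0 ?subrr; first exact: submod0.
    by move=> j /negPf ->; rewrite mul0r scale0r.
  - move=> x _; split=> [[c c0 Bc]|xm]; last by apply/Bpart/mZ.
    have := vi (fun j => (j == k')%:R * (x : R) - c j) _ k'.
    rewrite eqxx mul1r c0 // subr0; apply.
    under eq_bigr do rewrite scalerBl.
    rewrite sumrB (bigD1 k') //= eqxx mul1r big1 ?addr0 //.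
    by move=> j /negPf ->; rewrite mul0r scale0r.
  - move=> z [c c0 Bc]; exists (c k') => //; exists (fun j => if j == k' then 0 else c j).
      move=> j kj; case: eqVneq => // jk; apply: c0.
      by rewrite ltn_neqAle kj andbT eq_sym.
    move: Bc; rewrite (bigD1 k') //= opprD addrA; congr (B (_ - _)).
    rewrite [RHS](bigD1 k') //= eqxx scale0r add0r.
    by apply: eq_bigr => j /negPf ->.
have Zd : Z = part d.
  apply/seteqP; split=> [z /vs[c Bc]|z [c _ Bc]].
    by exists c => // j; rewrite leqNgt ltn_ord.
  by apply: (submod_subr sZ (BZ _ Bc)); apply: submod_sum => // j _; apply: submodZ.
by rewrite Zd; apply: bound.
Qed.

End MinimalResolutions.
Arguments inmax_submod {R} m.

(** * Betti numbers along a retract *)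

Section TotalComplex.
Variables (R A : noethLocalRingType) (j : {rmorphism R -> A}) (p : {rmorphism A -> R}).
Hypotheses (j_local : local_hom j) (pj : cancel j p).
Variables (G : freecx A) (augG : 'rV[A]_(frk G 0) -> restrict_scalars p R^o).
Hypothesis rG : fresolves [set: restrict_scalars p R^o] [set 0] G augG.

Definition shiftcx (F : freecx R) : freecx R :=
  @FreeCx R (fun i => frk F i.+1) (fun i => fbd F i.+1).

(** The total complex of the tensor product over R of F and G, built by
    recursion on the degree: its part of degree n + 1 is that of F_0 (x) G
    together with the part of degree n for the shifted complex. *)
Fixpoint tch (n : nat) (F : freecx R) : lmodType A :=
  if n is n'.+1 then ('M[A]_(frk F 0, frk G n) * tch n' (shiftcx F))%type
  else 'M[A]_(frk F 0, frk G 0).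

Definition tfirst n F : tch n F -> 'M[A]_(frk F 0, frk G n) :=
  match n return tch n F -> 'M[A]_(frk F 0, frk G n) with
  | 0 => id | n'.+1 => fun v => v.1 end.

(** Elements of F_i (x) G_l are matrices with rows indexed by F_i and columns by
    G_l; the differential of G acts on the right, and that of F, transposed, on
    the left. *)
Definition jtr m n (D : 'M[R]_(m, n)) : 'M[A]_(n, m) := (map_mx j D)^T.

Fixpoint tbd (n : nat) (F : freecx R) : tch n.+1 F -> tch n F :=
  match n return tch n.+1 F -> tch n F with
  | 0 => fun v => v.1 *m fbd G 0 + jtr (fbd F 0) *m (v.2 : 'M_(frk F 1, frk G 0))
  | n'.+1 => fun v => (v.1 *m fbd G n'.+1 + jtr (fbd F 0) *m @tfirst n'.+1 (shiftcx F) v.2,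
                         - @tbd n' (shiftcx F) v.2)
  end.

(** The augmentation F_i (x) G_0 -> F_i. *)
Definition teval m (X : 'M[A]_(m, frk G 0)) : 'rV[R]_m := \row_b augG (row b X).

Lemma jtrM m n q (D : 'M[R]_(m, n)) (E : 'M[R]_(n, q)) : jtr (D *m E) = jtr E *m jtr D.
Proof. by rewrite /jtr map_mxM trmx_mul. Qed.

Lemma teval_lin m : semilin p (@teval m).
Proof.
have [al _ _ _ _] := rG.
by move=> a X Y; apply/rowP => b; rewrite !mxE linearP /= al.
Qed.

Lemma teval_jtr m n (D : 'M[R]_(m, n)) X : teval (jtr D *m X) = teval X *m D.
Proof.
have [al _ _ _ _] := rG.
apply/rowP => b; rewrite !mxE row_mul mulmx_sum_row (semilin_sum al).
apply: eq_bigr => k _; rewrite (semilinZ al) !mxE mulrC.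
by rewrite -[in RHS](pj (D k b)).
Qed.

Lemma teval_eq0 m (X : 'M[A]_(m, frk G 0)) : teval X = 0 <-> exists Y, X = Y *m fbd G 0.
Proof.
have [al _ _ Ba _] := rG; split=> [X0|[Y ->]].
  apply: rows_lift => b; apply/Ba.
  by have := congr1 (fun u : 'rV_m => u 0 b) X0; rewrite !mxE.
apply/rowP => b; rewrite !mxE; apply/Ba; exists (row b Y); exact: row_mul.
Qed.

Lemma teval_surj m (w : 'rV[R]_m) : exists X, teval X = w.
Proof.
have [_ _ sa _ _] := rG.
have /fin_all_exists[u uP] b : exists u, w 0 b = augG u.
  by have [u /= /eqP] := sa (w 0 b) I; rewrite subr_eq0 => /eqP ?; exists u.
by exists (\matrix_b u b); apply/rowP => b; rewrite mxE rowK -uP.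
Qed.

Lemma tbd_lin n F : lin (@tbd n F).
Proof.
elim: n F => [|n IH] F a x y /=.
  by rewrite mulmxDl mulmxDr -scalemxAl -scalemxAr scalerDr; abelian.
rewrite IH; apply: injective_projections => /=.
  by rewrite mulmxDl mulmxDr -scalemxAl -scalemxAr scalerDr; abelian.
by rewrite opprD scalerN.
Qed.

Definition texact (F : freecx R) := forall i (u : 'rV_(frk F i.+1)),
  u *m fbd F i = 0 <-> exists w, u = w *m fbd F i.+1.

Lemma texact_bdbd F i : texact F -> fbd F i.+1 *m fbd F i = 0.
Proof.
by move=> exF; apply: mul_rows_eq => u; rewrite mulmx0 mulmxA; apply/exF; exists u.
Qed.

Lemma texact_shift F : texact F -> texact (shiftcx F).
Proof. by move=> exF i u; apply: exF. Qed.

Definition tcyc n F : tch n F -> Prop :=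
  match n return tch n F -> Prop with
  | 0 => fun v => exists w, teval v = w *m fbd F 0
  | n'.+1 => fun v => tbd v = 0
  end.

Lemma tbd_cyc n F (v : tch n.+1 F) : texact F -> tcyc (tbd v).
Proof.
have GG i : fbd G i.+1 *m fbd G i = 0 by apply: fresolves_bdbd rG.
elim: n F v => [|n IH] F v exF.
  exists (teval (v.2 : 'M_(frk F 1, frk G 0))).
  rewrite /tbd (semilinD (@teval_lin _)) teval_jtr; apply/eqP.
  by rewrite -subr_eq0 addrK; apply/eqP/teval_eq0; exists v.1.
have FF := texact_bdbd 0 exF.
case: n IH v => [|n] IH v /=.
  rewrite mulmxDl -!mulmxA GG mulmx0 add0r mulmxN mulmxDr !mulmxA -jtrM FF.
  by rewrite /jtr map_mx0 trmx0 mul0mx addr0 subrr.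
have := IH _ v.2 (texact_shift exF) => /= e; rewrite (semilinN (@tbd_lin _ _)) e.
apply: injective_projections; rewrite /= ?oppr0 //.
rewrite mulmxDl -!mulmxA GG mulmx0 add0r mulmxN mulmxDr !mulmxA -jtrM FF.
by rewrite /jtr map_mx0 trmx0 mul0mx addr0 subrr.
Qed.

(** Exactness of the total complex: a cycle is first corrected in its component
    along the shifted complex, by induction, and then in F_0 (x) G, by exactness
    of G. *)
Lemma tcyc_bd n F (v : tch n F) : texact F -> tcyc v -> exists v', v = tbd v'.
Proof.
have [_ _ _ _ exG] := rG.
elim: n F v => [|n IH] F v exF.
  move=> [w vw]; have [C Cw] := teval_surj w.
  have /teval_eq0[Y Yv] : teval (v - jtr (fbd F 0) *m C) = 0.
    by rewrite (semilinB (@teval_lin _)) teval_jtr Cw vw subrr.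
  by exists (Y, C); rewrite /= -Yv subrK.
move=> dv; have [c' cE] : exists c', v.2 = @tbd n (shiftcx F) c'.
  apply: IH; first exact: texact_shift.
  case: n v dv => [|n] v dv /=.
    apply/exF; rewrite -teval_jtr; apply/teval_eq0; exists (- v.1); rewrite mulNmx.
    by apply/eqP; rewrite -addr_eq0 addrC; apply/eqP.
  by have /(congr1 snd)/eqP := dv; rewrite oppr_eq0 => /eqP.
pose v' : tch n.+2 F := (0, - c').
pose X := v.1 - (tbd v').1.
have vX : v - tbd v' = (X, 0).
  apply: injective_projections => //=.
  by rewrite (semilinN (@tbd_lin _ _)) opprK cE subrr.
have dX : @tbd n F (X, 0) = 0.
  rewrite -vX (semilinB (@tbd_lin _ _)) dv sub0r.
  by have /= -> := tbd_cyc v' exF; rewrite oppr0.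
have /(@fresolves_lift _ _ _ _ _ _ n _ _ rG)[Y XY] : X *m fbd G n = 0.
  case: n v dv c' cE v' X vX dX {IH} => [|n] v dv c' cE v' X vX /=.
    by rewrite mulmx0 addr0.
  by move/(congr1 fst); rewrite /= mulmx0 addr0.
exists (v' + (Y, 0)); rewrite (semilinD (@tbd_lin _ _)).
rewrite addrC (_ : tbd _ = v - tbd v') ?subrK // vX.
apply: injective_projections; first by rewrite /= mulmx0 addr0 -XY.
by rewrite /= (semilin0 (@tbd_lin _ _)) oppr0.
Qed.

(** Coordinates on the free modules of the total complex. *)
Fixpoint trk n (F : freecx R) : nat :=
  if n is n'.+1 then (frk F 0 * frk G n + trk n' (shiftcx F))%N else (frk F 0 * frk G 0)%N.

Fixpoint tvec n F : tch n F -> 'rV[A]_(trk n F) :=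
  match n return tch n F -> 'rV[A]_(trk n F) with
  | 0 => fun v => mxvec v
  | n'.+1 => fun v => row_mx (mxvec v.1) (@tvec n' (shiftcx F) v.2)
  end.

Fixpoint tunvec n F : 'rV[A]_(trk n F) -> tch n F :=
  match n return 'rV[A]_(trk n F) -> tch n F with
  | 0 => fun u => vec_mx u
  | n'.+1 => fun u => (vec_mx (lsubmx u), @tunvec n' (shiftcx F) (rsubmx u))
  end.

Lemma tvecK n F : cancel (@tvec n F) (@tunvec n F).
Proof.
elim: n F => [|n IH] F v /=; first exact: mxvecK.
by rewrite row_mxKl row_mxKr mxvecK IH; case: v.
Qed.

Lemma tunvecK n F : cancel (@tunvec n F) (@tvec n F).
Proof.
elim: n F => [|n IH] F v /=; first exact: vec_mxK.
by rewrite vec_mxK IH hsubmxK.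
Qed.

Lemma tunvec_lin n F : lin (@tunvec n F).
Proof.
elim: n F => [|n IH] F a x y /=; first by rewrite linearP.
by rewrite !linearP IH.
Qed.

Lemma tvec_lin n F : lin (@tvec n F).
Proof. by move=> a x y; apply: (can_inj (@tunvecK n F)); rewrite tunvec_lin !tvecK. Qed.

Lemma trkE n F : trk n F = \sum_(i < n.+1) frk F i * frk G (n - i).
Proof.
elim: n F => [|n IH] F /=; first by rewrite big_ord1.
by rewrite big_ord_recl IH.
Qed.

Definition totcx (F : freecx R) : freecx A :=
  @FreeCx A (fun n => trk n F)
    (fun n => \matrix_k tvec (@tbd n F (@tunvec n.+1 F (delta_mx 0 k)))).

Lemma totcxE F n u : u *m fbd (totcx F) n = tvec (@tbd n F (@tunvec n.+1 F u)).
Proof.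
apply: (rows_lin (f := fun u => tvec (@tbd n F (@tunvec n.+1 F u)))) => a x y.
by rewrite tunvec_lin tbd_lin tvec_lin.
Qed.

Lemma mxvec_max m n (X : 'M[A]_(m, n)) :
  (forall a b, X a b \in max_ideal A) -> inmax (mxvec X).
Proof. by move=> Xm k; case/mxvec_indexP: k => a b; rewrite mxvecE. Qed.

Lemma row_mx_max m n (x : 'rV[A]_m) (y : 'rV[A]_n) : inmax x -> inmax y -> inmax (row_mx x y).
Proof. by move=> xm ym k; rewrite mxE; case: splitP => l _; [apply: xm | apply: ym]. Qed.

Lemma mulmx_max m n q (X : 'M[A]_(m, n)) (Y : 'M[A]_(n, q)) :
  (forall a b, Y a b \in max_ideal A) -> forall a b, (X *m Y) a b \in max_ideal A.
Proof. by move=> Ym a b; rewrite mxE; apply: max_sum => k _; apply: maxMl. Qed.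

Lemma jtr_max m n q (D : 'M[R]_(m, n)) (X : 'M[A]_(m, q)) :
  (forall a b, D a b \in max_ideal R) -> forall a b, (jtr D *m X) a b \in max_ideal A.
Proof.
move=> Dm a b; rewrite mxE; apply: max_sum => k _; apply: maxMr.
by rewrite !mxE local_max.
Qed.

Lemma tbd_max n F v : minimalcx F -> minimalcx G -> inmax (tvec (@tbd n F v)).
Proof.
move=> mF mG; elim: n F mF v => [|n IH] F mF v /=.
  apply: mxvec_max => a b; rewrite mxE.
  by apply: maxD; [apply: mulmx_max; apply: mG | apply: jtr_max; apply: mF].
apply: row_mx_max.
  apply: mxvec_max => a b; rewrite mxE.
  by apply: maxD; [apply: mulmx_max; apply: mG | apply: jtr_max; apply: mF].
rewrite (semilinN (@tvec_lin _ _)) => k; rewrite mxE; apply: maxN.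
by apply: IH => i; apply: mF.
Qed.

Lemma totcx_min F : minimalcx F -> minimalcx G -> minimalcx (totcx F).
Proof. by move=> mF mG n k l; rewrite mxE; apply: tbd_max. Qed.

Lemma totcx_resolves (N : lmodType R) F aug : fresolves [set: N] [set 0] F aug ->
  fresolves [set: restrict_scalars p N] [set 0] (totcx F) (fun u => aug (teval (@tunvec 0 F u))).
Proof.
move=> rF; have [al _ sa Ba ex] := rF; split=> //.
- by move=> a x y; rewrite tunvec_lin teval_lin al.
- move=> z _; have [w /= zw] := sa z I; have [X XE] := teval_surj w.
  by exists (@tvec 0 F X); rewrite /= mxvecK XE.
- move=> u; split=> [/Ba[w uw]|[w ->]].
    have [v' uv] := @tcyc_bd 0 F (@tunvec 0 F u) ex (ex_intro _ w uw).
    by exists (@tvec 1 F v'); rewrite totcxE tvecK -uv tunvecK.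
  by rewrite totcxE tvecK; apply/Ba; apply: (@tbd_cyc 0 F).
- move=> n u; rewrite totcxE; split=> [u0|[w ->]].
    have [|v' uv] := @tcyc_bd n.+1 F (@tunvec n.+1 F u) ex.
      by apply: (can_inj (@tvecK n F)); rewrite u0 (semilin0 (@tvec_lin _ _)).
    by exists (@tvec n.+2 F v'); rewrite totcxE tvecK -uv tunvecK.
  rewrite totcxE tvecK; have /= -> := @tbd_cyc n.+1 F (@tunvec n.+2 F w) ex.
  exact: semilin0 (@tvec_lin _ _).
Qed.

End TotalComplex.

Section BettiRetract.
Variables (R A : noethLocalRingType) (j : {rmorphism R -> A}) (p : {rmorphism A -> R}).
Hypotheses (j_local : local_hom j) (p_local : local_hom p) (pj : cancel j p).

Lemma retract_surj b : exists a, p a = b.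
Proof. by exists (j b). Qed.

Lemma fg_regular (S : noethLocalRingType) : fg_module (S^o : lmodType S).
Proof. by exists 1%N, (fun=> 1) => x; exists (fun=> x); rewrite big_ord1 /= [RHS]mulr1. Qed.

Lemma fg_restrict (N : lmodType R) : fg_module N -> fg_module (restrict_scalars p N).
Proof.
move=> [n [v vP]]; exists n, v => x; have [c xc] := vP x.
exists (fun i => j (c i)); rewrite [LHS]xc; apply: eq_bigr => i _.
by rewrite -[in LHS](pj (c i)).
Qed.

(** With F and G minimal resolutions of N over R and of R over A, the complex
    F (x) G over R is a minimal resolution of N over A, F being mapped to A by j. *)
Lemma tor_dim_restrict (N : lmodType R) n : fg_module N ->
  tor_dim (restrict_scalars p N) n =
  \sum_(i < n.+1) tor_dim N i * tor_dim (restrict_scalars p R^o) (n - i).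
Proof.
move=> fgN.
have [F [aug [rF mF]]] := minimal_resolution fgN (@submod_setT _ N) (@submod_set0 _ N) (fun _ _ => I).
have fgp := fg_restrict (fg_regular R).
have [G [augG [rG mG]]] := minimal_resolution fgp (@submod_setT _ _) (@submod_set0 _ _) (fun _ _ => I).
have rT := totcx_resolves pj rG rF; have mT := totcx_min j_local mF mG.
rewrite tor_dimE (tord_minimal n (@submod_set0 _ _) rT mT) /= trkE.
apply: eq_bigr => i _; rewrite !tor_dimE.
by rewrite (tord_minimal _ (@submod_set0 _ _) rF mF) (tord_minimal _ (@submod_set0 _ _) rG mG).
Qed.

Lemma fg_kernel : fg_module (kernel p).
Proof.
have sk : submod (V := A^o) (fun x => x \in in_kernel p).
  by split=> [|a x y xk yk]; [exact: rpred0 | apply: rpredD => //; apply: rpredZ].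
have [n [v [kv vP]]] := noetherian (fg_regular A) sk.
exists n, (fun i => Kernel (kv i)) => x; have [c xc] := vP (kernel_val x) (valP x).
exists c; apply: val_inj; rewrite [LHS]xc raddf_sum.
by apply: eq_bigr.
Qed.

(* ker p, as a submodule of the free module of rank 1 of row vectors *)
Let kerU : set 'rV[A]_1 := [set u | p (u 0 0) = 0].

Let kerU_submod : submod kerU.
Proof.
split=> [|a x y]; rewrite /kerU /= !mxE ?rmorph0 // rmorphD rmorphM => -> ->.
by rewrite mulr0 addr0.
Qed.

Let kerU_max : kerU `<=` @inmax _ 1.
Proof.
move=> u pu k; rewrite (ord1 k) maxE; apply/negP => /(rmorph_unit p).
by rewrite [p _]pu unitr0.
Qed.

(** ker p is the first syzygy of R over A. *)
Lemma tor_dim_retract i :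
  tor_dim (restrict_scalars p R^o) i =
  if i is i'.+1 then tor_dim (kernel p) i' else 1%N.
Proof.
have -> : tor_dim (restrict_scalars p R^o) i = tord [set: 'rV[A]_1] kerU i.
  rewrite tor_dimE; apply: (tord_iso (f := fun u : 'rV[A]_1 => p (u 0 0) : restrict_scalars p R^o)) => //.
  - exact: fg_rV.
  - by move=> a x y; rewrite !mxE rmorphD rmorphM.
  - exact: submod_set0.
  - move=> z _; exists (const_mx (j z)) => //; rewrite /= mxE pj; exact: subrr.
case: i => [|i]; first exact: tord_syzygy0.
rewrite tord_syzygyS // tor_dimE.
apply: (tord_iso (f := fun x : kernel p => const_mx (kernel_val x) : 'rV[A]_1)) => //.
- exact: fg_kernel.
- by move=> a x y; apply/rowP => k; rewrite !mxE.
- exact: submod_set0.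
- exact: submod_set0.
- by move=> x _; rewrite /kerU /= mxE; apply/eqP; apply: (valP x).
- move=> x _; split=> [/= /(congr1 (fun u : 'rV_1 => u 0 0))|-> /=].
    by rewrite !mxE => x0; apply: val_inj.
  by apply/rowP => k; rewrite !mxE.
- move=> u pu; have ku : (u 0 0 : A^o) \in in_kernel p by rewrite inE; apply/eqP.
  exists (Kernel ku) => //=; apply/eqP; rewrite subr_eq0; apply/eqP/rowP => k.
  by rewrite (ord1 k) mxE.
Qed.

End BettiRetract.

(** * Betti numbers of a module and Koszul homology *)

Section KoszulResolution.
Variables (R : noethLocalRingType).

Definition cone_rk (f : nat -> nat) i := if i is i'.+1 then (f i'.+1 + f i')%N else f 0%N.

(** The mapping cone of multiplication by a. *)
Definition conecx (a : R) (F : freecx R) : freecx R :=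
  @FreeCx R (cone_rk (frk F))
    (fun i => match i return 'M[R]_(cone_rk (frk F) i.+1, cone_rk (frk F) i) with
              | 0 => col_mx (fbd F 0) a%:M
              | i'.+1 => block_mx (fbd F i'.+1) 0 a%:M (- fbd F i') end).

Variables (M : lmodType R) (F : freecx R) (aug : 'rV[R]_(frk F 0) -> M).
Hypothesis fgM : fg_module M.
Hypothesis rF : fresolves [set: M] [set 0] F aug.
Hypothesis mF : minimalcx F.

(** The complex K(s) (x) F, a minimal free model of K(s) (x) M. *)
Definition kfcx (s : seq R) : freecx R := foldr conecx F s.

(** The augmentation K(s) (x) F -> K(s) (x) M. *)
Fixpoint keps s i : 'rV[R]_(frk (kfcx s) i) -> kch (size s) M :=
  match s return 'rV[R]_(frk (kfcx s) i) -> kch (size s) M with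
  | [::] => match i return 'rV[R]_(frk F i) -> M with 0 => aug | _ => fun=> 0 end
  | a :: s' =>
    match i return 'rV[R]_(cone_rk (frk (kfcx s')) i) -> (kch (size s') M * kch (size s') M)%type with
    | 0 => fun u => (@keps s' 0 u, 0)
    | i'.+1 => fun u => (@keps s' i'.+1 (lsubmx u), @keps s' i' (rsubmx u))
    end
  end.

Lemma keps_lin s i : lin (@keps s i).
Proof.
have [al _ _ _ _] := rF.
elim: s i => [|a s IH] [|i] c x y //=; first by rewrite scaler0 addr0.
  by apply: kpairP; rewrite ?kchE /= ?IH // scaler0 addr0.
by apply: kpairP; rewrite ?kchE /= linearP IH.
Qed.

Lemma keps_deg s i u : kdeg i%:Z (@keps s i u).
Proof.
elim: s i u => [|a s IH] [|i] u //=.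
  by split; [exact: IH | apply: submod0 (kdeg_submod _ _)].
split; first exact: IH.
by rewrite (_ : i.+1%:Z - 1 = i); [exact: IH | lia].
Qed.

Definition fcyc (L : freecx R) i : set 'rV[R]_(frk L i) :=
  match i return set 'rV[R]_(frk L i) with
  | 0 => [set: 'rV[R]_(frk L 0)] | i'.+1 => kerset (fbd L i') end.

Definition fbnd (L : freecx R) i : set 'rV[R]_(frk L i) :=
  [set u | exists w, u = w *m fbd L i].

Lemma mul_cone a L i (u : 'rV_(frk L i.+2 + frk L i.+1)) :
  u *m fbd (conecx a L) i.+1 =
  row_mx (lsubmx u *m fbd L i.+1 + a *: rsubmx u) (- (rsubmx u *m fbd L i)).
Proof.
by rewrite -[in LHS](hsubmxK u) mul_row_block mulmx0 add0r mul_mx_scalar mulmxN.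
Qed.

Lemma mul_cone0 a L (u : 'rV_(frk L 1 + frk L 0)) :
  u *m fbd (conecx a L) 0 = lsubmx u *m fbd L 0 + a *: rsubmx u.
Proof. by rewrite -[in LHS](hsubmxK u) mul_row_col mul_mx_scalar. Qed.

Lemma keps_bd s i (u : 'rV_(frk (kfcx s) i.+1)) :
  @keps s i (u *m fbd (kfcx s) i) = kd s (@keps s i.+1 u).
Proof.
have [al _ _ Ba _] := rF.
elim: s i u => [|a s IH] i u.
  case: i u => [|i] u //=; apply/Ba; by exists u.
case: i u => [|i] u.
  rewrite (@mul_cone0 a (kfcx s)) /=; apply: kpairP => /=; last by rewrite kd_deg0 ?oppr0 //; apply: keps_deg.
  by rewrite (semilinD (@keps_lin s 0)) (semilinZ (@keps_lin s 0)) IH.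
rewrite (@mul_cone a (kfcx s)) /= row_mxKl row_mxKr; apply: kpairP => /=.
  by rewrite (semilinD (@keps_lin s _)) (semilinZ (@keps_lin s _)) IH.
by rewrite (semilinN (@keps_lin s _)) IH.
Qed.

Lemma keps_surj s i v : kdeg i%:Z v -> exists u, @keps s i u = v.
Proof.
have [al _ sa _ _] := rF.
elim: s i v => [|a s IH] i v /=.
  case: i => [|i] vi; last by exists 0; rewrite vi.
  by have [u /= /eqP] := sa v I; rewrite subr_eq0 => /eqP ->; exists u.
case: i => [|i] [/IH[u1 e1] d2].
  by exists u1; apply: kpairP => //=; apply/esym; apply: kdeg_lt0 d2.
have [|u2 e2] := IH i v.2; first by move: d2; rewrite (_ : i.+1%:Z - 1 = i) //; lia.
by exists (row_mx u1 u2); apply: kpairP; rewrite /= ?row_mxKl ?row_mxKr.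
Qed.

(** The kernel of the augmentation is acyclic, by induction over the cones; the
    augmentation is therefore a quasi-isomorphism. *)
Lemma keps_acyclic s i u : fcyc u -> @keps s i u = 0 ->
  exists2 w, u = w *m fbd (kfcx s) i & @keps s i.+1 w = 0.
Proof.
have [al _ _ Ba ex] := rF.
elim: s i u => [|a s IH] i u.
  case: i u => [|i] u; first by move=> _ /Ba[w ->]; exists w.
  by move=> /ex[w ->] _; exists w.
case: i u => [|i] u.
  move=> _ [/(IH 0%N u I)[w uw ew]]; exists (row_mx w 0).
    by rewrite (@mul_cone0 a (kfcx s)) row_mxKl row_mxKr scaler0 addr0.
  by rewrite /= row_mxKl row_mxKr ew (semilin0 (@keps_lin s 0)).
move=> cu [e1 e2]; have [du c2] : lsubmx u *m fbd (kfcx s) i + a *: rsubmx u = 0 /\ @fcyc (kfcx s) i (rsubmx u).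
  case: i u cu {e1 e2} => [|i] u; rewrite /fcyc /kerset /= .
    by rewrite (@mul_cone0 a (kfcx s)).
  by rewrite (@mul_cone a (kfcx s)) -row_mx0 => /eq_row_mx[-> /eqP]; rewrite oppr_eq0 => /eqP.
have [w1 w1E k1] := IH i _ c2 e2.
have [||w0 w0E k0] := IH i.+1 (lsubmx u + a *: w1).
- by rewrite /= /kerset /= mulmxDl -scalemxAl -w1E.
- by rewrite (semilinD (@keps_lin s _)) (semilinZ (@keps_lin s _)) e1 k1 scaler0 addr0.
exists (row_mx w0 (- w1)); last first.
  by rewrite /= row_mxKl row_mxKr k0 (semilinN (@keps_lin s _)) k1 oppr0.
rewrite (@mul_cone a (kfcx s)) row_mxKl row_mxKr -w0E scalerN addrK mulNmx opprK -w1E.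
by rewrite hsubmxK.
Qed.

Lemma kfcx_min s : (forall x, x \in s -> x \in max_ideal R) -> minimalcx (kfcx s).
Proof.
elim: s => [|a s IH] sm; first exact: mF.
have am : a \in max_ideal R by apply: sm; rewrite inE eqxx.
have {}IH : minimalcx (kfcx s) by apply: IH => x xs; apply: sm; rewrite inE xs orbT.
have aM n (k l : 'I_n) : (a%:M : 'M[R]_n) k l \in max_ideal R.
  by rewrite mxE; case: eqP => _; rewrite ?mulr1n // mulr0n max0.
case=> [|i] k l; rewrite mxE; case: splitP => k' _ //.
  by rewrite mxE; case: splitP => l' _; rewrite ?mxE ?max0.
by rewrite mxE; case: splitP => l' _ //; rewrite mxE maxN.
Qed.

Lemma fbnd_submod L i : submod (@fbnd L i).
Proof.
split=> [|c _ _ [x ->] [y ->]]; first by exists 0; rewrite mul0mx.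
by exists (c *: x + y); rewrite mulmxDl scalemxAl.
Qed.

Lemma fcyc_submod L i : submod (@fcyc L i).
Proof. by case: i => [|i]; [exact: submod_setT | exact: kerset_submod]. Qed.

Section Homology.
Variable s : seq R.
Hypotheses (sm : forall x, x \in s -> x \in max_ideal R) (ms : spans_max (size s) s).
Local Notation L := (kfcx s).

Lemma fbnd_fcyc i : @fbnd L i `<=` @fcyc L i.
Proof.
have dd : forall i, fbd L i.+1 *m fbd L i = 0.
  elim: (s) => [|a s' IH] k; first exact: fresolves_bdbd rF.
  apply: mul_rows_eq => u; rewrite mulmx0 mulmxA (@mul_cone a (kfcx s')).
  case: k u => [|k] u.
    rewrite (@mul_cone0 a (kfcx s')) row_mxKl row_mxKr mulmxDl -mulmxA IH mulmx0 add0r.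
    by rewrite scalerN -scalemxAl subrr.
  rewrite (@mul_cone a (kfcx s')) row_mxKl row_mxKr mulmxDl -mulmxA IH mulmx0 add0r.
  by rewrite scalerN -scalemxAl subrr mulNmx -mulmxA IH mulmx0 !oppr0 row_mx0.
by case: i => [//|i] _ [w ->]; rewrite /= /kerset /= -mulmxA dd mulmx0.
Qed.

Lemma keps_cyc i u : @fcyc L i u -> kcyc (size s) s i (@keps s i u).
Proof.
move=> cu; split; first exact: keps_deg.
case: i u cu => [|i] u cu; first by rewrite kd_deg0 //; apply: keps_deg.
by rewrite -keps_bd [_ *m _]cu (semilin0 (@keps_lin s i)).
Qed.

Lemma keps_bnd i u : @fcyc L i u -> kbnd (size s) s i (@keps s i u) <-> @fbnd L i u.
Proof.
move=> cu; split=> [[c dc uc]|[w ->]]; last first.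
  by rewrite keps_bd; exists (@keps s i.+1 w) => //; rewrite -PoszD addn1; apply: keps_deg.
have [|u' e'] := @keps_surj s i.+1 c; first by rewrite -addn1 PoszD.
have [||w uw _] := @keps_acyclic s i (u - u' *m fbd L i).
- by apply: submodB (fcyc_submod _ _) cu _; apply: fbnd_fcyc; exists u'.
- by rewrite (semilinB (@keps_lin s i)) keps_bd e' uc subrr.
by exists (w + u'); rewrite mulmxDl -uw subrK.
Qed.

Lemma kspace_kfcx i : kspace (@fcyc L i) (@fbnd L i).
Proof.
split; [exact: fcyc_submod | exact: fbnd_submod | exact: fbnd_fcyc |].
move=> a u am cu; apply/keps_bnd; first exact: submodZ (fcyc_submod _ _) cu.
rewrite (semilinZ (@keps_lin s i)).
by have [_ _ _] := kcyc_kspace M i ms; apply=> //; apply: keps_cyc.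
Qed.

Lemma residue_dim_kfcx i : residue_dim (@fcyc L i) (@fbnd L i) = kh M (size s) s i.
Proof.
apply/esym; apply: (residue_dim_liniso (fg_rV _ _) (@keps_lin s i) (kspace_kfcx i)).
- exact: kbnd_submod.
- exact: keps_cyc.
- exact: keps_bnd.
- move=> c [dc cc]; have [u e] := keps_surj dc.
  suff [u' cu' e'] : exists2 u', @fcyc L i u' & @keps s i u' = c.
    by exists u' => //; rewrite e' subrr; apply: submod0 (kbnd_submod _ _ _).
  case: i u c dc cc e => [|i] u c dc cc e; first by exists u.
  have [||w uw ew] := @keps_acyclic s i (u *m fbd L i).
  + by apply: fbnd_fcyc; exists u.
  + by rewrite keps_bd e.
  exists (u - w); first by rewrite /= /kerset /= mulmxBl -uw subrr.
  by rewrite (semilinB (@keps_lin s _)) e ew subr0.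
Qed.

Local Notation bk := (tord [set: R^o] (fun x : R^o => (x : R) \in max_ideal R)).

(** Splitting L_j / B_j along its homology H_j = Z_j / B_j, a vector space over
    the residue field, and L_j / Z_j = B_(j-1). *)
Lemma tord_fbnd_le j i :
  (tord [set: 'rV[R]_(frk L j)] (@fbnd L j) i <=
   \sum_(l < j.+1) kh M (size s) s l%:Z * bk (i + (j - l)))%N.
Proof.
have mL := kfcx_min sm.
have bndm k : @fbnd L k `<=` @inmax _ _.
  move=> _ [w ->] l; rewrite mxE; apply: max_sum => q _; exact/maxMl/mL.
elim: j i => [|j IH] i.
  have [v vb] := residue_dimP (fg_rV _ _) (kspace_kfcx 0).
  have := tord_residue_basis i (fg_rV _ _) (kspace_kfcx 0) vb.
  by rewrite residue_dim_kfcx big_ord1 addn0.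
apply: leq_trans (tord_subadditive (Z := @fcyc L j.+1) i (fg_rV _ _) (fbnd_submod _ _)
  (fcyc_submod _ _) (submod_setT _) (@fbnd_fcyc j.+1) (fun _ _ => I)) _.
rewrite big_ord_recr /= addnC subnn addn0; apply: leq_add; last first.
  have [v vb] := residue_dimP (fg_rV _ _) (kspace_kfcx j.+1).
  have := tord_residue_basis i (fg_rV _ _) (kspace_kfcx j.+1) vb.
  by rewrite residue_dim_kfcx.
have -> : tord [set: 'rV[R]_(frk L j.+1)] (@fcyc L j.+1) i = tord (@fbnd L j) [set 0] i.
  apply/esym; apply: (tord_iso (f := fun u => u *m fbd L j) i (fg_rV _ _)) => //.
  - exact: mulmx_lin.
  - exact: fcyc_submod.
  - exact: submod_set0.
  - by move=> u _; exists u.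
  - by move=> u [w ->]; exists w => //; rewrite subrr.
rewrite -tord_syzygyS; [|exact: fbnd_submod|exact: bndm].
apply: leq_trans (IH _) _; apply: leq_sum => l _.
by rewrite (_ : i.+1 + (j - l) = i + (j.+1 - l))%N //; have := ltn_ord l; lia.
Qed.

Lemma frk_kfcx_le j :
  (frk L j <= \sum_(l < j.+1) kh M (size s) s l%:Z * bk (j - l))%N.
Proof.
have mL := kfcx_min sm.
rewrite -(@tord_syzygy0 _ _ (@fbnd L j)); [exact: tord_fbnd_le | exact: fbnd_submod |].
move=> _ [w ->] l; rewrite mxE; apply: max_sum => q _; exact/maxMl/mL.
Qed.

End Homology.

Lemma frk_kfcx s i : frk (kfcx s) i = iter (size s) cone_rk (frk F) i.
Proof.
by elim: s i => [|a s IH] [|i] //=; rewrite !IH.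
Qed.

End KoszulResolution.

Section ResidueFieldModule.
Variable R : noethLocalRingType.

Definition kmod : lmodType R := restrict_scalars (@residue_map R) (residue_field R)^o.

Lemma residue_map_surj (u : residue_field R) : exists x, residue_map x = u.
Proof. by exists (repr u); apply: reprK. Qed.

Lemma residue_map_lin : lin (fun x : R^o => residue_map x : kmod).
Proof. by move=> a x y; rewrite rmorphD rmorphM. Qed.

Lemma fg_kmod : fg_module kmod.
Proof.
exists 1%N, (fun=> 1) => u; have [x <-] := residue_map_surj u.
by exists (fun=> x); rewrite big_ord1; rewrite [RHS]mulr1.
Qed.

Lemma tor_dim_kmod i :
  tor_dim kmod i = tord [set: R^o] (fun x : R^o => (x : R) \in max_ideal R) i.
Proof.
rewrite tor_dimE; apply: (tord_iso i (fg_regular R) residue_map_lin) => //.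
- by split=> [|a x y]; [exact: max0 | move=> xm ym; apply: maxD => //; apply: maxMl].
- exact: submod_set0.
- by move=> x _; split=> [/eqP|xm]; [|apply/eqP]; rewrite residue_map_eq0.
- by move=> u _; have [x <-] := residue_map_surj u; exists x; rewrite ?subrr.
Qed.

(** The free model K(s) (x) F of K(s) (x) M has ranks (1 + t)^n P_M and, being
    minimal with homology made of copies of k, it is bounded by kappa_M P_k. *)
Lemma betti_koszul_le (M : lmodType R) (s : seq R) j : fg_module M ->
  (forall x, x \in s -> x \in max_ideal R) -> spans_max (size s) s ->
  (iter (size s) cone_rk (tor_dim M) j <=
   \sum_(l < j.+1) kh M (size s) s l%:Z * tor_dim kmod (j - l))%N.
Proof.
move=> fgM sm ms.
have [F [aug [rF mF]]] := minimal_resolution fgM (submod_setT M) (submod_set0 M) (fun _ _ => I).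
have -> : tor_dim M = frk F.
  by apply/funext => i; rewrite tor_dimE (tord_minimal i (submod_set0 M) rF mF).
rewrite -frk_kfcx; under eq_bigr do rewrite tor_dim_kmod.
exact: frk_kfcx_le rF mF _ sm ms j.
Qed.

End ResidueFieldModule.

(** * The syzygy recursion for Koszul homology *)

Section SubmoduleType.
Variables (R : nzRingType) (V : lmodType R) (U : set V) (sU : submod U).

Definition in_sub (_ : submod U) : {pred V} := fun x => `[< U x >].

Lemma in_sub_submod_closed : submod_closed (in_sub sU).
Proof.
split=> [|a x y]; first by apply/asboolP; apply: submod0.
by move=> /asboolP Ux /asboolP Uy; apply/asboolP; apply: sU.2.
Qed.

HB.instance Definition _ :=
  GRing.isSubmodClosed.Build R V (in_sub sU) in_sub_submod_closed.

Record submodule := Submodule { subval :> V; _ : subval \in in_sub sU }.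

HB.instance Definition _ := [isSub for subval].
HB.instance Definition _ := [Choice of submodule by <:].
HB.instance Definition _ := [SubChoice_isSubZmodule of submodule by <:].
HB.instance Definition _ := [SubZmodule_isSubLmodule of submodule by <:].

Lemma subvalP (x : submodule) : U (subval x).
Proof. by apply/asboolP; apply: (valP x). Qed.

Lemma subval_surj v : U v -> exists x : submodule, subval x = v.
Proof. by move=> /asboolP Uv; exists (Submodule (Uv : v \in in_sub sU)). Qed.

Lemma subval_lin : lin (subval : submodule -> V).
Proof. by []. Qed.

Lemma subval_inj : injective (subval : submodule -> V).
Proof. exact: val_inj. Qed.

End SubmoduleType.

Lemma fg_submodule (R : noethLocalRingType) (V : lmodType R) (U : set V) (sU : submod U) :
  fg_module V -> fg_module (submodule sU).
Proof.
move=> fgV; have [n [v [Uv vP]]] := noetherian fgV sU.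
have /fin_all_exists[w wv] i := subval_surj sU (Uv i).
exists n, w => x; have [c xc] := vP _ (subvalP x); exists c.
apply: (@subval_inj _ _ _ sU); rewrite xc (semilin_sum (@subval_lin _ _ _ sU)).
by apply: eq_bigr => i _; rewrite (semilinZ (@subval_lin _ _ _ sU)) wv.
Qed.

Section KoszulOfFree.
Variables (R : noethLocalRingType) (n : nat) (s : seq R).
Hypothesis ms : spans_max n s.

(** The exact sequences R -> R^(1+b) -> R^b are split, so that the image of
    H(R^(1+b)) in H(R^b) is everything. *)
Lemma kh_free b i : kh 'rV[R]_b n s i = (b * kh R^o n s i)%N.
Proof.
elim: b => [|b IH].
  rewrite mul0n /kh (_ : kcyc n s i = kbnd n s i); first exact/residue_dimxx/kbnd_submod.
  have all0 (v : kch n 'rV[R]_0) : v = 0.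
    by elim: (n) v => [|k IH] v; [rewrite [v]thinmx0 | apply: kpairP; apply: IH].
  apply/seteqP; split=> v _; rewrite [v]all0; apply: submod0.
    exact: kbnd_submod.
  exact: kcyc_submod.
pose f (x : R^o) : 'rV[R]_(1 + b) := row_mx (const_mx x) 0.
pose g (u : 'rV[R]_(1 + b)) : 'rV[R]_b := rsubmx u.
pose h (w : 'rV[R]_b) : 'rV[R]_(1 + b) := row_mx 0 w.
have fl : lin f.
  move=> a x y; rewrite /f scale_row_mx add_row_mx scaler0 addr0; congr row_mx.
  by apply/rowP => k; rewrite !mxE.
have gl : lin g by move=> a x y; rewrite /g linearP.
have hl : lin h by move=> a x y; rewrite /h scale_row_mx add_row_mx scaler0 addr0.
have fi : injective f.
  move=> x y /eq_row_mx[/(congr1 (fun u : 'rV_1 => u 0 0)) + _].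
  by rewrite !mxE.
have gh w : g (h w) = w by rewrite /g row_mxKr.
have gs w : exists u, g u = w by exists (h w).
have gf0 x : g (f x) = 0 by rewrite /g /f row_mxKr.
have ex u : g u = 0 -> exists x, f x = u.
  move=> gu; exists (lsubmx u 0 0); rewrite -[RHS]hsubmxK [rsubmx u]gu; congr row_mx.
  by apply/rowP => k; rewrite !mxE (ord1 k).
have := koszul_les (fg_regular R) (fg_rV _ _) (fg_rV _ _) fl gl fi gs gf0 ex ms i.
have -> : kimg_dim g n s (i + 1) = kh 'rV[R]_b n s (i + 1).
  rewrite /kimg_dim /kh; congr residue_dim; apply/seteqP; split; first exact: kimg_cyc.
  move=> w [dw cw]; exists (kmap h w); last by rewrite kmap_comp -[LHS]kmap_id; apply: kmap_ext => u; rewrite /= gh.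
  by split; [apply: (kmap_deg hl) | rewrite -kmap_kd_lin // cw (semilin0 (kmap_lin hl (n := n)))].
have -> : kimg_dim g n s i = kh 'rV[R]_b n s i.
  rewrite /kimg_dim /kh; congr residue_dim; apply/seteqP; split; first exact: kimg_cyc.
  move=> w [dw cw]; exists (kmap h w); last by rewrite kmap_comp -[LHS]kmap_id; apply: kmap_ext => u; rewrite /= gh.
  by split; [apply: (kmap_deg hl) | rewrite -kmap_kd_lin // cw (semilin0 (kmap_lin hl (n := n)))].
move/eqP; rewrite addnAC addnC eqn_add2l => /eqP e.
by rewrite mulSn -IH; apply/esym.
Qed.

End KoszulOfFree.

Section PositiveProducts.
Variables (R : noethLocalRingType) (M : lmodType R) (n : nat) (s : seq R).

(** The cycles representing H_+(R) H(M), as the smallest submodule containing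
    the boundaries and the products of cycles. *)
Definition kprod i : set (kch n M) := [set v | forall T : set (kch n M),
  submod T -> kbnd n s i `<=` T ->
  (forall a b (z : kch n R^o) (c : kch n M), 0 < a -> b + a = i ->
     kcyc n s a z -> kcyc n s b c -> T (krm c z)) -> T v].

Lemma kprod_submod i : submod (kprod i).
Proof.
split=> [T sT _ _|a x y Px Py T sT BT gT]; first exact: submod0.
by apply: sT.2; [apply: Px | apply: Py].
Qed.

Lemma kbnd_kprod i : kbnd n s i `<=` kprod i.
Proof. by move=> v Bv T _ BT _; apply: BT. Qed.

Lemma kprod_krm i a b (z : kch n R^o) (c : kch n M) : 0 < a -> b + a = i ->
  kcyc n s a z -> kcyc n s b c -> kprod i (krm c z).
Proof. by move=> a0 ab Zz Zc T sT BT gT; apply: gT Zz Zc. Qed.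

Lemma kprod_cyc i : kprod i `<=` kcyc n s i.
Proof.
move=> v; apply; [exact: kcyc_submod | exact: kbnd_cyc |].
move=> a b z c a0 <- [dz cz] [dc cc]; split; first exact: krm_deg.
by rewrite kd_krm_cycle // cc (semilin0 (krm_linl _)).
Qed.

Lemma kprod_le0 i : i <= 0 -> kprod i `<=` kbnd n s i.
Proof.
move=> i0 v; apply=> //; first exact: kbnd_submod.
move=> a b z c a0 ab _ [dc _]; rewrite (@kdeg_lt0 _ _ _ b c) ?(semilin0 (krm_linl _)) //.
  exact: submod0 (kbnd_submod _ _ _).
by rewrite -(ltrD2r a) ab add0r; apply: le_lt_trans i0 a0.
Qed.

Definition kq i := residue_dim (kprod i) (kbnd n s i).

Lemma kprod_kspace i : spans_max n s -> kspace (kprod i) (kbnd n s i).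
Proof.
move=> ms; have [_ _ _ mZ] := kcyc_kspace M i ms.
split; [exact: kprod_submod | exact: kbnd_submod | exact: kbnd_kprod |].
by move=> a z am /kprod_cyc Zz; apply: mZ.
Qed.

End PositiveProducts.
Arguments kq {R} M n s i.
Arguments kprod {R M} n s i.
Arguments kprod_submod {R M} n s i.

Section SyzygyRecursion.
Variables (R : noethLocalRingType) (s : seq R).
Local Notation n := (size s).
Hypotheses (sm : forall x, x \in s -> x \in max_ideal R) (ms : spans_max n s).
Variables (X Y W : lmodType R) (f : X -> Y) (g : Y -> W).
Hypotheses (fgX : fg_module X) (fgY : fg_module Y) (fgW : fg_module W).
Hypotheses (fl : lin f) (gl : lin g) (finj : injective f).
Hypotheses (gsurj : forall w, exists y, g y = w).
Hypotheses (gf0 : forall x, g (f x) = 0) (exact_fg : forall y, g y = 0 -> exists x, f x = y).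

(** The connecting map sends products to products, and its kernel is the image
    of H(Y). *)
Lemma kq_syzygy i : (kq W n s (i + 1) <= kimg_dim g n s (i + 1) + kq X n s i)%N.
Proof.
have [[fgX' fgY'] fgW'] := (fg_kch n fgX, fg_kch n fgY, fg_kch n fgW).
have [fk gk] := (kmap_lin fl (n := n), kmap_lin gl (n := n)).
have finjk : injective (kmap f (n := n)) by apply: kmap_inj.
pose QX : set (kch n Y) := [set y | exists2 x, kprod n s i x & y = kmap f x].
pose BX : set (kch n Y) := [set y | exists2 x, kbnd n s i x & y = kmap f x].
have sQX : submod QX := lin_image fk (kprod_submod n s i).
have sBX : submod BX by apply: (lin_image fk (kbnd_submod n s i)).
pose Q : set (kch n W) := kprod n s (i + 1).
pose C : set (kch n W) := kimg g s (i + 1).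
have sC : submod C by exact: kimg_submod.
have BC : kbnd n s (i + 1) `<=` C by exact: kbnd_kimg.
have kQ : kspace Q (kbnd n s (i + 1)) by exact: kprod_kspace.
have sQC : submod (Q `&` C) by apply: submodI => //; exact: kprod_submod.
have BQC : kbnd n s (i + 1) `<=` Q `&` C by move=> v Bv; split; [exact: kbnd_kprod | exact: BC].
have QCQ : Q `&` C `<=` Q by move=> v [].
rewrite /kq (residue_dim_add fgW' kQ sQC BQC QCQ) addnC; apply: leq_add.
  apply: (residue_dim_sub fgW' _ sQC BQC); last by move=> v [].
  have [_ _ _ mZ] := kcyc_kspace W (i + 1) ms.
  split; [exact: sC | exact: kbnd_submod | exact: BC |].
  by move=> a z am /(kimg_cyc gl) Zz; apply: mZ.
(* every product lifts to a chain whose boundary is a product *)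
pose T : set (kch n W) := [set v | exists y, [/\ kdeg (i + 1) y, kmap g y = v & QX (kd s y)]].
have lift_prod v : Q v -> T v.
  move=> Qv; apply: Qv.
  - split; first by exists 0; rewrite kd0 (semilin0 gk); split=> //;
      [apply: submod0 (kdeg_submod _ _) | apply: submod0 sQX].
    move=> a x y [x' [dx gx Qx]] [y' [dy gy Qy]]; exists (a *: x' + y').
    by rewrite gk gx gy kd_lin; split=> //; [apply: (kdeg_submod _ _).2 | apply: sQX.2].
  - move=> _ [w dw ->]; have [y dy <-] := kmap_surj_deg gl gsurj dw; exists (kd s y).
    rewrite kdd kmap_kd_lin //; split=> //; last exact: submod0 sQX.
    by rewrite -[X in kdeg X](addrK 1); apply: kd_deg.
  - move=> a b z c a0 ab [dz cz] [dc cc]; have [y dy gy] := kmap_surj_deg gl gsurj dc.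
    exists (krm y z); split; first by rewrite -ab; apply: krm_deg.
      by rewrite kmap_krm // gy.
    rewrite kd_krm_cycle //.
    have [||x dx fx] := @kmap_ker_deg _ _ _ _ f g n fl exact_fg (b - 1) (kd s y).
    + by rewrite kmap_kd_lin // gy.
    + exact: kd_deg.
    exists (krm x z); last by rewrite kmap_krm // fx.
    apply: (@kprod_krm _ _ _ _ _ a (b - 1)) => //; first by rewrite addrAC ab addrK.
    by split=> //; apply: finjk; rewrite kmap_kd_lin // fx kdd (semilin0 fk).
pose E : set (kch n Y) := [set y | [/\ kdeg (i + 1) y, Q (kmap g y) & QX (kd s y)]].
pose E' : set (kch n Y) := E `&` (fun y => C (kmap g y)).
have sE : submod E.
  split.
    rewrite /E /= (semilin0 gk) kd0; split; [apply: submod0 (kdeg_submod _ _) | |].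
      exact: submod0 (kprod_submod _ _ _).
    exact: submod0 sQX.
  move=> a x y [dx Qx QXx] [dy Qy QXy]; rewrite /E /= gk kd_lin; split.
  - exact: (kdeg_submod _ _).2.
  - exact: (kprod_submod _ _ _).2.
  - exact: sQX.2.
have kE : kspace E E'.
  split=> //; first by apply: (submodI sE); apply: (semilin_preim gk sC).
    by move=> y [].
  move=> a y am Ey; split; first exact: submodZ.
  case: Ey => _ Qy _; rewrite (semilinZ gk); apply: BC.
  by have [_ _ _ mQ] := kQ; apply: mQ.
have -> : residue_dim Q (Q `&` C) = residue_dim E E'.
  apply: (residue_dim_liniso fgY' gk kE sQC) => [y [] //|y Ey|v Qv].
    by case: (Ey) => _ Qy _; split=> [[]|[]].
  have [y [dy gy Qy]] := lift_prod v Qv; exists y; first by split; rewrite // gy.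
  by rewrite gy subrr; apply: submod0 sQC.
have <- : residue_dim QX BX = residue_dim (kprod n s i : set (kch n X)) (kbnd n s i).
  apply: (residue_dim_liniso fgX' fk (@kprod_kspace _ X n s i ms) sBX) => [x Qx|x Qx|y [x Qx ->]].
  - by exists x.
  - by split=> [[x' Bx' /finjk ->]|Bx] //; exists x.
  - by exists x => //; rewrite subrr; apply: submod0 sBX.
apply: (residue_dim_le fgY' fgY' (kd_lin s) kE).
- split=> //; first by move=> _ [x Bx ->]; exists x => //; apply: kbnd_kprod.
  move=> a _ am [x Qx ->]; exists (a *: x); last by rewrite (semilinZ fk).
  by have [_ _ _ mQ] := @kprod_kspace _ X n s i ms; apply: mQ.
- by move=> y [].
- move=> y Ey [_ [w dw ->] yw]; split=> //; exists (y - kmap f w); last first.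
    by rewrite (semilinB gk) kmap_gf // subr0.
  case: Ey => dy _ _; split; last by rewrite kdB yw kmap_kd_lin // subrr.
  by apply: submodB (kdeg_submod _ _) dy _; apply: (kmap_deg fl).
Qed.

End SyzygyRecursion.

(** * Integral power series *)

Record ps := PS { psc : nat -> int }.

Lemma psP f g : (forall n, psc f n = psc g n) -> f = g.
Proof. by case: f g => [f] [g] /= fg; congr PS; apply/funext. Qed.

HB.instance Definition _ := gen_eqMixin ps.
HB.instance Definition _ := gen_choiceMixin ps.

Definition ps_add f g := PS (fun n => psc f n + psc g n).
Definition ps_opp f := PS (fun n => - psc f n).
Definition ps_mul f g := PS (fun n => \sum_(i < n.+1) psc f i * psc g (n - i)).
Definition ps_const (a : int) := PS (fun n => if n == 0%N then a else 0).

Lemma ps_addA : associative ps_add. Proof. by move=> f g h; apply: psP => n /=; ring. Qed.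
Lemma ps_addC : commutative ps_add. Proof. by move=> f g; apply: psP => n /=; ring. Qed.
Lemma ps_add0 : left_id (ps_const 0) ps_add.
Proof. by move=> f; apply: psP => n /=; case: ifP => _; ring. Qed.
Lemma ps_addN : left_inverse (ps_const 0) ps_opp ps_add.
Proof. by move=> f; apply: psP => n /=; case: ifP => _; ring. Qed.

HB.instance Definition _ := GRing.isZmodule.Build ps ps_addA ps_addC ps_add0 ps_addN.

(** The coefficients of a product up to degree N are those of a product of
    polynomials, from which the laws of multiplication are imported. *)
Definition ps_trunc N f : {poly int} := \poly_(i < N.+1) psc f i.

Lemma ps_mulE N f g n : (n <= N)%N -> psc (ps_mul f g) n = (ps_trunc N f * ps_trunc N g)`_n.
Proof.
move=> nN; rewrite coefM /=; apply: eq_bigr => i _; rewrite !coef_poly !ltnS.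
by rewrite (leq_trans (leq_subr _ _) nN) (leq_trans (leq_ord i) nN).
Qed.

Lemma ps_mulA : associative ps_mul.
Proof.
move=> f g h; apply: psP => n.
have trunc_mul f' g' k : (k <= n)%N ->
    (ps_trunc n (ps_mul f' g'))`_k = (ps_trunc n f' * ps_trunc n g')`_k.
  by move=> kn; rewrite coef_poly ltnS kn (ps_mulE _ _ kn).
rewrite !(ps_mulE _ _ (leqnn n)).
transitivity (ps_trunc n f * (ps_trunc n g * ps_trunc n h))`_n.
  rewrite !coefM; apply: eq_bigr => i _; congr (_ * _); apply: trunc_mul.
  exact: leq_subr.
rewrite mulrA !coefM; apply: eq_bigr => i _; congr (_ * _); apply/esym/trunc_mul.
exact: leq_ord.
Qed.

Lemma ps_mulC : commutative ps_mul.
Proof. by move=> f g; apply: psP => n; rewrite !(ps_mulE _ _ (leqnn n)) mulrC. Qed.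

Lemma ps_mul1 : left_id (ps_const 1) ps_mul.
Proof.
move=> f; apply: psP => n /=; rewrite big_ord_recl /= mul1r subn0 big1 ?addr0 //.
by move=> i _; rewrite mul0r.
Qed.

Lemma ps_mulDl : left_distributive ps_mul ps_add.
Proof.
move=> f g h; apply: psP => n /=; rewrite -big_split.
by apply: eq_bigr => i _; rewrite mulrDl.
Qed.

Lemma ps_1neq0 : ps_const 1 != ps_const 0.
Proof. by apply/eqP => /(congr1 (fun f => psc f 0)). Qed.

HB.instance Definition _ := GRing.Zmodule_isComNzRing.Build ps
  ps_mulA ps_mulC ps_mul1 ps_mulDl ps_1neq0.

Lemma pscD f g n : psc (f + g) n = psc f n + psc g n. Proof. by []. Qed.
Lemma pscB f g n : psc (f - g) n = psc f n - psc g n. Proof. by []. Qed.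
Lemma pscM f g n : psc (f * g) n = \sum_(i < n.+1) psc f i * psc g (n - i). Proof. by []. Qed.
Lemma psc0 n : psc 0 n = 0. Proof. by rewrite /= if_same. Qed.
Lemma psc1 n : psc 1 n = (n == 0%N)%:R. Proof. by rewrite /=; case: eqP. Qed.

Definition pst : ps := PS (fun n => (n == 1%N)%:R).

Lemma psc_tM f n : psc (pst * f) n = if n is n'.+1 then psc f n' else 0.
Proof.
rewrite pscM big_ord_recl /= mul0r add0r; case: n => [|n]; first by rewrite big_ord0.
rewrite big_ord_recl /= mul1r subSS subn0 big1 ?addr0 // => i _.
by rewrite mul0r.
Qed.

Lemma psc_onetM f n : psc ((1 + pst) * f) n = psc f n + (if n is n'.+1 then psc f n' else 0).
Proof. by rewrite mulrDl mul1r pscD psc_tM. Qed.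

Definition psge0 f := forall n, 0 <= psc f n.

Lemma psge0D f g : psge0 f -> psge0 g -> psge0 (f + g).
Proof. by move=> f0 g0 n; rewrite pscD addr_ge0. Qed.

Lemma psge0M f g : psge0 f -> psge0 g -> psge0 (f * g).
Proof. by move=> f0 g0 n; rewrite pscM sumr_ge0 // => i _; rewrite mulr_ge0. Qed.

Lemma psge0_1 : psge0 1. Proof. by move=> n; rewrite psc1; case: eqP. Qed.
Lemma psge0_t : psge0 pst. Proof. by move=> n /=; case: eqP. Qed.
Lemma psge0X f n : psge0 f -> psge0 (f ^+ n).
Proof. by move=> f0; elim: n => [|n IH]; [exact: psge0_1 | rewrite exprS; apply: psge0M]. Qed.
Lemma psge0_onet : psge0 (1 + pst).
Proof. exact: psge0D psge0_1 psge0_t. Qed.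

Lemma psc_lowM f g n : (forall m, (m < n)%N -> psc f m = 0) ->
  psc (f * g) n = psc f n * psc g 0.
Proof.
move=> f0; rewrite pscM big_ord_recr /= subnn big1 ?add0r // => i _.
by rewrite f0 ?mul0r.
Qed.

Lemma ps_mulI0 f g : psc g 0 != 0 -> f * g = 0 -> f = 0.
Proof.
move=> g0 fg; apply: psP => n; rewrite psc0.
elim/ltn_ind: n => n IH; have := psc_lowM g IH.
by rewrite fg psc0 => /esym/eqP; rewrite mulf_eq0 (negPf g0) orbF => /eqP.
Qed.

(** The lowest nonzero coefficients of S U and of X k are positive, and cannot
    cancel. *)
Lemma ps_low_pos S U X k : psge0 S -> psge0 X -> 0 < psc U 0 -> 0 < psc k 0 ->
  S * U + X * k = 0 -> S = 0 /\ X = 0.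
Proof.
move=> S0 X0 U0 k0 SX.
suff H n : psc S n = 0 /\ psc X n = 0 by split; apply: psP => n; rewrite psc0; case: (H n).
elim/ltn_ind: n => n IH.
have := congr1 (fun f => psc f n) SX; rewrite pscD psc0.
rewrite (psc_lowM U (fun m mn => (IH m mn).1)) (psc_lowM k (fun m mn => (IH m mn).2)).
have := S0 n; have := X0 n => Xn Sn /eqP.
rewrite paddr_eq0 ?mulr_ge0 // 1?ltW // !mulf_eq0 (gt_eqF U0) (gt_eqF k0) !orbF.
by move=> /andP[/eqP-> /eqP->].
Qed.

(** * The Golod defect of a module *)

Section SemilinearKoszul.
Variables (R S : noethLocalRingType) (phi : {rmorphism R -> S}).
Hypothesis phi_surj : forall b, exists a, phi a = b.
Hypothesis phi_local : local_hom phi.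
Variables (V : lmodType R) (W : lmodType S) (f : V -> W) (finv : W -> V).
Hypotheses (fgV : fg_module V) (fl : semilin phi f) (fK : cancel f finv) (finvK : cancel finv f).

Lemma kmap_bij_cyc n s i (v : kch n V) : kcyc n s i v <-> kcyc n (map phi s) i (kmap f v).
Proof.
have fi := @kmap_inj _ _ _ _ f n (can_inj fK).
split=> [[dv cv]|[dv cv]]; split.
- exact: (kmap_deg fl).
- by rewrite -(kmap_kd fl) cv (semilin0 (kmap_lin fl (n := n))).
- have [w dw wv] := @kmap_lift _ _ _ _ f n i (kmap f v) (semilin0 fl)
    (kco_true _ (fun y => ex_intro _ (finv y) (finvK y))) dv.
  by rewrite -(fi _ _ wv).
- by apply: fi; rewrite (kmap_kd fl) cv (semilin0 (kmap_lin fl (n := n))).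
Qed.

Lemma kmap_bij_surj n i (w : kch n W) : kdeg i w -> exists2 v : kch n V, kdeg i v & kmap f v = w.
Proof.
by apply: kmap_lift; [exact: semilin0 fl | apply: kco_true => y; exists (finv y)].
Qed.

Lemma kmap_bij_bnd n s i (v : kch n V) : kbnd n s i v <-> kbnd n (map phi s) i (kmap f v).
Proof.
have fi := @kmap_inj _ _ _ _ f n (can_inj fK).
split=> [[w dw ->]|[w dw]].
  by exists (kmap f w); [apply: (kmap_deg fl) | rewrite (kmap_kd fl)].
have [u du <-] := kmap_bij_surj dw; rewrite -(kmap_kd fl) => /fi ->.
by exists u.
Qed.

(** Over A and over R, a module restricted along a section has the same Koszul
    homology with respect to corresponding families. *)
Lemma kh_semilin n s i : spans_max n s -> kh W n (map phi s) i = kh V n s i.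
Proof.
move=> ms; apply: (residue_dim_iso phi_surj phi_local (fg_kch n fgV) (kmap_lin fl (n := n)) (kcyc_kspace V i ms)).
- exact: kbnd_submod.
- by move=> v /kmap_bij_cyc.
- by move=> v _; apply: iff_sym; apply: kmap_bij_bnd.
- move=> w cw; have [v dv vw] := kmap_bij_surj cw.1; subst w.
  exists v; first exact/kmap_bij_cyc.
  by rewrite subrr; apply: submod0 (kbnd_submod _ _ _).
Qed.

End SemilinearKoszul.

Section GolodDefect.
Variable R : noethLocalRingType.
Implicit Types M : lmodType R.
Local Notation xs := (max_ideal_gens R).
Local Notation n := (size xs).

Lemma xs_max x : x \in xs -> x \in max_ideal R.
Proof. by have [+ _ _] := max_ideal_gensP R; apply. Qed.

Lemma xs_spans : spans_max n xs.
Proof. by have [] := max_ideal_gensP R. Qed.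

Definition betti_ps M := PS (fun i => (tor_dim M i)%:Z).
Definition koszul_ps M := PS (fun i => (koszul_dim M i)%:Z).
Definition denom_ps := 1 - pst * (koszul_ps R^o - 1).

Lemma koszul_psE M i : fg_module M -> psc (koszul_ps M) i = kh M n xs i.
Proof. by move=> fgM; rewrite /= (koszul_dimE i fgM (max_ideal_gensP R)). Qed.

Lemma koszul_dim_gt M i : fg_module M -> (n < i)%N -> koszul_dim M i = 0%N.
Proof.
move=> fgM ni; rewrite (koszul_dimE i fgM (max_ideal_gensP R)) /kh.
rewrite (_ : kcyc n xs i = kbnd n xs i); first exact/residue_dimxx/kbnd_submod.
apply/seteqP; split; last exact: kbnd_cyc.
by move=> v [dv _]; rewrite (kdeg_gt _ dv) //; apply: submod0 (kbnd_submod _ _ _).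
Qed.

Lemma coef_koszul_poly M i : fg_module M -> (koszul_poly M)`_i = psc (koszul_ps M) i.
Proof.
move=> fgM; rewrite coef_poly /=; case: ltnP => // ni.
by rewrite koszul_dim_gt.
Qed.

Lemma coef_denominator i : (golod_denominator R)`_i = psc denom_ps i.
Proof.
rewrite /golod_denominator /denom_ps coefB coef1 pscB psc1 coefXM psc_tM.
case: i => [|i]; congr (_ - _) => //.
transitivity ((koszul_poly R^o - 1)`_i) => //.
by rewrite coefB coef1 pscB psc1 (coef_koszul_poly _ (fg_regular R)).
Qed.

Lemma golodE M : fg_module M -> golod M <-> betti_ps M * denom_ps = koszul_ps M.
Proof.
move=> fgM; split=> [gM|e i].
  apply: psP => i; rewrite -(coef_koszul_poly _ fgM) -gM pscM.
  by apply: eq_bigr => k _; rewrite coef_denominator.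
rewrite (coef_koszul_poly _ fgM) -e pscM.
by apply: eq_bigr => k _; rewrite coef_denominator.
Qed.

Fixpoint alt_sum (f : nat -> int) i : int := f i - (if i is i'.+1 then alt_sum f i' else 0).

(** The series S_M with (1 + t) S_M = kappa_M - D_R P_M (defectE), which measures
    how far M is from being Golod. *)
Definition defect_ps M := PS (alt_sum (psc (koszul_ps M - denom_ps * betti_ps M))).

Lemma defectE M : (1 + pst) * defect_ps M = koszul_ps M - denom_ps * betti_ps M.
Proof. by apply: psP => -[|i]; rewrite psc_onetM /= ?addr0 ?subr0 // subrK. Qed.

Lemma onet_inj f g : (1 + pst) * f = (1 + pst) * g -> f = g.
Proof.
move=> e; apply/eqP; rewrite -subr_eq0; apply/eqP; apply: (@ps_mulI0 _ (1 + pst)) => //.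
by rewrite mulrC mulrBr e subrr.
Qed.

Lemma golod_defect M : fg_module M -> golod M <-> defect_ps M = 0.
Proof.
move=> fgM; rewrite golodE //; split=> [e|e].
  by apply: onet_inj; rewrite defectE mulrC e subrr mulr0.
by move: (defectE M); rewrite e mulr0 => /esym/eqP; rewrite subr_eq0 mulrC => /eqP.
Qed.

Lemma tor_dim_iso (M N : lmodType R) (f : M -> N) (g : N -> M) i : fg_module M -> lin f ->
  cancel f g -> cancel g f -> tor_dim N i = tor_dim M i.
Proof.
move=> fgM fl fK gK; rewrite !tor_dimE.
apply: (tord_iso i fgM fl) => //; [exact: submod_set0 | exact: submod_set0 | |].
- move=> x _; split=> /= [fx|->]; last exact: semilin0 fl.
  by apply: (can_inj fK); rewrite fx (semilin0 fl).
- by move=> y _; exists (g y) => //; rewrite gK; exact: subrr.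
Qed.

Lemma golod_iso (M N : lmodType R) (f : M -> N) (g : N -> M) : fg_module M -> fg_module N -> lin f ->
  cancel f g -> cancel g f -> golod N <-> golod M.
Proof.
move=> fgM fgN fl fK gK; rewrite !golodE //.
have -> : betti_ps N = betti_ps M.
  by apply: psP => i; rewrite /= (tor_dim_iso i fgM fl fK gK).
suff -> : koszul_ps N = koszul_ps M by [].
apply: psP => i; rewrite !koszul_psE //; congr Posz.
have sj b : exists a, idfun a = b :> R by exists b.
by have := kh_semilin sj (fun _ => id) fgM fl fK gK i xs_spans; rewrite map_id.
Qed.

(** ** Minimal covers *)

Lemma minimal_cover M : fg_module M -> exists b (g : 'rV[R]_b -> M),
  [/\ lin g, forall x, exists u, g u = x & forall u, g u = 0 -> inmax u].
Proof.
move=> fgM; have [b [v [_ vs vi]]] :=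
  residue_basis_exists (submod_set0 M) (noetherian fgM (submod_setT M)).
exists b, (fun u => \sum_i u 0 i *: v i); split.
- move=> a x y; rewrite scaler_sumr -big_split; apply: eq_bigr => i _.
  by rewrite !mxE scalerDl scalerA.
- move=> x; have [c /= /eqP] := vs x I; rewrite subr_eq0 => /eqP ->.
  by exists (\row_i c i); apply: eq_bigr => i _; rewrite mxE.
- by move=> u /vi um k; apply: um.
Qed.

Section MinimalCover.
Variables (M : lmodType R) (b : nat) (g : 'rV[R]_b -> M).
Hypotheses (fgM : fg_module M) (gl : lin g) (gsurj : forall x, exists u, g u = x).
Hypothesis gker : forall u, g u = 0 -> inmax u.

Definition cover_ker : set 'rV[R]_b := [set u | g u = 0].

Lemma cover_ker_submod : submod cover_ker.
Proof. exact: (semilin_preim gl (submod_set0 M)). Qed.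

Let Om : lmodType R := submodule cover_ker_submod.

Lemma fg_Om : fg_module Om.
Proof. exact: fg_submodule (fg_rV _ _). Qed.

Lemma tor_dim_cover i : tor_dim M i = if i is i'.+1 then tor_dim Om i' else b.
Proof.
have -> : tor_dim M i = tord [set: 'rV[R]_b] cover_ker i.
  rewrite tor_dimE; apply: (tord_iso i (fg_rV R b) gl) => //.
  - exact: cover_ker_submod.
  - exact: submod_set0.
  - by move=> x _; have [u <-] := gsurj x; exists u => //; exact: subrr.
case: i => [|i]; first exact: (tord_syzygy0 cover_ker_submod gker).
rewrite (tord_syzygyS i cover_ker_submod gker) tor_dimE.
apply: (tord_iso i fg_Om (@subval_lin _ _ _ cover_ker_submod)) => //.
- exact: submod_set0.
- exact: submod_set0.
- by move=> x _; apply: subvalP.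
- by move=> x _; split=> [/= x0|-> //]; apply: subval_inj.
- by move=> u /(subval_surj cover_ker_submod)[x <-]; exists x => //; exact: subrr.
Qed.

Lemma koszul_cover i :
  (kh Om n xs i + kimg_dim g n xs (i + 1) + kimg_dim g n xs i =
   kh M n xs (i + 1) + b * kh R^o n xs i)%N.
Proof.
rewrite -(kh_free xs_spans).
apply: (koszul_les fg_Om (fg_rV R b) fgM (@subval_lin _ _ _ cover_ker_submod) gl) => //.
- exact: subval_inj.
- by move=> x; apply: (subvalP x).
- by move=> u gu; exact: (subval_surj cover_ker_submod gu).
- exact: xs_spans.
Qed.

Lemma kq_cover i : (kq M n xs (i + 1) <= kimg_dim g n xs (i + 1) + kq Om n xs i)%N.
Proof.
apply: (kq_syzygy xs_spans fg_Om (fg_rV R b) fgM (@subval_lin _ _ _ cover_ker_submod) gl) => //.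
- exact: subval_inj.
- by move=> x; apply: (subvalP x).
- by move=> u gu; exact: (subval_surj cover_ker_submod gu).
Qed.

Fixpoint kinj k : M -> kch k M :=
  if k is k'.+1 return M -> kch k M then fun x => (kinj k' x, 0) else id.

Lemma kinj_lin k : lin (kinj k).
Proof.
elim: k => [|k IH] a x y //=; rewrite IH; apply: kpairP; rewrite ?kchE //=.
by rewrite scaler0 addr0.
Qed.

Lemma kinj_deg k x : kdeg 0 (kinj k x).
Proof. by elim: k => //= k IH; split=> //; apply: submod0 (kdeg_submod _ _). Qed.

Lemma kinj_surj k (v : kch k M) : kdeg 0 v -> exists x, kinj k x = v.
Proof.
elim: k v => [|k IH] v /=; first by exists v.
move=> [/IH[x e1] /kdeg_lt0 e2]; exists x; apply: kpairP => //=.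
by rewrite e2.
Qed.

Lemma kimg_dim0 : kimg_dim g n xs 0 = kh M n xs 0.
Proof.
rewrite /kimg_dim /kh; congr residue_dim; apply/seteqP; split; first exact: kimg_cyc.
move=> w [dw _]; have [y dy gy] := kmap_surj_deg gl gsurj dw.
by exists y => //; split=> //; apply: kd_deg0.
Qed.

Lemma kd_inmax k s (y : kch k 'rV[R]_b) : (forall x, x \in s -> x \in max_ideal R) ->
  kco (@inmax R b) (kd s y).
Proof.
elim: k s y => [|k IH] s y sm /=; first exact: submod0 (inmax_submod _).
have bm x : x \in behead s -> x \in max_ideal R by move=> /mem_behead; apply: sm.
have hm : head 0 s \in max_ideal R.
  by case: (s) sm => [|a s'] sm /=; [exact: max0 | apply: sm; rewrite inE eqxx].
have kcoP (u v : kch k 'rV[R]_b) : kco (@inmax R b) u -> kco (@inmax R b) v ->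
    kco (@inmax R b) (u + v).
  elim: (k) u v => [|l IHl] u v /=; first exact: (submodD (inmax_submod _)).
  by move=> [u1 u2] [v1 v2]; split; apply: IHl.
have kcoZ a (u : kch k 'rV[R]_b) : a \in max_ideal R -> kco (@inmax R b) (a *: u).
  move=> am; elim: (k) u => [|l IHl] u /=; first by move=> c; rewrite mxE maxMr.
  by split; apply: IHl.
split; first by apply: kcoP; [exact: IH | exact: kcoZ].
by rewrite -(kdN (behead s)); apply: IH.
Qed.

(** H_0(M) = M / m M. *)
Lemma kh_cover0 : kh M n xs 0 = b.
Proof.
have kl := lin_comp gl (@kinj_lin n).
have kb : residue_dim [set: 'rV[R]_b] (@inmax R b) = b.
  apply: (residue_dimE (v := fun i => delta_mx 0 i)) => //; first exact: inmax_submod.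
  split=> // [u _|c cm i].
    exists (u 0); rewrite -row_sum_delta subrr; exact: submod0 (inmax_submod _).
  have -> : c i = (\sum_j c j *: delta_mx 0 j : 'rV_b) 0 i; last exact: cm.
  rewrite (_ : \sum_j _ = \row_j c j) ?mxE // [RHS]row_sum_delta.
  by apply: eq_bigr => j _; rewrite mxE.
rewrite -[RHS]kb; apply: (residue_dim_liniso (f := kinj n \o g) (fg_rV R b) kl).
- split; [exact: submod_setT | exact: inmax_submod | by [] |].
  by move=> a u am _ k; rewrite mxE maxMr.
- exact: kbnd_submod.
- by move=> u _; split; [exact: kinj_deg | apply: kd_deg0; exact: kinj_deg].
- move=> u _; split=> [[c dc uc]|um].
    have [y dy gy] := kmap_surj_deg gl gsurj dc.
    have gE k (v : 'rV[R]_b) : kinj k (g v) = kmap g ((fix ki k := if k is k'.+1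
        return 'rV[R]_b -> kch k 'rV[R]_b then fun x => (ki k' x, 0) else id) k v).
      elim: k => //= k ->; congr pair; exact/esym/(semilin0 (kmap_lin gl (n := k))).
    move: uc; rewrite /= gE -gy -kmap_kd_lin // => /eqP.
    rewrite -subr_eq0 -(semilinB (kmap_lin gl (n := n))) => /eqP e.
    have cm : kco (@inmax R b) (kd xs y) by apply: kd_inmax; exact: xs_max.
    elim: (n) (kd xs y) cm e => [|k IH] w /=.
      move=> wm /gker um; exact: (submod_subr (inmax_submod _) um wm).
    by move=> [w1 w2] /(congr1 fst) /=; apply: IH.
  have [_ _ _ mZ] := kcyc_kspace M 0 xs_spans.
  rewrite /= [u]row_sum_delta (semilin_sum gl) (semilin_sum (@kinj_lin n)).
  apply: submod_sum => [|k _]; first exact: kbnd_submod.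
  rewrite (semilinZ gl) (semilinZ (@kinj_lin n)); apply: mZ; first exact: um.
  by split; [exact: kinj_deg | apply: kd_deg0; exact: kinj_deg].
- move=> v [dv _]; have [x <-] := kinj_surj dv; have [u <-] := gsurj x.
  by exists u => //; rewrite subrr; apply: submod0 (kbnd_submod _ _ _).
Qed.

(** Substituting the long exact sequence koszul_cover in the defect leaves the
    recursion S_M = tau - b + t S_Om, where tau counts the image of H(R^b) in
    H(M) and has constant term b. *)
Lemma defect_cover i : psc (defect_ps M) i =
  if i is i'.+1 then (kimg_dim g n xs i)%:Z + psc (defect_ps Om) i' else 0.
Proof.
pose T := PS (fun i => (kimg_dim g n xs i)%:Z).
have bE : betti_ps M = ps_const b + pst * betti_ps Om.
  apply: psP => -[|k]; rewrite pscD psc_tM [LHS]/= tor_dim_cover [psc (ps_const _) _]/=.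
    by rewrite addr0.
  by rewrite add0r.
have kE : pst * koszul_ps Om + (1 + pst) * T = koszul_ps M + pst * (ps_const b * koszul_ps R^o).
  apply: psP => -[|k]; rewrite !pscD psc_onetM !psc_tM.
    by rewrite !addr0 add0r koszul_psE //= kimg_dim0.
  rewrite (koszul_psE _ fg_Om) (koszul_psE _ fgM) pscM big_ord_recl subn0.
  rewrite (koszul_psE _ (fg_regular R)) big1 ?addr0 /=; last by move=> l _; rewrite mul0r.
  have := koszul_cover k; rewrite (_ : k%:Z + 1 = k.+1); lia.
have -> : defect_ps M = T - ps_const b + pst * defect_ps Om.
  apply: onet_inj; rewrite defectE bE [RHS]mulrDr [X in _ = _ + X]mulrCA defectE.
  have -> : koszul_ps M = pst * koszul_ps Om + (1 + pst) * T - pst * (ps_const b * koszul_ps R^o).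
    by rewrite kE addrK.
  by rewrite /denom_ps; ring.
rewrite pscD pscB psc_tM; case: i => [|i] /=; last by rewrite subr0.
by rewrite kimg_dim0 kh_cover0 subrr addr0.
Qed.

End MinimalCover.

(** Along syzygies, the dimensions of H_+(R) H(M) satisfy as an inequality
    (kq_cover) the recursion that the defect satisfies (defect_cover). *)
Lemma kq_le_defect M (i : nat) : fg_module M -> (kq M n xs i)%:Z <= psc (defect_ps M) i.
Proof.
elim: i M => [|i IH] M fgM; have [b [g [gl gs gk]]] := minimal_cover fgM.
  rewrite (defect_cover fgM gl gs gk) /kq (_ : kprod n xs 0 = kbnd n xs 0).
    by rewrite residue_dimxx //; apply: kbnd_submod.
  by apply/seteqP; split; [exact: kprod_le0 | exact: kbnd_kprod].
rewrite (defect_cover fgM gl gs gk).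
have := kq_cover fgM gl gs i; have := IH _ (fg_Om gl).
rewrite (_ : i%:Z + 1 = i.+1); lia.
Qed.

Lemma defect_ge0 M : fg_module M -> psge0 (defect_ps M).
Proof. by move=> fgM i; apply: le_trans (kq_le_defect i fgM). Qed.

End GolodDefect.

(** * A Golod module forces the ring to be Golod *)

Lemma bsum_lt0 r (f : int -> nat) (i : int) :
  (forall k : int, k < 0 -> f k = 0%N) -> i < 0 -> bsum r f i = 0%N.
Proof.
move=> f0; elim: r i => [|r IH] i i0 /=; first exact: f0.
by rewrite !IH // subr_lt0 (lt_trans i0).
Qed.

Lemma bsum_ps r (f : int -> nat) : (forall k : int, k < 0 -> f k = 0%N) ->
  PS (fun i => (bsum r f i)%:Z) = (1 + pst) ^+ r * PS (fun i => (f i)%:Z).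
Proof.
move=> f0; elim: r => [|r IH]; first by rewrite mul1r.
rewrite exprS -mulrA -IH; apply: psP => -[|i]; rewrite psc_onetM /= PoszD.
  by rewrite (@bsum_lt0 _ _ (0 - 1)).
by rewrite (_ : i.+1%:Z - 1 = i) //; lia.
Qed.

Lemma cone_rk_ps r (f : nat -> nat) :
  PS (fun i => (iter r cone_rk f i)%:Z) = (1 + pst) ^+ r * PS (fun i => (f i)%:Z).
Proof.
elim: r => [|r IH]; first by rewrite mul1r.
rewrite exprS -mulrA -IH; apply: psP => -[|i]; rewrite psc_onetM /= ?addr0 //.
Qed.

Lemma kd_kill (R : noethLocalRingType) (M : lmodType R) k (ys s : seq R) (v : kch k M) :
  (forall y (x : M), y \in ys -> y *: x = 0) ->
  kd (ys ++ s) v = kd (nseq (size ys) 0 ++ s) v.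
Proof.
elim: ys k v => [//|y ys IH] [//|k] v yk /=.
rewrite !IH; try by move=> y' x y'ys; apply: yk; rewrite inE y'ys orbT.
rewrite scale0r (_ : y *: v.2 = 0) //.
have {}yk : forall x : M, y *: x = 0 by move=> x; apply: yk; rewrite inE eqxx.
elim: (k) (v.2) => [|l IHl] w; first exact: yk.
by apply: kpairP; rewrite kchE IHl.
Qed.

Section ResidueFieldGolod.
Variable R : noethLocalRingType.
Local Notation xs := (max_ideal_gens R).
Local Notation n := (size xs).
Local Notation k := (kmod R).

Lemma kmod_kill a (u : k) : a \in max_ideal R -> a *: u = 0.
Proof.
move=> am; rewrite -[LHS]/((residue_map a : residue_field R) * u).
have /eqP -> : residue_map a == 0 by rewrite residue_map_eq0.
exact: mul0r.
Qed.

(** The differential of K (x) k vanishes, each of the n generators doubling the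
    complex. *)
Lemma koszul_kmod : koszul_ps k = (1 + pst) ^+ n.
Proof.
have fgk := fg_kmod R.
pose P i : set (kch 0 k) := kcyc 0 [::] i; pose Q i : set (kch 0 k) := kbnd 0 [::] i.
pose d (i : int) := residue_dim (P i) (Q i).
have kPQ i : kspace (P i) (Q i).
  split; [exact: kcyc_submod | exact: kbnd_submod | exact: kbnd_cyc |].
  by move=> a z am _; rewrite [_ *: _]kmod_kill //; apply: submod0 (kbnd_submod _ _ _).
have khE i : kh k n xs i = bsum n d i.
  have [_ <-] := kall_dim n fgk kPQ i.
  have kdE (v : kch (n + 0) k) : kd xs v = kd (nseq n 0 ++ [::]) v.
    have := @kd_kill R k (n + 0) xs [::] v (fun y x yx => kmod_kill x (xs_max yx)).
    by rewrite (cats0 xs).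
  rewrite -[X in kh _ X _ _](addn0 n) /kh -kcyc_layers -kbnd_layers.
  congr residue_dim; apply/seteqP; split=> v.
  - by move=> [dv cv]; split; rewrite -?kdE.
  - by move=> [dv cv]; split; rewrite ?kdE.
  - by move=> [w dw ->]; exists w; rewrite -?kdE.
  - by move=> [w dw ->]; exists w; rewrite ?kdE.
have Q0 i : Q i = [set 0].
  apply/seteqP; split=> v; first by move=> [w _ ->].
  by move=> ->; apply: submod0 (kbnd_submod _ _ _).
have dim0 : residue_dim (P 0) (Q 0) = 1%N.
  apply: (residue_dimE (v := fun _ : 'I_1 => (1 : residue_field R) : k)); first exact: kbnd_submod.
  split=> [_|z _|c]; first by split=> //; rewrite eqxx.
    have [x xz] := residue_map_surj z; exists (fun=> x); rewrite Q0 big_ord1 /=.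
    by rewrite -[x *: _]/((residue_map x : residue_field R) * 1) mulr1 xz subrr.
  rewrite Q0 big_ord1 /= => /eqP e i; rewrite (ord1 i) maxE -residue_map_eq0.
  by rewrite -[X in X == _]mulr1.
have dimN i : i != 0 -> residue_dim (P i) (Q i) = 0%N.
  move=> i0; rewrite (_ : P i = Q i); first exact/residue_dimxx/kbnd_submod.
  rewrite Q0; apply/seteqP; split=> v; first by move=> [/(_ i0)].
  by move=> ->; apply: submod0 (kcyc_submod _ _ _).
transitivity ((1 + pst) ^+ n * PS (fun i => (d i)%:Z)); last first.
  rewrite -[RHS]mulr1; congr (_ * _).
  by apply: psP => -[|i]; rewrite psc1 /= /d ?dim0 ?dimN.
rewrite -bsum_ps => [|i i0]; last by rewrite /d dimN // lt_eqF.
by apply: psP => i; rewrite koszul_psE // khE.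
Qed.

Lemma tor_dim0_gt0 (M : lmodType R) : fg_module M -> nonzero_module M ->
  (0 < psc (koszul_ps M) 0) && (0 < psc (betti_ps M) 0).
Proof.
move=> fgM [x x0]; have [b [g [gl gs gk]]] := minimal_cover fgM.
rewrite koszul_psE // (kh_cover0 gl gs gk) /= (tor_dim_cover gl gs gk).
rewrite !ltz_nat andbb lt0n; apply: contra_neq x0 => b0.
have [u <-] := gs x; rewrite (_ : u = 0) ?(semilin0 gl) //.
by apply/rowP => i; have := leq_trans (ltn_ord i) (eq_leq b0).
Qed.

(** Let E = kappa_M P_k - (1 + t)^n P_M, which is nonnegative (betti_koszul_le).
    If M is Golod then E D_R + (1 + t) kappa_M S_k = 0, so that S_k = 0. *)
Lemma golod_residue_field (M : lmodType R) : fg_module M -> nonzero_module M ->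
  golod M -> golod k.
Proof.
move=> fgM M0 gM; have fgk := fg_kmod R.
apply/golod_defect => //; have defk := defectE k; rewrite koszul_kmod in defk.
pose E := koszul_ps M * betti_ps k - (1 + pst) ^+ n * betti_ps M.
have E0 : psge0 E.
  move=> i; rewrite pscB subr_ge0 -cone_rk_ps pscM.
  have := betti_koszul_le i fgM (@xs_max R) (@xs_spans R).
  rewrite -lez_nat => /le_trans; apply; rewrite rmorph_sum; apply: ler_sum => l _ /=.
  by rewrite (koszul_dimE l fgM (max_ideal_gensP R)) PoszM.
have DE : E * denom_ps R + defect_ps k * ((1 + pst) * koszul_ps M) = 0.
  have := defk; move/(golodE fgM): gM => gM defk'.
  transitivity (koszul_ps M * (denom_ps R * betti_ps k + (1 + pst) * defect_ps k)
    - (1 + pst) ^+ n * (betti_ps M * denom_ps R)); first by rewrite /E; ring.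
  by rewrite defk' gM [X in _ * X - _]addrC subrK mulrC subrr.
have [||_ ->] := ps_low_pos E0 (defect_ge0 fgk) _ _ DE.
- by rewrite /denom_ps pscB psc1 psc_tM subr0.
- by rewrite psc_onetM addr0; have /andP[] := tor_dim0_gt0 fgM M0.
- by [].
Qed.

End ResidueFieldGolod.

(** * Chains with products of positive degree as coefficients *)

Section LayeredProducts.
Variables (R : noethLocalRingType) (n : nat) (s : seq R).
Hypothesis ms : spans_max n s.

(** With layers in kscal, a family is a chain on the first r generators with
    coefficients in R. *)
Definition kscal (a : int) : set (kch n R^o) :=
  [set c | exists2 x : R, a != 0 -> x = 0 & c = x *: kunit R n].

(** With layers in kpos, a family of cycles has no component along H_0(R). *)
Definition kpos (a : int) : set (kch n R^o) := if 0 < a then kcyc n s a else [set 0].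
Definition kposb (a : int) : set (kch n R^o) := if 0 < a then kbnd n s a else [set 0].

Lemma kscal_cyc a : kscal a `<=` kcyc n s a.
Proof.
move=> _ [x xa ->]; split; last by rewrite kdZ kd_unit scaler0.
have [->|/xa ->] := eqVneq a 0; last by rewrite scale0r; apply: submod0 (kdeg_submod _ _).
exact: submodZ (kdeg_submod _ _) (kunit_deg _ _).
Qed.

Lemma kscal_submod a : submod (kscal a).
Proof.
split; first by exists 0; rewrite ?scale0r.
move=> c _ _ [x xa ->] [y ya ->]; exists (c * x + y); last by rewrite scalerDl scalerA.
by move=> a0; rewrite xa // ya // mulr0 addr0.
Qed.

Lemma kpos_submod a : submod (kpos a).
Proof. by rewrite /kpos; case: ifP => _; [exact: kcyc_submod | exact: submod_set0]. Qed.

Lemma kposb_submod a : submod (kposb a).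
Proof. by rewrite /kposb; case: ifP => _; [exact: kbnd_submod | exact: submod_set0]. Qed.

Lemma kpos_kspace a : kspace (kpos a) (kposb a).
Proof.
split; [exact: kpos_submod | exact: kposb_submod | |]; rewrite /kpos /kposb; case: ifP => _ //.
- exact: kbnd_cyc.
- by have [_ _ _] := kcyc_kspace R^o a ms.
- by move=> b z _ ->; rewrite scaler0.
Qed.

(** A family of cycles is the sum of the products of its members with monomials
    in the first r generators. *)
Lemma kpos_ind r (T : set (kch (r + n) R^o)) i : submod T ->
  (forall b a (u : kch (r + n) R^o) (z : kch n R^o), 0 < a -> b + a = i ->
     kall r kscal b u -> kcyc n s a z -> T (klr z u)) ->
  kall r kpos i `<=` T.
Proof.
elim: r T i => [|r IH] T i sT gT v /=.
  rewrite /kpos; case: ifP => [i0 zv|_ ->]; last exact: submod0.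
  rewrite -(krm_unitl v); apply: (gT 0 i) => //; first by rewrite add0r.
  by exists 1; rewrite ?eqxx // scale1r.
move=> [v1 v2]; have -> : v = ((v.1, 0) : kch (r.+1 + n) R^o) + (0, v.2).
  by apply: kpairP; rewrite kchE /= ?addr0 ?add0r.
have u0 b : kall r kscal b (0 : kch (r + n) R^o).
  exact: submod0 (kall_submod r b kscal_submod).
apply: submodD => //.
  apply: (IH (fun w => T ((w, 0) : kch (r.+1 + n) R^o)) i) v1.
    split; first exact: (submod0 sT).
    move=> c x y Tx Ty; have := sT.2 c _ _ Tx Ty; congr T.
    by apply: kpairP; rewrite kchE //= scaler0 addr0.
  move=> b a u z a0 ab Uu Zz; have := gT b a ((u, 0) : kch (r.+1 + n) R^o) z a0 ab _ Zz.
  by rewrite /= (semilin0 (@klr_lin _ _ _ r z)); apply; split=> //=.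
apply: (IH (fun w => T ((0, w) : kch (r.+1 + n) R^o)) (i - 1)) v2.
  split; first exact: (submod0 sT).
  move=> c x y Tx Ty; have := sT.2 c _ _ Tx Ty; congr T.
  by apply: kpairP; rewrite kchE //= scaler0 addr0.
move=> b a u z a0 ab Uu Zz.
have := gT (b + 1) a ((0, u) : kch (r.+1 + n) R^o) z a0 _ _ Zz.
rewrite /= (semilin0 (@klr_lin _ _ _ r z)); apply; first by rewrite addrAC ab subrK.
by split=> //=; rewrite addrK.
Qed.

Variable M : lmodType R.

(** The families of kall r P whose member indexed by all of the first r
    generators satisfies Q. *)
Fixpoint knt r (P Q : int -> set (kch n M)) i : set (kch (r + n) M) :=
  if r is r'.+1 return set (kch (r + n) M) then
    fun v => kall r' P i v.1 /\ @knt r' P Q (i - 1) v.2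
  else Q i.
Arguments knt : clear implicits.

(** The coefficient of degree i of ((1 + t)^r - t^r) f(t). *)
Fixpoint knt_sum r (f : int -> nat) i : nat :=
  if r is r'.+1 then (bsum r' f i + knt_sum r' f (i - 1)%R)%N else 0%N.

Lemma knt_dim r P Q : fg_module M -> (forall i, kspace (P i) (Q i)) -> forall i,
  kspace (knt r P Q i) (kall r Q i) /\
  residue_dim (knt r P Q i) (kall r Q i) = knt_sum r (fun i => residue_dim (P i) (Q i)) i.
Proof.
move=> fgM kPQ; elim: r => [|r IH] i.
  have [_ sQ _ mP] := kPQ i; split; last exact: residue_dimxx.
  by split=> // a z _; apply: submodZ.
have [k1 d1] := kall_dim r fgM kPQ i; have [k2 d2] := IH (i - 1).
have fgr := fg_kch (r + n) fgM.
have [k d] := residue_dim_prod fgr fgr k1 k2.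
by split=> //=; rewrite -d1 -d2 -d.
Qed.

Lemma kall_knt r P Q i v : (forall j, submod (Q j)) ->
  kall r P i v -> ktop v = 0 -> knt r P Q i v.
Proof.
move=> sQ; elim: r i v => [|r IH] i v /=; first by move=> _ ->; apply: submod0.
by move=> [v1 v2] t0; split=> //; apply: IH.
Qed.

Lemma kall_klr r b a i (z : kch n R^o) (v : kch (r + n) M) : 0 < a -> b + a = i ->
  kcyc n s a z -> kall r (fun j => kcyc n s j) b v -> kall r (fun j => kprod n s j) i (klr z v).
Proof.
move=> a0; elim: r b i v => [|r IH] b i v ab Zz /=; first exact: (kprod_krm a0 ab Zz).
by move=> [v1 v2]; split; [apply: IH v1 | apply: IH v2] => //; rewrite -ab addrAC.
Qed.

(** The terms of the differential of a chain with coefficients in R that are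
    produced by the elements of ls, by which R maps to M. *)
Fixpoint kdy r (ls : seq M) : kch (r + n) R^o -> kch (r + n) M :=
  if r is r'.+1 return kch (r + n) R^o -> kch (r + n) M then
    fun v => (kdy (behead ls) v.1 + kmap (fun x : R^o => (x : R) *: head 0 ls) v.2,
              - kdy (behead ls) v.2)
  else fun=> 0.

Lemma scale_lin (y : M) : lin (fun x : R^o => (x : R) *: y).
Proof. by move=> a x x'; rewrite scalerDl scalerA. Qed.

Lemma kdy_lin r ls : lin (@kdy r ls).
Proof.
elim: r ls => [|r IH] ls a x y /=; first by rewrite scaler0 addr0.
rewrite !IH (kmap_lin (scale_lin (head 0 ls)) (n := r + n)); apply: kpairP; rewrite !kchE /=.
  by rewrite scalerDr; abelian.
by rewrite opprD scalerN.
Qed.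

Lemma kdy_deg r ls i v : kdeg i v -> kdeg (i - 1) (@kdy r ls v).
Proof.
elim: r ls i v => [|r IH] ls i v /=; first by move=> _; apply: submod0 (kdeg_submod _ _).
move=> [v1 v2]; split.
  apply: submodD (kdeg_submod _ _) _ _; first exact: IH.
  exact: (kmap_deg (scale_lin _)).
by apply: submodN (kdeg_submod _ _) _; apply: IH.
Qed.

Lemma kdy_top r ls v : ktop (@kdy r ls v) = 0.
Proof.
elim: r ls v => [//|r IH] ls v /=.
have topN q (w : kch (q + n) M) : ktop (- w) = - ktop w by elim: q w => //= q IHq w; apply: IHq.
by rewrite topN IH oppr0.
Qed.

Lemma kmap_klr r z (y : M) (v : kch (r + n) R^o) :
  kmap (fun x : R^o => (x : R) *: y) (klr z v) = klr z (kmap (fun x : R^o => (x : R) *: y) v).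
Proof.
elim: r v => [|r IH] v /=; first exact: (kmap_krm v z (scale_lin y)).
by rewrite !IH.
Qed.

Lemma kdy_klr r ls z v : kdy ls (klr z v) = klr z (@kdy r ls v).
Proof.
elim: r ls v => [|r IH] ls v /=; first by rewrite (semilin0 (krm_linl _)).
by rewrite !IH kmap_klr (semilinD (@klr_lin _ _ _ r z)) (semilinN (@klr_lin _ _ _ r z)).
Qed.

End LayeredProducts.
Arguments knt {R n M} r P Q i _.

(** * Koszul homology of the retract *)

Lemma lincomb_cat (R : noethLocalRingType) (b s t : seq R) m :
  lincomb b (s ++ t) (size s + m) =
  lincomb b s (size s) + lincomb (drop (size s) b) t m.
Proof.
elim: s b => [|x s IH] b /=; first by rewrite drop0 add0r.
by rewrite IH addrA; case: b => //=; rewrite ?drop0 //; case: (size s).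
Qed.

Lemma min_gensI (R : noethLocalRingType) (s : seq R) :
  (forall x, x \in s -> x \in max_ideal R) -> spans_max (size s) s ->
  (forall b : seq R, lincomb b s (size s) = 0 ->
     forall k, (k < size s)%N -> b`_k \in max_ideal R) -> min_gens s.
Proof.
move=> sm ms si; split=> // c c0 i.
pose b := mkseq (fun k => if insub k is Some i then c i else 0) (size s).
have bE (k : 'I_(size s)) : b`_k = c k.
  by rewrite nth_mkseq // insubT // => lti; congr c; apply: val_inj.
rewrite -bE; apply: si => //; rewrite lincombE -[RHS]c0.
by apply: eq_bigr => k _; rewrite bE.
Qed.

Section Retract.
Variables (R A : noethLocalRingType) (j : {rmorphism R -> A}) (p p' : {rmorphism A -> R}).
Hypotheses (j_local : local_hom j) (p_local : local_hom p) (p'_local : local_hom p').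
Hypotheses (pj : cancel j p) (p'j : cancel j p').
Hypothesis II'0 : forall (x : kernel p) (y : kernel p'), kernel_val x * kernel_val y = 0 :> A.

Local Notation I := (restrict_scalars j (kernel p)).
Local Notation xs := (max_ideal_gens R).
Local Notation n := (size xs).

Definition ival (x : I) : A^o := kernel_val (x : kernel p).

Lemma ival_inj : injective ival.
Proof. exact: val_inj. Qed.

Lemma ival_semilin : semilin j ival.
Proof. by []. Qed.

Lemma p_ival x : p (ival x) = 0.
Proof. by apply/eqP; apply: (valP (x : kernel p)). Qed.

Lemma ival_surj a : p a = 0 -> exists x : I, ival x = a.
Proof.
move=> pa; have ka : (a : A^o) \in in_kernel p by rewrite inE pa.
by exists (Kernel ka : kernel p).
Qed.

(** I I' = 0 makes A act on I through p'. *)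
Lemma ival_act a x : a * ival x = j (p' a) * ival x.
Proof.
have ka : (a - j (p' a) : A^o) \in in_kernel p' by rewrite inE rmorphB p'j subrr.
apply/eqP; rewrite -subr_eq0 -mulrBl mulrC; apply/eqP.
exact: (II'0 (x : kernel p) (Kernel ka)).
Qed.

Lemma kernel_semilin : semilin p' (id : kernel p -> I).
Proof.
move=> a x y; apply: ival_inj.
have valP (c : A) (u v : kernel p) :
    kernel_val (c *: u + v) = c * kernel_val u + kernel_val v :> A by [].
rewrite [LHS]valP [RHS](valP (j (p' a)) x y); congr (_ + _).
exact: ival_act.
Qed.

Lemma fg_I : fg_module I.
Proof.
have [m [v vP]] := fg_kernel p; exists m, v => x; have [c xc] := vP (x : kernel p).
exists (fun i => p' (c i)); rewrite [LHS]xc.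
rewrite -[LHS]/(id (\sum_i c i *: v i)) (semilin_sum kernel_semilin).
by apply: eq_bigr => i _; rewrite (semilinZ kernel_semilin).
Qed.

Lemma p_in_max a : (p a \in max_ideal R) = (a \in max_ideal A).
Proof. exact: local_max. Qed.

Lemma p'_in_max a : (p' a \in max_ideal R) = (a \in max_ideal A).
Proof. exact: local_max. Qed.

Lemma j_in_max x : (j x \in max_ideal A) = (x \in max_ideal R).
Proof. exact: local_max. Qed.

Section Generators.
Variables (yl : seq I).
Hypothesis yspan : forall x : I, exists c : nat -> R, x = \sum_(l < size yl) c l *: yl`_l.
Hypothesis ymin : forall c : nat -> R, \sum_(l < size yl) c l *: yl`_l = 0 ->
  forall l, (l < size yl)%N -> c l \in max_ideal R.
Local Notation ys := (map ival yl).
Local Notation sA := (ys ++ map j xs).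

Lemma ival_sum (c : nat -> R) :
  ival (\sum_(l < size yl) c l *: yl`_l) = \sum_(l < size yl) j (c l) * ys`_l.
Proof.
rewrite (semilin_sum ival_semilin); apply: eq_bigr => l _.
by rewrite (semilinZ ival_semilin) (nth_map 0).
Qed.

(** In a relation, the coefficients at xs are not units because p kills the
    generators of I. Subtracting elements of R from these coefficients turns the
    relation into one between generators of I, on which A acts through R. *)
Lemma sA_min_gens : min_gens sA.
Proof.
have szA : size sA = (size yl + n)%N by rewrite size_cat !size_map.
apply: min_gensI.
- move=> x; rewrite mem_cat => /orP[/mapP[y _ ->]|/mapP[y yx ->]].
    by rewrite -p_in_max p_ival max0.
  by rewrite j_in_max; apply: xs_max.
- apply: spans_maxP => a am; have [t0 tD tM] := ideal_gen_ideal sA.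
  rewrite -[a](subrK (j (p a))); apply: (tD).
    have [|x <-] := @ival_surj (a - j (p a)); first by rewrite rmorphB pj subrr.
    have [c ->] := yspan x; rewrite ival_sum.
    apply: is_ideal_sum => [|l _]; first exact: ideal_gen_ideal.
    by apply: (tM); apply: ideal_gen_mem; rewrite mem_cat mem_nth ?size_map.
  have pam : p a \in max_ideal R by rewrite p_in_max.
  have [b ->] := @xs_spans R _ pam; rewrite lincombE rmorph_sum.
  apply: is_ideal_sum => [|l _]; first exact: ideal_gen_ideal.
  rewrite rmorphM; apply: (tM); apply: ideal_gen_mem; rewrite mem_cat; apply/orP; right.
  by apply: map_f; apply: mem_nth.
- move=> b; rewrite szA -[size yl](size_map ival) lincomb_cat !lincombE size_map => b0.
  set b2 := drop (size yl) b in b0.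
  have [_ _ xi] := max_ideal_gensP R.
  have b2m (l : 'I_n) : b2`_l \in max_ideal A.
    rewrite -p_in_max; apply: (xi (fun l => p b2`_l)).
    have := congr1 p b0; rewrite rmorphD !rmorph_sum rmorph0 big1 ?add0r => [|i _]; last first.
      by rewrite rmorphM (nth_map 0) // p_ival mulr0.
    by move=> e; rewrite -[RHS]e; apply: eq_bigr => i _; rewrite rmorphM (nth_map 0) // pj.
  have b1m l : (l < size yl)%N -> b`_l \in max_ideal A.
    have /choice[x xE] (i : nat) : exists x : I, ival x = b2`_i - j (p b2`_i).
      by apply: ival_surj; rewrite rmorphB pj subrr.
    have /choice[c cE] (i : nat) := yspan (x i).
    pose d l := \sum_(i < n) c i l * xs`_i.
    have dm k : d k \in max_ideal R.
      by apply: max_sum => i _; apply: maxMl; apply: xs_max; apply: mem_nth.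
    move=> ly; suff : p' b`_l + d l \in max_ideal R.
      by move=> /maxD/(_ (maxN (dm l))); rewrite addrK p'_in_max.
    apply: (ymin (c := fun l => p' b`_l + d l)) => //; apply: ival_inj.
    rewrite (ival_sum (fun l => p' b`_l + d l)) (semilin0 ival_semilin) -[RHS]b0.
    under eq_bigr do rewrite rmorphD mulrDl.
    rewrite big_split /=; congr (_ + _).
      by apply: eq_bigr => k _; rewrite (nth_map 0) // -ival_act.
    have px0 : \sum_(i < n) j (p b2`_i) * j xs`_i = 0.
      have := congr1 (j \o p) b0; rewrite /= !rmorphD !rmorph_sum !rmorph0 big1 ?add0r => [|i _]; last first.
        by rewrite !rmorphM (nth_map 0) // p_ival rmorph0 mulr0.
      by move=> e; rewrite -[RHS]e; apply: eq_bigr => i _; rewrite !rmorphM (nth_map 0) // pj.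
    transitivity (\sum_(i < n) (b2`_i - j (p b2`_i)) * j xs`_i); last first.
      rewrite (eq_bigr (fun i : 'I_n => b2`_i * j xs`_i - j (p b2`_i) * j xs`_i)) => [|i _]; last first.
        exact: mulrBl.
      rewrite sumrB px0 subr0; apply: eq_bigr => i _; by rewrite (nth_map 0).
    under [RHS]eq_bigr do rewrite -xE cE ival_sum mulr_suml.
    rewrite exchange_big /=; apply: eq_bigr => k _.
    rewrite rmorph_sum mulr_suml; apply: eq_bigr => i _.
    by rewrite rmorphM mulrAC.
  move=> k kn; case: (ltnP k (size yl)) => [/b1m //|yk].
  have kn' : (k - size yl < n)%N by rewrite ltn_subLR.
  by have := b2m (Ordinal kn'); rewrite nth_drop subnKC.
Qed.

(** ** The Koszul complexes of R and I over A *)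

Local Notation r := (size yl).
Local Notation s0 := (nseq r 0 ++ xs).

Lemma sA_spans : spans_max (r + n) sA.
Proof. by have [_ + _] := sA_min_gens; rewrite size_cat !size_map. Qed.

Lemma s0_spans : spans_max (r + n) s0.
Proof. by apply: spans_max_cat; [rewrite size_nseq | exact: xs_spans]. Qed.

Lemma map_p_sA : map p sA = s0.
Proof.
rewrite map_cat -!map_comp; congr (_ ++ _); last first.
  by rewrite -[RHS]map_id; apply: eq_map => x /=; rewrite pj.
by elim: (yl) => //= y l ->; rewrite p_ival.
Qed.

Definition ycoefs : seq (seq R) :=
  [seq xget [::] [set b | p' (ival y) = lincomb b xs n] | y <- yl].

Lemma map_p'_sA : map p' sA = [seq lincomb b xs n | b <- ycoefs] ++ xs.
Proof.
rewrite map_cat -!map_comp; congr (_ ++ _); last first.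
  by rewrite -[RHS]map_id; apply: eq_map => x /=; rewrite p'j.
apply: eq_map => y /=; case: xgetP => [b _ //|nob].
have [|b yb] := @xs_spans R (p' (ival y)); last by case: (nob b).
by rewrite p'_in_max -p_in_max p_ival max0.
Qed.

(** p maps the generators of I to zeros. *)
Lemma kh_restrict_A (N : lmodType R) i : fg_module N ->
  kh (restrict_scalars p N) (r + n) sA i = bsum r (kh N n xs) i.
Proof.
move=> fgN; rewrite -(kh_layers r i fgN (@xs_spans R)) -map_p_sA; apply/esym.
have fl : semilin p (id : restrict_scalars p N -> N) by [].
have idK : cancel (id : restrict_scalars p N -> N) id by [].
have Kid : cancel id (id : restrict_scalars p N -> N) by [].
exact: (kh_semilin (retract_surj pj) p_local (fg_restrict pj fgN) fl idK Kid i sA_spans).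
Qed.

(** p' maps the generators of I to elements of the maximal ideal of R, which kth
    replaces by zeros. *)
Lemma kh_kernel_A i : kh (kernel p) (r + n) sA i = bsum r (kh I n xs) i.
Proof.
have := kh_kth ycoefs i fg_I (@xs_spans R); rewrite -map_p'_sA size_map => <-.
have idK : cancel (id : kernel p -> I) id by [].
have Kid : cancel id (id : kernel p -> I) by [].
apply/esym; exact: (kh_semilin (retract_surj p'j) p'_local (fg_kernel p) kernel_semilin idK Kid i sA_spans).
Qed.

Definition pA : A^o -> restrict_scalars p R^o := p.

Lemma pA_lin : lin pA.
Proof. by move=> a x y; rewrite /pA rmorphD rmorphM. Qed.

(** The dimension of the image of H_i(A) in H_i(R), both over A. *)
Definition imgA_dim i := kimg_dim pA (r + n) sA i.

Lemma koszul_les_A i :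
  (bsum r (kh I n xs) i + imgA_dim (i + 1) + imgA_dim i =
   bsum r (kh R^o n xs) (i + 1) + kh A^o (r + n) sA i)%N.
Proof.
rewrite -kh_kernel_A -(kh_restrict_A _ (fg_regular R)).
apply: (@koszul_les A (kernel p) A^o (restrict_scalars p R^o) (@kernel_val _ _ p) pA).
- exact: fg_kernel.
- exact: fg_regular.
- exact: (fg_restrict pj (fg_regular R)).
- by [].
- exact: pA_lin.
- exact: val_inj.
- by move=> x; exists (j x); rewrite /pA pj.
- by move=> x; apply: (p_ival (x : I)).
- by move=> a /ival_surj[x <-]; exists (x : kernel p).
- exact: sA_spans.
Qed.

Definition pR : A^o -> R^o := p.
Definition jA : R^o -> A^o := j.

(** Chains over R that lift to cycles over A. *)
Definition liftA i : set (kch (r + n) R^o) :=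
  [set v | exists2 w : kch (r + n) A^o, kcyc (r + n) sA i w & v = kmap pR w].

Lemma p_semilin : semilin p pR.
Proof. by move=> a x y; rewrite /pR rmorphD rmorphM. Qed.

Lemma j_semilin : semilin j jA.
Proof. by move=> a x y; rewrite /jA rmorphD rmorphM. Qed.

Lemma kmap_pj (v : kch (r + n) R^o) : kmap pR (kmap jA v) = v.
Proof. by rewrite kmap_comp -[RHS]kmap_id; apply: kmap_ext => x; rewrite /= /pR /jA pj. Qed.

Lemma liftA_submod i : submod (liftA i).
Proof.
exact: (semilin_image (kmap_lin p_semilin (n := r + n)) (retract_surj pj) (kcyc_submod _ _ _)).
Qed.

Lemma liftA_cyc i : liftA i `<=` kcyc (r + n) s0 i.
Proof.
move=> _ [w [dw cw] ->]; split; first exact: (kmap_deg p_semilin).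
by rewrite -map_p_sA -(kmap_kd p_semilin) cw (semilin0 (kmap_lin p_semilin (n := _))).
Qed.

Lemma kbnd_liftA i : kbnd (r + n) s0 i `<=` liftA i.
Proof.
move=> _ [w dw ->]; exists (kd sA (kmap jA w)).
  by apply: kbnd_cyc; exists (kmap jA w) => //; apply: (kmap_deg j_semilin).
by rewrite (kmap_kd p_semilin) map_p_sA kmap_pj.
Qed.

Lemma imgA_dimE i : imgA_dim i = residue_dim (liftA i) (kbnd (r + n) s0 i).
Proof.
have fl : semilin p (id : restrict_scalars p R^o -> R^o) by [].
have fgA := fg_restrict pj (fg_regular R).
have pE (w : kch (r + n) A^o) : kmap (id : restrict_scalars p R^o -> R^o) (kmap pA w) = kmap pR w.
  by rewrite kmap_comp.
apply/esym/(residue_dim_iso (retract_surj pj) p_local (fg_kch _ fgA) (kmap_lin fl (n := r + n))).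
- have [_ _ _ mZ] := kcyc_kspace (restrict_scalars p R^o) i sA_spans.
  split; [exact: (kimg_submod (r + n) sA pA_lin i) | exact: kbnd_submod | |].
    by apply: kbnd_kimg; [exact: pA_lin | move=> x; exists (j x); rewrite /pA pj].
  by move=> a z am /(kimg_cyc pA_lin) cz; apply: mZ.
- exact: kbnd_submod.
- by move=> _ [w cw ->]; exists w; rewrite ?pE.
- move=> z _; rewrite -map_p_sA; apply: iff_sym.
  exact: (kmap_bij_bnd fl (fun _ => erefl) (fun _ => erefl) sA i z).
- move=> _ [w cw ->]; exists (kmap pA w); first by exists w.
  by rewrite pE subrr; apply: submod0 (kbnd_submod _ _ _).
Qed.

Definition kpos_dim (i : int) : nat := if 0 < i then kh R^o n xs i else 0%N.

(** A cycle over A of positive degree has its coefficients in the maximal ideal,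
    so that its image over R has no component along H_0(R). *)
Lemma imgA_dim_le i : 0 < i -> (imgA_dim i <= bsum r kpos_dim i)%N.
Proof.
move=> i0; rewrite imgA_dimE.
pose Z a : set (kch n R^o) := if 0 < a then kcyc n xs a else kbnd n xs a.
have kZ a : kspace (Z a) (kbnd n xs a).
  have [sZ sB BZ mZ] := kcyc_kspace R^o a (@xs_spans R).
  by rewrite /Z; case: ifP => _; split=> // b z _; apply: submodZ.
have [kZr <-] : kspace (kall r Z i) (kall r (fun a => kbnd n xs a) i) /\
    residue_dim (kall r Z i) (kall r (fun a => kbnd n xs a) i) = bsum r kpos_dim i.
  have [k ->] := kall_dim r (fg_regular R) kZ i; split=> //.
  apply: bsum_ext => a; rewrite /Z /kpos_dim; case: ifP => // _.
  exact/residue_dimxx/kbnd_submod.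
rewrite -kbnd_layers in kZr *.
apply: (residue_dim_sub (fg_kch _ (fg_regular R)) kZr (liftA_submod i) (@kbnd_liftA i)).
move=> v Cv; have := liftA_cyc Cv; rewrite kcyc_layers.
have {Cv} : kco (fun x : R^o => (x : R) \in max_ideal R) v.
  case: Cv => w cw ->.
  have cwm : kco (fun x : A^o => (x : A) \in max_ideal A) w.
    have mA := sA_min_gens; have sz : size sA = (r + n)%N by rewrite size_cat !size_map.
    have := @cycle_coef_max A sA i; rewrite sz; exact.
  by apply: kmap_co cwm => x; rewrite -p_in_max.
elim: r i {i0} v {kZr} => [|q IH] a v /=; last first.
  by move=> [m1 m2] [z1 z2]; split; apply: IH.
rewrite /Z; case: ltP => // a0 vm [dv _].
have [a00|an0] := eqVneq a 0; last first.
  have al : a < 0 by rewrite lt_neqAle an0.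
  by rewrite (kdeg_lt0 al dv); apply: submod0 (kbnd_submod _ _ _).
rewrite a00 in dv *; have [x xv] := kinj_surj dv.
have xE : forall k (x : R^o), kinj k x = (x : R) *: kunit R k.
  elim=> [|k IHk] y /=; first by rewrite [RHS]mulr1.
  by rewrite IHk; apply: kpairP; rewrite kchE //= scaler0.
rewrite -xv xE; have [_ _ _ mZ] := kcyc_kspace R^o 0 (@xs_spans R); apply: mZ.
  by move: vm; rewrite -xv; elim: (n) => //= k IHk [/IHk].
by split; [exact: kunit_deg | exact: kd_unit].
Qed.

(** ** The connecting map on products *)

Lemma kmap_scale_ival k (y : I) (c : kch k R^o) :
  (ival y : A) *: kmap jA c = kmap ival (kmap (fun x : R^o => (x : R) *: y) c).
Proof.
elim: k c => [|k IH] c /=; first by rewrite [RHS](semilinZ ival_semilin) [LHS]mulrC.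
by apply: kpairP; rewrite kchE /= IH.
Qed.

(** The generators of I act on chains of A lifted from R through the values
    kdy in I, whence the connecting map of 0 -> I -> A -> R -> 0. *)
Lemma kd_lift_A q (l : seq I) (v : kch (q + n) R^o) : size l = q ->
  kd (map ival l ++ map j xs) (kmap jA v) =
  kmap jA (kd (nseq q 0 ++ xs) v) + kmap ival (kdy l v).
Proof.
have jl q' := kmap_lin j_semilin (n := q').
have il q' := kmap_lin ival_semilin (n := q').
elim: q l v => [|q IH] [|y l] v //=.
  by move=> _; rewrite (kmap_kd j_semilin) (semilin0 (il n)) addr0.
move=> [lq]; rewrite !IH // scale0r addr0; apply: kpairP; rewrite !kchE /=.
  rewrite (semilinD (il (q + n)%N)) addrA; congr (_ + _).
  exact: kmap_scale_ival.
by rewrite (semilinN (jl (q + n)%N)) (semilinN (il (q + n)%N)) opprD.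
Qed.

Lemma kd_ival k (t : seq A) (w : kch k I) :
  kd t (kmap ival w) = kmap ival (kd (map p' t) w).
Proof.
have il q := kmap_lin ival_semilin (n := q).
elim: k t w => [|k IH] t w /=; first exact/esym/(semilin0 ival_semilin).
apply: kpairP => /=; last by rewrite (semilinN (il k)) IH behead_map.
rewrite (semilinD (il k)) IH behead_map; congr (_ + _).
have -> : head 0 (map p' t) = p' (head 0 t) by case: (t) => //=; rewrite rmorph0.
elim: k {IH w} w.2 => [|k IHk] c /=.
  by rewrite [RHS](semilinZ ival_semilin) [LHS]ival_act.
by apply: kpairP; rewrite kchE /= IHk.
Qed.

(** The connecting map, followed by the change of generators kth to s0. *)
Local Notation conn v := (kth ycoefs (kdy yl v)).

Lemma kmap_ival_inj k : injective (@kmap R A I A^o ival k).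
Proof. exact: kmap_inj ival_inj. Qed.

(** The connecting map commutes with right multiplication by cycles of R, so
    that products go to products; it vanishes on the component at the set of all
    of the generators of I, since kdy removes one of them. *)
Lemma conn_kpos i (v : kch (r + n) R^o) : kall r (kpos xs) i v ->
  knt r (fun a => kprod n xs a) (fun a => kbnd n xs a) (i - 1) (conn v).
Proof.
have sP a : submod (kprod n xs a : set (kch n I)) by exact: kprod_submod.
have sB a : submod (kbnd n xs a : set (kch n I)) by exact: kbnd_submod.
have kp a : kspace (kprod n xs a : set (kch n I)) (kbnd n xs a) by apply: kprod_kspace; exact: xs_spans.
have sK : submod (knt r (fun a => kprod n xs a : set (kch n I)) (fun a => kbnd n xs a) (i - 1)).
  by have [[]] := knt_dim r fg_I kp (i - 1).
have cl : lin (fun v : kch (r + n) R^o => conn v).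
  by move=> c x y; rewrite kdy_lin kth_lin.
apply: (@kpos_ind R n xs r (fun v => knt r _ _ (i - 1) (conn v))).
  exact: (semilin_preim cl sK).
move=> b a u z a0 ab Uu Zz; rewrite kdy_klr kth_klr.
apply: kall_knt => //; last by rewrite -kth_klr -kdy_klr ktop_kth kdy_top.
have [du cu] : kcyc (r + n) s0 b u.
  by rewrite kcyc_layers; apply: kall_sub Uu => c; apply: kscal_cyc.
apply: (@kall_klr _ _ _ _ r (b - 1) a) => //; first by rewrite addrAC ab.
rewrite -kcyc_layers; split; first by apply: kth_deg; apply: kdy_deg.
rewrite kth_kd ?size_map // -map_p'_sA (_ : kd _ _ = 0) ?(semilin0 (@kth_lin _ _ _ _ _)) //.
apply: kmap_ival_inj; rewrite -kd_ival (semilin0 (kmap_lin ival_semilin (n := _))).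
have := kd_lift_A u erefl; rewrite cu (semilin0 (kmap_lin j_semilin (n := _))) add0r => <-.
by rewrite kdd.
Qed.

(** When conn v is a boundary, kdy yl v is the boundary of a chain w of I, and
    j v - w is a cycle of A lifting v. *)
Lemma conn_bnd_lift i (v : kch (r + n) R^o) : kcyc (r + n) s0 i v ->
  kbnd (r + n) s0 (i - 1) (conn v) -> liftA i v.
Proof.
move=> [dv cv] [w0 dw0 cw0]; rewrite subrK in dw0.
have [w dw w0E] := kth_surj ycoefs dw0; subst w0.
have {cw0} yE : kdy yl v = kd (map p' sA) w.
  by apply: (kth_inj (bs := ycoefs)); rewrite cw0 kth_kd ?size_map // map_p'_sA.
exists (kmap jA v - kmap ival w); last first.
  rewrite (semilinB (kmap_lin p_semilin (n := _))) kmap_pj (_ : kmap pR _ = 0) ?subr0 //.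
  elim: (r + n)%N (w) => [|k IH] c /=; first exact: p_ival.
  by apply: kpairP => /=; apply: IH.
split.
  apply: submodB (kdeg_submod _ _) _ _; first exact: (kmap_deg j_semilin).
  exact: (kmap_deg ival_semilin).
rewrite kdB kd_ival (kd_lift_A v erefl) cv (semilin0 (kmap_lin j_semilin (n := _))) add0r.
by rewrite yE subrr.
Qed.

(** On families of cycles of positive degree, the kernel of the connecting map
    consists of liftable cycles, and its values are bounded by conn_kpos. *)
Lemma imgA_dim_ge i :
  (bsum r kpos_dim i <= imgA_dim i + knt_sum r (kq I n xs) (i - 1))%N.
Proof.
have fgR := fg_regular R; have fgRn := fg_kch (r + n) fgR; have fgIn := fg_kch (r + n) fg_I.
have kp a := kpos_kspace (@xs_spans R) a.
have [kE dE] := kall_dim r fgR kp i.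
have {dE} <- : residue_dim (kall r (@kpos R n xs) i) (kall r (@kposb R n xs) i) = bsum r kpos_dim i.
  rewrite dE; apply: bsum_ext => a; rewrite /kpos /kposb /kpos_dim; case: ifP => // _.
  exact/residue_dimxx/submod_set0.
have Ecyc : kall r (@kpos R n xs) i `<=` kcyc (r + n) s0 i.
  rewrite kcyc_layers; apply: kall_sub => a v; rewrite /kpos; case: ifP => // _ ->.
  exact: submod0 (kcyc_submod _ _ _).
have Bbnd : kall r (@kposb R n xs) i `<=` kbnd (r + n) s0 i.
  rewrite kbnd_layers; apply: kall_sub => a v; rewrite /kposb; case: ifP => // _ ->.
  exact: submod0 (kbnd_submod _ _ _).
have sE : submod (kall r (@kpos R n xs) i) by case: kE.
pose EC : set (kch (r + n) R^o) := kall r (@kpos R n xs) i `&` liftA i.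
have sEC : submod EC by apply: submodI => //; exact: liftA_submod.
have BEC : kall r (@kposb R n xs) i `<=` EC.
  by move=> v Bv; split; [case: kE => _ _ + _; apply | apply/kbnd_liftA/Bbnd].
have ECE : EC `<=` kall r (@kpos R n xs) i by move=> v [].
rewrite (residue_dim_add fgRn kE sEC BEC ECE) addnC; apply: leq_add.
  rewrite imgA_dimE; apply: (residue_dim_le (f := id) fgRn fgRn).
  - by [].
  - by have [] := kspace_split kE sEC BEC ECE.
  - have [_ _ _ mZ] := kcyc_kspace R^o i s0_spans.
    split; [exact: liftA_submod | exact: kbnd_submod | exact: kbnd_liftA |].
    by move=> a z am /liftA_cyc cz; apply: mZ.
  - by move=> v [].
  - move=> v [+ _]; rewrite kbnd_layers.
    elim: (r) i v {kE sE EC sEC BEC ECE Ecyc Bbnd} => [|q IH] a v /=.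
      by rewrite /kpos /kposb; case: ifP.
    by move=> [e1 e2] [b1 b2]; split; apply: IH.
have kq' a : kspace (kprod n xs a : set (kch n I)) (kbnd n xs a) by apply: kprod_kspace; exact: xs_spans.
have [kK dK] := knt_dim r fg_I kq' (i - 1); rewrite -[knt_sum _ _ _]dK.
apply: (residue_dim_le (f := fun v => conn v) fgRn fgIn) => //.
- by move=> c x y; rewrite kdy_lin kth_lin.
- by have [] := kspace_split kE sEC BEC ECE.
- exact: conn_kpos.
- move=> v Ev; rewrite -kbnd_layers => Bv; split=> //.
  by apply: conn_bnd_lift => //; apply: Ecyc.
Qed.

End Generators.

End Retract.

(** * Golod modules over the retract *)

(** ** Koszul series *)

Lemma knt_sum_lt0 r (f : int -> nat) (i : int) :
  (forall k : int, k < 0 -> f k = 0%N) -> i < 0 -> knt_sum r f i = 0%N.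
Proof.
move=> f0; elim: r i => [//|r IH] i i0 /=.
by rewrite bsum_lt0 // IH // subr_lt0 (lt_trans i0).
Qed.

Lemma knt_sum_ps r (f : int -> nat) : (forall k : int, k < 0 -> f k = 0%N) ->
  PS (fun i => (knt_sum r f i)%:Z) =
  ((1 + pst) ^+ r - pst ^+ r) * PS (fun i => (f i)%:Z).
Proof.
move=> f0; elim: r => [|r IH].
  by rewrite subrr mul0r; apply: psP => i; rewrite psc0.
transitivity ((1 + pst) ^+ r * PS (fun i => (f i)%:Z) +
    pst * (((1 + pst) ^+ r - pst ^+ r) * PS (fun i => (f i)%:Z))); last first.
  by rewrite !exprS; ring.
rewrite -IH -bsum_ps //; apply: psP => -[|i]; rewrite pscD psc_tM /= PoszD.
  by rewrite knt_sum_lt0 //; lia.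
by rewrite (_ : i.+1%:Z - 1 = i) //; lia.
Qed.

Lemma psge0_onetB r : psge0 ((1 + pst) ^+ r - pst ^+ r).
Proof.
elim: r => [|r IH]; first by rewrite subrr => i; rewrite psc0.
rewrite (_ : _ - _ = (1 + pst) ^+ r + pst * ((1 + pst) ^+ r - pst ^+ r)); last first.
  by rewrite !exprS; ring.
apply: psge0D; first exact: (psge0X _ psge0_onet).
exact: (psge0M psge0_t IH).
Qed.

Lemma kh_regular0 (R : noethLocalRingType) :
  kh R^o (size (max_ideal_gens R)) (max_ideal_gens R) 0 = 1%N.
Proof.
apply: (@kh_cover0 R R^o 1 (fun u => u 0 0)).
- by move=> a u v; rewrite !mxE.
- by move=> x; exists (\row_i x); rewrite mxE.
- by move=> u u0 i; rewrite ord1 u0 max0.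
Qed.

Lemma minimal_gens_seq (R : noethLocalRingType) (M : lmodType R) : fg_module M -> exists yl : seq M,
  (forall x : M, exists c : nat -> R, x = \sum_(l < size yl) c l *: yl`_l) /\
  (forall c : nat -> R, \sum_(l < size yl) c l *: yl`_l = 0 ->
     forall l, (l < size yl)%N -> c l \in max_ideal R).
Proof.
move=> fgM; have [b [g [gl gs gk]]] := minimal_cover fgM.
exists [seq g (delta_mx 0 k) | k <- enum 'I_b].
have gE (c : nat -> R) : \sum_(l < size [seq g (delta_mx 0 k) | k <- enum 'I_b])
    c l *: [seq g (delta_mx 0 k) | k <- enum 'I_b]`_l = g (\row_(k < b) c k).
  rewrite -(big_mkord xpredT (fun l => c l *: [seq g (delta_mx 0 k) | k <- enum 'I_b]`_l)).
  rewrite size_map size_enum_ord big_mkord [X in _ = g X]row_sum_delta (semilin_sum gl).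
  apply: eq_bigr => k _; rewrite (nth_map k) ?size_enum_ord // nth_ord_enum.
  by rewrite (semilinZ gl) mxE.
split=> [x|c].
  have [u <-] := gs x; pose c l := if insub l is Some k then u 0 k else 0.
  by exists c; rewrite gE; congr g; apply/rowP => k; rewrite mxE /c valK.
rewrite gE => /gk um l; rewrite size_map size_enum_ord => lb.
by have := um (Ordinal lb); rewrite mxE.
Qed.

Section RetractKoszul.
Variables (R A : noethLocalRingType) (j : {rmorphism R -> A}) (p p' : {rmorphism A -> R}).
Hypotheses (j_local : local_hom j) (p_local : local_hom p) (p'_local : local_hom p').
Hypotheses (pj : cancel j p) (p'j : cancel j p').
Hypothesis II'0 : forall (x : kernel p) (y : kernel p'), kernel_val x * kernel_val y = 0 :> A.
Local Notation I := (restrict_scalars j (kernel p)).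
Local Notation xs := (max_ideal_gens R).
Local Notation n := (size xs).
Let fgI : fg_module I := fg_I p'j II'0.

(** The series t s counts the classes of H_+(R), over A, that do not lift to A;
    the exact sequence 0 -> I -> A -> R -> 0 determines kappa_A from it. *)
Lemma retract_koszul : exists r (s : ps),
  [/\ psge0 s,
      psge0 (((1 + pst) ^+ r - pst ^+ r) * defect_ps I - s),
      denom_ps A = (1 + pst) ^+ r * (denom_ps R - pst * koszul_ps I) + pst * (1 + pst) * s
    & forall N : lmodType R, fg_module N ->
        koszul_ps (restrict_scalars p N) = (1 + pst) ^+ r * koszul_ps N].
Proof.
have [yl [yspan ymin]] := minimal_gens_seq fgI.
have fgR := fg_regular R; have fgA := fg_regular A.
have sAm := sA_min_gens j_local p_local p'_local pj p'j II'0 yspan ymin.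
have szA : size (map (@ival _ _ j p) yl ++ map j xs) = (size yl + n)%N.
  by rewrite size_cat !size_map.
set sA := _ ++ _ in sAm szA; set r := size yl.
pose im i := imgA_dim yl i.
have les i : (bsum r (kh I n xs) i + im (i + 1)%R + im i =
    bsum r (kh R^o n xs) (i + 1)%R + kh A^o (r + n) sA i)%N.
  exact: (koszul_les_A j_local p_local p'_local pj p'j II'0 yspan ymin i).
have kR0 (k : int) : k < 0 -> kh R^o n xs k = 0%N by exact: kh_lt0.
have kI0 (k : int) : k < 0 -> kh I n xs k = 0%N by exact: kh_lt0.
have kA0 (k : int) : k < 0 -> kh A^o (r + n) sA k = 0%N by exact: kh_lt0.
have kq0 (k : int) : k <= 0 -> kq I n xs k = 0%N.
  move=> k0; rewrite /kq (_ : kprod n xs k = kbnd n xs k).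
    exact/residue_dimxx/kbnd_submod.
  by apply/seteqP; split; [exact: kprod_le0 | exact: kbnd_kprod].
have im_1 : im (-1) = 0%N.
  have := les (-1 - 1); rewrite subrK (bsum_lt0 _ kR0) // kA0 // => /eqP.
  by rewrite !addn_eq0 => /andP[/andP[_ /eqP]].
have im0 : im 0 = bsum r (kh R^o n xs) 0.
  by have := les (-1); rewrite addNr (bsum_lt0 _ kI0) // kA0 // im_1 addn0 add0n addn0.
pose kR := koszul_ps R^o; pose kI := koszul_ps I; pose T := PS (fun i => (im i)%:Z).
have kRE : kR = PS (fun i => (kh R^o n xs i)%:Z).
  by apply: psP => i; rewrite koszul_psE.
have kIE : kI = PS (fun i => (kh I n xs i)%:Z).
  by apply: psP => i; rewrite koszul_psE.
have kAE (V : lmodType A) i : fg_module V -> psc (koszul_ps V) i = kh V (r + n) sA i.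
  by move=> fgV; rewrite /= (koszul_dimE i fgV sAm) szA.
have lesE : pst * ((1 + pst) ^+ r * kI) + (1 + pst) * T =
    (1 + pst) ^+ r * kR + pst * koszul_ps A^o.
  rewrite kRE kIE -!bsum_ps //; apply: psP => -[|i]; rewrite !pscD psc_onetM !psc_tM.
    by rewrite add0r !addr0 /= im0.
  rewrite kAE //=; have := les i; rewrite (_ : i%:Z + 1 = i.+1); last by lia.
  by move=> e; apply/eqP; rewrite -!PoszD eqz_nat addnA e.
(* eA counts the part of H(R), over A, without component along H_0(R) *)
pose eA := (1 + pst) ^+ r * (kR - 1).
have eAE : eA = PS (fun i => (bsum r (kpos_dim R) i)%:Z).
  rewrite /eA bsum_ps; last by move=> k k0; rewrite /kpos_dim ltNge (ltW k0).
  congr (_ * _); rewrite kRE; apply: psP => -[|i]; rewrite pscB psc1 /kpos_dim /=.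
    by rewrite kh_regular0.
  by rewrite subr0.
pose s := PS (fun i => psc eA i.+1 - psc T i.+1).
have sE : pst * s = eA - T + 1.
  apply: psP => -[|i]; rewrite psc_tM pscD pscB psc1; last by rewrite addr0.
  have -> : psc eA 0 = 0.
    rewrite eAE /=; elim: (r) => [|q IH] /=; first by rewrite /kpos_dim ltxx.
    rewrite PoszD IH (bsum_lt0 _ (f := kpos_dim R)) //.
    by move=> k k0; rewrite /kpos_dim ltNge (ltW k0).
  have -> : psc T 0 = 1.
    rewrite /= im0; have -> // : bsum r (kh R^o n xs) 0 = 1%N.
    elim: (r) => [|q IH] /=; first exact: kh_regular0.
    by rewrite IH (bsum_lt0 _ kR0).
  by rewrite sub0r addNr.
exists r, s; split.
- move=> i; rewrite (_ : psc s i = psc eA i.+1 - psc T i.+1) // eAE subr_ge0 lez_nat.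
  exact: (imgA_dim_le j_local p_local p'_local pj p'j II'0 yspan ymin).
- have wE : PS (fun i => (knt_sum r (kq I n xs) i)%:Z) =
      ((1 + pst) ^+ r - pst ^+ r) * PS (fun i => (kq I n xs i)%:Z).
    by apply: knt_sum_ps => k k0; rewrite kq0 // ltW.
  rewrite (_ : _ - s = ((1 + pst) ^+ r - pst ^+ r) *
      (defect_ps I - PS (fun i => (kq I n xs i)%:Z)) +
      (PS (fun i => (knt_sum r (kq I n xs) i)%:Z) - s)); last by rewrite wE; ring.
  apply: psge0D; first apply: psge0M.
  + exact: psge0_onetB.
  + by move=> i; rewrite pscB subr_ge0; apply: kq_le_defect.
  + move=> i; rewrite pscB (_ : psc s i = psc eA i.+1 - psc T i.+1) // eAE.
    rewrite [psc _ i](_ : _ = (knt_sum r (kq I n xs) i)%:Z) // ![psc _ i.+1]/=.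
    have := imgA_dim_ge j_local p_local p'_local pj p'j II'0 yspan ymin i.+1.
    rewrite -/r -/(im _) (_ : i.+1%:Z - 1 = i); last by lia.
    by move: (knt_sum _ _ _) => w; lia.
- have kAsol : pst * koszul_ps A^o = pst * ((1 + pst) ^+ r * kI) + (1 + pst) * T - (1 + pst) ^+ r * kR.
    by rewrite lesE; ring.
  have Tsol : T = eA + 1 - pst * s by rewrite sE; ring.
  rewrite {1}/denom_ps mulrBr kAsol Tsol /eA /denom_ps -/kR -/kI; ring.
- move=> N fgN; apply: psP => i; rewrite kAE; last exact: (fg_restrict pj fgN).
  rewrite (kh_restrict_A j_local p_local p'_local pj p'j II'0 yspan ymin) //.
  rewrite (_ : koszul_ps N = PS (fun i => (kh N n xs i)%:Z)).
    by rewrite -bsum_ps // => k; apply: kh_lt0.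
  by apply: psP => l; rewrite koszul_psE.
Qed.

End RetractKoszul.

(** ker p and ker p' are complements of j R in A, both isomorphic to A / j R: the
    projection along j R takes one to the other. *)
Section KernelSwap.
Variables (R A : noethLocalRingType) (j : {rmorphism R -> A}).

Definition kernel_swap (p p' : {rmorphism A -> R}) (x : restrict_scalars j (kernel p)) :
    restrict_scalars j (kernel p') :=
  insubd (0 : kernel p') (ival x - j (p' (ival x))).

Variables (p p' : {rmorphism A -> R}).
Hypotheses (pj : cancel j p) (p'j : cancel j p').

Lemma ival_swap x : ival (kernel_swap p' x) = ival (x : restrict_scalars j (kernel p)) - j (p' (ival x)).
Proof. by apply: (insubdK (0 : kernel p')); rewrite inE rmorphB p'j subrr. Qed.

Lemma kernel_swap_lin : lin (kernel_swap (p := p) p').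
Proof.
move=> a x y; apply: ival_inj.
rewrite ival_swap !(ival_semilin a) !ival_swap rmorphD !rmorphM rmorphD rmorphM p'j.
have e (b u v u' v' : A) : b * u + v - (b * u' + v') = b * (u - u') + (v - v') by ring.
exact: e.
Qed.

End KernelSwap.

Lemma kernel_swapK (R A : noethLocalRingType) (j : {rmorphism R -> A}) (p p' : {rmorphism A -> R}) :
  cancel j p -> cancel j p' -> cancel (kernel_swap (j := j) (p := p) p') (kernel_swap p).
Proof.
move=> pj p'j x; apply: ival_inj; rewrite ival_swap // ival_swap // rmorphB p_ival pj sub0r.
by rewrite rmorphN opprK subrK.
Qed.

(** ** Poincare series *)

Section RetractGolod.
Variables (R A : noethLocalRingType) (j : {rmorphism R -> A}) (p p' : {rmorphism A -> R}).
Hypotheses (j_local : local_hom j) (p_local : local_hom p) (p'_local : local_hom p').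
Hypotheses (pj : cancel j p) (p'j : cancel j p').
Hypothesis II'0 : forall (x : kernel p) (y : kernel p'), kernel_val x * kernel_val y = 0 :> A.
Local Notation I := (restrict_scalars j (kernel p)).
Local Notation I' := (restrict_scalars j (kernel p')).

Lemma II'0_sym (y : kernel p') (x : kernel p) : kernel_val y * kernel_val x = 0 :> A.
Proof. by rewrite [LHS](mulrC (kernel_val y : A)) II'0. Qed.

Let fgI : fg_module I := fg_I p'j II'0.
Let fgI' : fg_module I' := fg_I pj II'0_sym.

Lemma golod_kernels : golod I <-> golod I'.
Proof.
apply: (golod_iso fgI' fgI (kernel_swap_lin pj)); exact: kernel_swapK.
Qed.

Lemma betti_kernels : betti_ps I' = betti_ps I.
Proof.
apply: psP => i; congr Posz.
exact: (tor_dim_iso i fgI (kernel_swap_lin p'j) (kernel_swapK pj p'j) (kernel_swapK p'j pj)).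
Qed.

Lemma betti_restrict (q : {rmorphism A -> R}) (N : lmodType R) :
  cancel j q -> fg_module N ->
  betti_ps (restrict_scalars q N) = betti_ps N * betti_ps (restrict_scalars q R^o).
Proof.
move=> qj fgN; apply: psP => i; rewrite pscM /= (tor_dim_restrict j_local qj) //.
by rewrite -[LHS]natz natr_sum; apply: eq_bigr => k _; rewrite natz PoszM.
Qed.

Lemma betti_retract (q : {rmorphism A -> R}) : cancel j q ->
  betti_ps (restrict_scalars q R^o) = 1 + pst * betti_ps (kernel q).
Proof.
move=> qj; apply: psP => i; rewrite pscD psc1 psc_tM [LHS]/=.
by rewrite (tor_dim_retract qj); case: i => [|i]; rewrite ?addr0 ?add0r.
Qed.

(** Since I I' = 0, the A-module I is the R-module I restricted along p'. *)
Lemma betti_kernel : betti_ps (kernel p) = betti_ps (restrict_scalars p' I).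
Proof.
apply/esym/psP => i; congr Posz.
have idK : cancel (id : kernel p -> restrict_scalars p' I) id by [].
apply: (tor_dim_iso i (fg_kernel p) _ idK) => //; exact: (kernel_semilin p'j II'0).
Qed.

End RetractGolod.

(** ** Golod modules *)

Section RetractTheorem.
Variables (R A : noethLocalRingType) (j : {rmorphism R -> A}) (p p' : {rmorphism A -> R}).
Hypotheses (j_local : local_hom j) (p_local : local_hom p) (p'_local : local_hom p').
Hypotheses (pj : cancel j p) (p'j : cancel j p').
Hypothesis II'0 : forall (x : kernel p) (y : kernel p'), kernel_val x * kernel_val y = 0 :> A.
Local Notation I := (restrict_scalars j (kernel p)).
Local Notation I' := (restrict_scalars j (kernel p')).
Let II'0s := II'0_sym II'0.
Let fgI : fg_module I := fg_I p'j II'0.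
Let fgI' : fg_module I' := fg_I pj II'0s.

(** Let G and G' be the Poincare series of R over A through p and p'. The
    syzygies I and I' are restrictions along p' and p, whence G = 1 + t P_I G'
    and G' = 1 + t P_I G; subtracting, G = G'. *)
Lemma betti_retract_inv : betti_ps (restrict_scalars p R^o) * (1 - pst * betti_ps I) = 1.
Proof.
set G := betti_ps _; pose G' := betti_ps (restrict_scalars p' R^o); set P := betti_ps I.
have GE : G = 1 + pst * (P * G').
  by rewrite /G (betti_retract pj) (betti_kernel p'j II'0) (betti_restrict j_local p'j fgI).
have G'E : G' = 1 + pst * (P * G).
  rewrite /G' (betti_retract p'j) (betti_kernel pj II'0s) (betti_restrict j_local pj fgI').
  by rewrite (betti_kernels pj p'j II'0).
have GG' : G - G' = 0.
  apply: (@ps_mulI0 _ (1 + pst * P)).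
    by rewrite pscD psc1 psc_tM.
  by rewrite mulrDr mulr1 {1}GE {2}G'E; ring.
have {}GG' : G' = G by apply/esym/eqP; rewrite -subr_eq0 GG'.
by rewrite mulrBr mulr1 {1}GE GG'; ring.
Qed.

(** With X = (1 + t)^r S_I - s for the series s of retract_koszul, N is Golod over
    A if and only if S_N D_A + t X kappa_N = 0. Both terms being nonnegative at
    their lowest degrees, this means S_N = 0 and X = 0, and t^r S_I <= X. *)
Lemma golod_restrict (N : lmodType R) : fg_module N -> nonzero_module N ->
  golod (restrict_scalars p N) <-> golod N /\ golod I.
Proof.
move=> fgN N0.
have [r [s [s0 s_le DA KA]]] := retract_koszul j_local p_local p'_local pj p'j II'0.
rewrite (golodE (fg_restrict pj fgN)) KA // (betti_restrict j_local pj fgN).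
rewrite (golod_defect fgN) (golod_defect fgI).
have := betti_retract_inv; set G := betti_ps (restrict_scalars p R^o) => GP.
have SN := defectE N; have SI := defectE I.
have [SN0 SI0] := (defect_ge0 fgN, defect_ge0 fgI).
have /andP[kN0 _] := tor_dim0_gt0 fgN N0.
set P := betti_ps I in GP SI; set PN := betti_ps N in SN *.
set D := denom_ps R in SN SI DA; set DA' := denom_ps A in DA *.
set kN := koszul_ps N in SN kN0 *; set kI := koszul_ps I in SI DA.
set dN := defect_ps N in SN SN0 *; set dI := defect_ps I in SI SI0 s_le *.
pose X := (1 + pst) ^+ r * dI - s.
have D0 : psc D 0 = 1 by rewrite /D pscB psc1 psc_tM subr0.
have tX0 : psge0 (pst ^+ r * dI) by apply: psge0M => //; apply: psge0X psge0_t.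
have XE : X = ((1 + pst) ^+ r - pst ^+ r) * dI - s + pst ^+ r * dI by rewrite /X; ring.
have X0 : psge0 X by rewrite XE; apply: psge0D.
have DA0 : psc DA' 0 = 1 by rewrite /DA' pscB psc1 psc_tM subr0.
have PGE : PN * G * DA' = (1 + pst) ^+ r * kN <-> PN * DA' = (1 + pst) ^+ r * kN * (1 - pst * P).
  split=> [<-|e].
    by transitivity (PN * DA' * (G * (1 - pst * P))); [rewrite GP mulr1 | ring].
  transitivity (PN * DA' * G); first by ring.
  rewrite e; transitivity ((1 + pst) ^+ r * kN * (G * (1 - pst * P))); first by ring.
  by rewrite GP mulr1.
(* D_R times the failure of the Golod equality over A *)
have key : D * (PN * DA' - (1 + pst) ^+ r * kN * (1 - pst * P)) =
    - ((1 + pst) * (dN * DA' + pst * X * kN)).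
  transitivity (- ((1 + pst) * dN * DA' +
      pst * ((1 + pst) ^+ r * ((1 + pst) * dI) - (1 + pst) * s) * kN)); last by rewrite /X; ring.
  by rewrite SN SI DA; ring.
rewrite PGE; split=> [e|[dN0 dI0]].
  have : dN * DA' + pst * X * kN = 0.
    apply: onet_inj; rewrite mulr0; apply/eqP; rewrite -oppr_eq0 -key e subrr mulr0 //.
  move=> /ps_low_pos[]; rewrite ?DA0 //; first exact: (psge0M psge0_t X0).
  move=> dN0 tX; split=> //.
  have X00 : X = 0.
    by apply: psP => i; have := congr1 (fun f => psc f i.+1) tX; rewrite psc_tM !psc0.
  have tr0 : pst ^+ r * dI = 0.
    apply: psP => i; apply/eqP; rewrite psc0 eq_le tX0 andbT.
    by have := s_le i; have := congr1 (fun f => psc f i) XE; rewrite X00 psc0 pscD; lia.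
  elim: (r) tr0 => [|q IH]; first by rewrite mul1r.
  move=> e0; apply: IH; apply: psP => i.
  by have := congr1 (fun f => psc f i.+1) e0; rewrite exprS -mulrA psc_tM !psc0.
apply/eqP; rewrite -subr_eq0; apply/eqP/(@ps_mulI0 _ D); first by rewrite D0.
have s00 : s = 0.
  apply: psP => i; rewrite psc0; apply/eqP; rewrite eq_le s0 andbT.
  by have := s_le i; rewrite dI0 mulr0 pscB psc0 sub0r oppr_ge0.
by rewrite mulrC key /X dN0 dI0 s00 mulr0 subrr mulr0 !mul0r addr0 mulr0 oppr0.
Qed.

(** The residue field of A is that of R restricted along p, and it is Golod over
    R as soon as I is (golod_residue_field). *)
Lemma golod_ring_retract : nonzero_module (kernel p) -> golod_ring A <-> golod I.
Proof.
move=> I0; have fgk := fg_kmod R.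
suff -> : golod_ring A <-> golod (restrict_scalars p (kmod R)).
  rewrite golod_restrict //; last first.
    by exists (1 : residue_field R); apply: oner_neq0.
  split=> [[]//|gI]; split=> //; exact: (golod_residue_field fgI _ gI).
have pm a : (residue_map (p a) == 0) = (residue_map a == 0).
  by rewrite !residue_map_eq0; exact: (p_in_max p_local).
pose f (u : residue_field A) : residue_field R := residue_map (p (repr u)).
pose g (u : residue_field R) : residue_field A := residue_map (j (repr u)).
have rE (S : noethLocalRingType) (a : S) : residue_map (repr (residue_map a)) = residue_map a by exact: reprK.
have fE a : f (residue_map a) = residue_map (p a).
  apply/eqP; rewrite -subr_eq0 -!rmorphB pm !rmorphB subr_eq0; exact/eqP/rE.
have gE a : g (residue_map a) = residue_map (j a).
  apply/eqP; rewrite -subr_eq0 -!rmorphB -pm pj rmorphB subr_eq0; exact/eqP/rE.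
have fl : lin (f : kmod A -> restrict_scalars p (kmod R)).
  move=> a u v; have [x <-] := residue_map_surj u; have [y <-] := residue_map_surj v.
  rewrite -[a *: _]/(residue_map a * residue_map x : residue_field A).
  rewrite -rmorphM -[_ + _]rmorphD !fE rmorphD rmorphM.
  by rewrite rmorphD rmorphM.
apply: iff_sym; rewrite -[golod_ring A]/(golod (kmod A)).
apply: (@golod_iso A (kmod A) (restrict_scalars p (kmod R)) f g _ (fg_restrict pj fgk) fl).
- exact: fg_kmod.
- move=> u; have [x <-] := residue_map_surj u; rewrite fE gE.
  by apply/eqP; rewrite -subr_eq0 -rmorphB -pm rmorphB pj subrr rmorph0.
- by move=> u; have [x <-] := residue_map_surj u; rewrite gE fE pj.
Qed.

End RetractTheorem.

Theorem theorem1p2 (R A : noethLocalRingType)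
    (j : {rmorphism R -> A}) (p p' : {rmorphism A -> R})
    (j_local : local_hom j) (p_local : local_hom p) (p'_local : local_hom p')
    (pj : cancel j p) (p'j : cancel j p')
    (I_neq0 : nonzero_module (kernel p)) (I'_neq0 : nonzero_module (kernel p'))
    (II'0 : forall (x : kernel p) (y : kernel p'),
       kernel_val x * kernel_val y = 0 :> A) :
  let I := restrict_scalars j (kernel p) in
  let I' := restrict_scalars j (kernel p') in
  [/\ golod I <-> golod I',
      forall (N : lmodType R), nonzero_module N -> fg_module N ->
        forall q : {rmorphism A -> R}, q = p \/ q = p' ->
          (golod (restrict_scalars q N) <-> golod N /\ golod I) /\
          (golod (restrict_scalars q N) <-> golod N /\ golod I')
    & (golod_ring A <-> golod I) /\ (golod_ring A <-> golod I')].
Proof.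
move=> I I'; have II' : golod I <-> golod I' := golod_kernels pj p'j II'0.
split=> // [N N0 fgN q qE|].
  suff qN : golod (restrict_scalars q N) <-> golod N /\ golod I by rewrite -II'.
  case: qE => ->; first exact: (golod_restrict j_local p_local p'_local pj p'j II'0).
  rewrite II'; exact: (golod_restrict j_local p'_local p_local p'j pj (II'0_sym II'0)).
by rewrite -II'; split; exact: (golod_ring_retract j_local p_local p'_local pj p'j II'0).
Qed.
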